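(* For almost every triangle (with respect to Lebesgue measure on the set of pairs of angles $(\alpha,\beta)$, $\alpha,\beta>0$, $\alpha+\beta<\pi$, which parametrizes triangles up to similarity) and for any $\epsilon>0$ there is a constant $C>0$ such that $P_n<Ce^{n^{\epsilon}}$ for all $n$, where $P_n$ is the number of generalized diagonals of length at most $n$ of the billiard in the triangle.
   Context: Billiard in a triangle: a point moves along straight lines inside the triangle and reflects at the sides by the rule ''angle of incidence equals angle of reflection''. A generalized diagonal is a billiard orbit which connects two vertices of the triangle (it starts at a vertex and ends at a vertex; sides of the triangle themselves are not counted). Its (algebraic) length is the number of reflections it makes at the sides. $P_n$ denotes the number of generalized diagonals of length no greater than $n$. *)

(* Defs.v *)
From HB Require Import structures.
From mathcomp Require Import all_boot all_order all_algebra.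
From mathcomp Require Import all_classical all_reals all_analysis.

Set Implicit Arguments.
Unset Strict Implicit.
Unset Printing Implicit Defensive.

Import Order.TTheory GRing.Theory Num.Theory.
Import numFieldNormedType.Exports.

Local Open Scope classical_set_scope.
Local Open Scope ring_scope.

(* The norm `|.| of the library on 'rV[R]_2 is the max norm, hence the explicit
   Euclidean structure. *)
Definition dotv (R : realType) (u v : 'rV[R]_2) : R := (u *m v^T) 0 0.

Definition euclid (R : realType) (u : 'rV[R]_2) : R := Num.sqrt (dotv u u).

(* The unoriented angle at [y] between the rays [yx) and [yz), in [0, pi]. *)
Definition angle (R : realType) (x y z : 'rV[R]_2) : R :=
  acos (dotv (x - y) (z - y) / (euclid (x - y) * euclid (z - y))).

Definition open_segment (R : realType) (x y : 'rV[R]_2) : set 'rV[R]_2 :=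
  [set z | exists2 t : R, 0 < t < 1 & z = (1 - t) *: x + t *: y].

(* A triangle is given by its three vertices, indexed by 'I_3; indices are
   added modulo 3. *)
Definition noncollinear (R : realType) (T : 'I_3 -> 'rV[R]_2) : bool :=
  row_free (col_mx (T 1 - T 0) (T 2%:R - T 0)).

Definition triangle_interior (R : realType) (T : 'I_3 -> 'rV[R]_2) :
    set 'rV[R]_2 :=
  [set z | exists w : 'I_3 -> R,
     [/\ forall i, 0 < w i, \sum_i w i = 1 & z = \sum_i w i *: T i]].

(* The side opposite to the vertex [T i], without its end points. *)
Definition side (R : realType) (T : 'I_3 -> 'rV[R]_2) (i : 'I_3) :
    set 'rV[R]_2 :=
  open_segment (T (i + 1)) (T (i + 2%:R)).

(* The angle of incidence and the angle of reflection are measured from the two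
   opposite rays of the side at [y]. Since [x] and [z] lie in the same half-plane
   bounded by the line through that side, their equality is the law of
   reflection. *)
Definition reflects (R : realType) (T : 'I_3 -> 'rV[R]_2)
    (x y z : 'rV[R]_2) : Prop :=
  exists2 i : 'I_3, side T i y &
    angle x y (T (i + 1)) = angle z y (T (i + 2%:R)).

(* A finite piece of billiard orbit, as the sequence of its successive points on
   the boundary; reflections occur at all points but the first and the last. *)
Definition billiard_orbit (R : realType) (T : 'I_3 -> 'rV[R]_2)
    (s : seq 'rV[R]_2) : Prop :=
  [/\ (2 <= size s)%N,
      forall k : nat, (k.+1 < size s)%N ->
        open_segment s`_k s`_k.+1 `<=` triangle_interior T
    & forall k : nat, (k.+2 < size s)%N ->
        reflects T s`_k s`_k.+1 s`_k.+2].

Definition reflections (R : realType) (s : seq 'rV[R]_2) : nat := size s - 2.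

(* The sides of the triangle are excluded by [billiard_orbit], which requires
   the segments to run through the interior. *)
Definition generalized_diagonal (R : realType) (T : 'I_3 -> 'rV[R]_2)
    (s : seq 'rV[R]_2) : Prop :=
  [/\ billiard_orbit T s, range T (head 0 s) & range T (last 0 s)].

(* [counting] is +oo on infinite sets, so that an upper bound on this number
   includes its finiteness. *)
Definition num_generalized_diagonals (R : realType) (T : 'I_3 -> 'rV[R]_2)
    (n : nat) : \bar R :=
  counting [set s : seq 'rV[R]_2 |
    generalized_diagonal T s /\ (reflections s <= n)%N].

(* Main.v *)
Require Import Defs.
From HB Require Import structures.
From mathcomp Require Import all_boot all_order all_algebra.
From mathcomp Require Import all_classical all_reals all_analysis.
From mathcomp Require Import measurable_realfun complex.
From mathcomp Require Import ring lra zify.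

Set Implicit Arguments.
Unset Strict Implicit.
Unset Printing Implicit Defensive.

Import Order.TTheory GRing.Theory Num.Theory.
Import numFieldNormedType.Exports.
Import ComplexField.Normc.

(** A trajectory that starts at a vertex is followed along a straight line, by
    reflecting the triangle in each side that it crosses. It is determined by
    the point of the first crossed side, a coordinate between 0 and 1, and it is
    described by a word, which says for each crossed triangle whether the line
    leaves it through its right or its left side. Generalized diagonals are
    coded injectively by their starting triangle and their word
    ([diagonal_word]), so that it suffices to bound the number [f n] of words of
    length at most [n] that lead to a vertex. The proof derives
    [f n + 1 <= A * (n + 1) ^ 6 * (f (n / 2) + 1)] for almost all angles
    ([num_diagonals_recursion]); such a function grows more slowly than
    [expR (n `^ eps)] for every positive [eps] ([weakly_exponential]).

    Take two trajectories of length at most [n] from the same vertex [O], with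
    neighbouring directions, and let [W] and [W'] be their end points in the
    unfolded plane. No vertex is met in between, so the segment from [W] to [W']
    is a side of a triangle, or it is itself a trajectory between two vertices,
    whose length is at most the difference of the two lengths ([visible]). The
    unfolded triangles are images of the first one by isometries whose linear
    parts are products of powers of three fixed rotations, with exponents between
    [- n] and [n], up to a conjugation ([placed_congruent]). If the lengths
    differ by at most [n / 2], the vector from [W] to [W'] is therefore one of at
    most [O (n ^ 3) * (f (n / 2) + 9)] vectors ([visible_step]); if they do not,
    one of the two trajectories has length at most [n / 2]. Moreover the distance
    between the two directions, unless it exceeds a constant times [1 / n], is at
    least a constant times [1 / n] times the distance from them to the direction
    of that vector ([direction_close]).

    It remains to bound the number of gaps between neighbouring directions that
    are comparable to their distance to a given point. As such gaps grow
    geometrically away from the point, there are at most logarithmically many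
    of them with respect to the smallest gap ([count_gaps]), and this is where
    the angles come in: for almost all angles, directions of trajectories of
    length at most [n] differ by at least [expR (- (B * n ^ 2))]
    ([separation_of_comparisons]). Indeed the coordinate of a trajectory is a
    quotient of polynomials with integer coefficients and degree [O (n)] in the
    cotangents of the angles, and the difference of two coordinates has a
    non-zero integer polynomial as numerator. A non-zero integer polynomial has
    a leading coefficient of absolute value at least 1, hence it is small only
    near few points ([small_set_le]). There are exponentially many polynomials
    to consider, and the lemma of Borel and Cantelli applies ([ae_not_small]). *)

Local Open Scope ring_scope.

(** * Unfolding a triangle *)

Section Unfolding.
Variable K : comNzRingType.

(** An affine function is encoded by its values [F] at the three vertices. The
    coefficients [m j] are the barycentric coordinates, multiplied by a common
    denominator [D], of the mirror image of the vertex [j] in the opposite side;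
    [crossing] thus gives [D] times the values of the function at the vertices
    of the triangle reflected in that side. *)
Definition crossing (D : K) (m : 'I_3 -> 'I_3 -> K) (j : 'I_3)
    (F : 'I_3 -> K) : 'I_3 -> K :=
  fun k => if k == j then \sum_i m j i * F i else D * F k.

Definition unfolding (D : K) (m : 'I_3 -> 'I_3 -> K) (F : 'I_3 -> K)
    (js : seq 'I_3) : 'I_3 -> K :=
  foldl (fun F j => crossing D m j F) F js.

End Unfolding.

(** An unfolded triangle together with the side through which it was entered:
    the opposite vertex, then the left and the right end of that side. *)
Definition state : Type := ('I_3 * 'I_3 * 'I_3)%type.
Definition apex (st : state) : 'I_3 := st.1.1.
Definition side_end (st : state) (b : bool) : 'I_3 := if b then st.2 else st.1.2.
(** The next triangle when the line has the apex on its right ([b = true]) or on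
    its left. The apex replaces the end [side_end st b] of the crossed side, and
    the mirror image of that end is the new apex. *)
Definition turn (b : bool) (st : state) : state :=
  if b then (st.2, st.1.2, st.1.1) else (st.1.2, st.1.1, st.2).
Definition mirror (st : state) : state := (st.1.1, st.2, st.1.2).
Definition proper (st : state) : bool :=
  [&& st.1.1 != st.1.2, st.1.1 != st.2 & st.1.2 != st.2].

Fixpoint letters (st : state) (w : seq bool) : seq 'I_3 :=
  if w is b :: w' then side_end st b :: letters (turn b st) w' else [::].

Definition final (st : state) (w : seq bool) : state :=
  foldl (fun st b => turn b st) st w.

Lemma letters_cat st w u :
  letters st (w ++ u) = letters st w ++ letters (final st w) u.
Proof. by elim: w st => //= b w IH st; rewrite IH. Qed.

Lemma final_cat st w u : final st (w ++ u) = final (final st w) u.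
Proof. by rewrite /final foldl_cat. Qed.

Lemma size_letters st w : size (letters st w) = size w.
Proof. by elim: w st => //= b w IH st; rewrite IH. Qed.

Lemma proper_turn b st : proper st -> proper (turn b st).
Proof.
case: st b => [[i l] r] [] /and3P[/= il ir lr]; apply/and3P; split => //=;
by rewrite eq_sym.
Qed.

Lemma proper_mirror st : proper st -> proper (mirror st).
Proof.
case: st => [[i l] r] /and3P[/= il ir lr]; apply/and3P; split => //=.
by rewrite eq_sym.
Qed.

Lemma proper_final st w : proper st -> proper (final st w).
Proof. by elim: w st => //= b w IH st /(proper_turn b)/IH. Qed.

Lemma turn_mirror b st : turn b (mirror st) = mirror (turn (~~ b) st).
Proof. by case: b. Qed.

Lemma side_end_mirror b st : side_end (mirror st) b = side_end st (~~ b).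
Proof. by case: b. Qed.

Lemma final_mirror st w : final (mirror st) w = mirror (final st (map negb w)).
Proof. by elim: w st => //= b w IH st; rewrite turn_mirror IH. Qed.

Lemma proper_third st k : proper st ->
  k != apex st -> k != side_end st false -> k = side_end st true.
Proof.
case: st => [[i l] r] /and3P[/= il ir lr] ki kl; apply/eqP/contraT => kr.
have : uniq [:: i; l; r; k].
  by rewrite /= !inE !negb_or il ir lr ![_ == k]eq_sym ki kl kr.
move/card_uniqP => /= h; have := max_card (mem [:: i; l; r; k]).
by rewrite h card_ord.
Qed.

Lemma sum_proper (V : nmodType) st (f : 'I_3 -> V) : proper st ->
  \sum_i f i = f (apex st) + f (side_end st false) + f (side_end st true).
Proof.
move=> pst; have /and3P[il ir lr] := pst.
move: pst; case: st il ir lr => [[i l] r] /= il ir lr pst.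
rewrite (bigD1 i) //= (bigD1 l) 1?eq_sym //= (bigD1 r) /=; last first.
  by rewrite eq_sym ir eq_sym lr.
rewrite big1 ?addr0 ?addrA // => k /andP[/andP[ki kl]].
by rewrite (proper_third pst ki kl) eqxx.
Qed.

Section Linearity.
Variables (K : comNzRingType) (D : K) (m : 'I_3 -> 'I_3 -> K).

Lemma unfolding_cat F js ks :
  unfolding D m F (js ++ ks) = unfolding D m (unfolding D m F js) ks.
Proof. exact: foldl_cat. Qed.

Lemma crossingD j (a b : K) F G :
  crossing D m j (fun k => a * F k + b * G k) =
  (fun k => a * crossing D m j F k + b * crossing D m j G k).
Proof.
apply/funext => k; rewrite /crossing; case: ifP => _; last by ring.
rewrite !mulr_sumr -big_split /=; apply: eq_bigr => i _; ring.
Qed.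

Lemma unfoldingD js (a b : K) F G :
  unfolding D m (fun k => a * F k + b * G k) js =
  (fun k => a * unfolding D m F js k + b * unfolding D m G js k).
Proof. by elim: js F G => //= j js IH F G; rewrite crossingD IH. Qed.

Lemma crossing_scale j (a : K) F :
  crossing D m j (fun k => a * F k) = (fun k => a * crossing D m j F k).
Proof.
apply/funext => k; rewrite /crossing; case: ifP => _; last by ring.
by rewrite mulr_sumr; apply: eq_bigr => i _; ring.
Qed.

Lemma unfolding_scale js (a : K) F :
  unfolding D m (fun k => a * F k) js = (fun k => a * unfolding D m F js k).
Proof. by elim: js F => //= j js IH F; rewrite crossing_scale IH. Qed.

End Linearity.

Lemma unfolding_rmorph (K L : comNzRingType) (f : {rmorphism K -> L})
    (D : K) (m : 'I_3 -> 'I_3 -> K) js F :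
  unfolding (f D) (fun j k => f (m j k)) (fun k => f (F k)) js =
  (fun k => f (unfolding D m F js k)).
Proof.
elim: js F => //= j js IH F; rewrite -IH; congr (foldl _ _ _).
apply/funext => k; rewrite /crossing; case: ifP => _; last by rewrite rmorphM.
by rewrite rmorph_sum; apply: eq_bigr => i _; rewrite rmorphM.
Qed.

(** * Directions that follow a word *)

Section Following.
Variable R : realFieldType.
Variable m : 'I_3 -> 'I_3 -> R.
Hypothesis m_diag : forall j, m j j = -1.
Hypothesis m_sum : forall j, \sum_i m j i = 1.

Local Notation cross_ := (crossing 1 m).

Lemma crossing_const j a : cross_ j (fun=> a) = fun=> a.
Proof.
apply/funext => k; rewrite /crossing; case: ifP => _; last by rewrite mul1r.
by rewrite -mulr_suml m_sum mul1r.
Qed.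

Lemma unfolding_const js a : unfolding 1 m (fun=> a) js = fun=> a.
Proof. by elim: js => //= j js IH; rewrite crossing_const. Qed.

Definition sgb (b : bool) : R := if b then 1 else -1.

Lemma sgbN b : sgb (~~ b) = - sgb b.
Proof. by case: b; rewrite /sgb ?opprK. Qed.

(** [F] vanishes on a line that crosses the entry side of [st], with negative
    values on its left. The line passes on the side of the apex told by the sign
    of [F] there, and the word ends where the line meets a vertex. *)
Fixpoint follows (st : state) (F : 'I_3 -> R) (w : seq bool) : bool :=
  if w is b :: w' then
    (0 < sgb b * F (apex st)) &&
      follows (turn b st) (cross_ (side_end st b) F) w'
  else F (apex st) == 0.

(** The affine function that vanishes on the line from the apex to the point of
    the opposite side with coordinate [x]. *)
Definition slope (st : state) (x : R) : 'I_3 -> R :=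
  fun k => if k == apex st then 0
           else if k == side_end st false then - x else 1 - x.

(** The trajectory starts at the apex and crosses the opposite side at the
    coordinate [x]. *)
Definition hits (st : state) (x : R) (w : seq bool) : bool :=
  [&& 0 < x, x < 1 & follows st (cross_ (apex st) (slope st x)) w].

Definition mix (t : R) (F G : 'I_3 -> R) : 'I_3 -> R :=
  fun k => (1 - t) * F k + t * G k.

Lemma crossing_mix j t F G : cross_ j (mix t F G) = mix t (cross_ j F) (cross_ j G).
Proof. exact: crossingD. Qed.

Lemma follows_scale st F w (a : R) : 0 < a ->
  follows st (fun k => a * F k) w = follows st F w.
Proof.
move=> a0; elim: w st F => [|b w IH] st F /=.
  by rewrite mulf_eq0 (gt_eqF a0).
by rewrite mulrCA pmulr_rgt0 // crossing_scale IH.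
Qed.

Lemma follows_mirror st F w :
  follows (mirror st) (fun k => - F k) (map negb w) = follows st F w.
Proof.
elim: w st F => [|b w IH] st F /=; first by rewrite oppr_eq0.
rewrite sgbN mulNr mulrN opprK turn_mirror side_end_mirror negbK.
congr (_ && _); rewrite -IH; congr follows; apply/funext => k.
have -> : (fun k => - F k) = (fun k => -1 * F k) by apply/funext => i; rewrite mulN1r.
by rewrite crossing_scale mulN1r.
Qed.

Lemma hits_mirror st x w : proper st ->
  hits (mirror st) (1 - x) (map negb w) = hits st x w.
Proof.
move=> pst; have /and3P[il ir lr] := pst.
rewrite /hits subr_gt0 ltrBlDr ltrDl.
rewrite andbA (andbC (x < 1)) -andbA; congr [&& _, _ & _].
rewrite -[RHS]follows_mirror; congr follows; apply/funext => k.
have -> : slope (mirror st) (1 - x) = (fun k => -1 * slope st x k).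
  apply/funext => i; rewrite /slope /apex [side_end _ _]/=.
  case: eqVneq => [_|ii]; first by rewrite mulr0.
  rewrite /mirror /=; case: (eqVneq i st.1.2) => [->|il'].
    by rewrite (negbTE lr); ring.
  by rewrite (proper_third pst ii il') eqxx; ring.
by rewrite crossing_scale mulN1r.
Qed.

Lemma sign_change (a c : R) (b : bool) : 0 < sgb b * c -> sgb b * a < 0 ->
  exists2 t, 0 < t < 1 & (1 - t) * a + t * c = 0.
Proof.
move=> c0 a0; exists (a / (a - c)); last first.
  field; apply/eqP => ac; move: c0 a0; have -> : c = a by lra.
  by case: b; rewrite /sgb; lra.
case: b c0 a0; rewrite /sgb ?mul1r ?mulN1r ?oppr_gt0 ?oppr_lt0 => c0 a0.
  rewrite -mulrNN -invrN divr_gt0 ?ltr_pdivrMr; lra.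
rewrite divr_gt0 ?ltr_pdivrMr; lra.
Qed.

Lemma sgb_mix t b (x y : R) : 0 < t < 1 -> 0 <= sgb b * x -> 0 < sgb b * y ->
  0 < sgb b * ((1 - t) * x + t * y).
Proof.
move=> /andP[t0 t1] x0 y0.
have -> : sgb b * ((1 - t) * x + t * y) = (1 - t) * (sgb b * x) + t * (sgb b * y).
  by ring.
by apply: ltr_wpDl; [apply: mulr_ge0 => //; lra | exact: mulr_gt0].
Qed.

(** If two words branch at some vertex, then the two affine functions have
    opposite signs there, and some mixture of them vanishes at that vertex. *)
Lemma follows_branch w w' st F F' : follows st F w -> follows st F' w' ->
  [\/ prefix w w', prefix w' w |
    exists t u, [/\ 0 < t < 1, (size u < size w)%N & follows st (mix t F F') u]].
Proof.
elim: w w' st F F' => [|b w IH] [|b' w'] st F F'; try by [constructor 1 | constructor 2].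
move=> /= /andP[Fb Fw] /andP[Fb' Fw'].
have [eb|nb] := eqVneq b b'; last first.
  constructor 3; have a0 : sgb b' * F (apex st) < 0.
    by move: Fb; case: (b) nb; case: (b') => // _; rewrite /sgb; lra.
  have [t t01 ht] := sign_change Fb' a0.
  by exists t, [::]; split => //=; rewrite /mix ht.
rewrite -eb in Fb' Fw' *; have [p|p|[t [u [t01 su fu]]]] := IH _ _ _ _ Fw Fw'.
- by constructor 1.
- by constructor 2.
- constructor 3; exists t, (b :: u); split => //=.
  by rewrite crossing_mix fu andbT sgb_mix // ltW.
Qed.

Fixpoint weakly_follows (st : state) (F : 'I_3 -> R) (w : seq bool) : bool :=
  if w is b :: w' then
    (0 <= sgb b * F (apex st)) &&
      weakly_follows (turn b st) (cross_ (side_end st b) F) w'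
  else true.

(** At the first apex where [F] has strictly the wrong sign, some mixture of [F]
    and [F'] vanishes. *)
Lemma weakly_follows_or w st F F' : follows st F' w ->
  weakly_follows st F w \/
  exists t u, [/\ 0 < t < 1, (size u < size w)%N & follows st (mix t F F') u].
Proof.
elim: w st F F' => [|b w IH] st F F' /=; first by left.
move=> /andP[Fb' Fw'].
have [Fb|Fb] := leP 0 (sgb b * F (apex st)); last first.
  right; have [t t01 ht] := sign_change Fb' Fb.
  by exists t, [::]; split => //=; rewrite /mix ht.
have [->|[t [u [t01 su fu]]]] := IH _ (cross_ (side_end st b) F) _ Fw'; first by left.
right; exists t, (b :: u); split => //=.
by rewrite crossing_mix fu andbT sgb_mix.
Qed.

(** * The segment between two vertices seen in neighbouring directions *)

(** The pair [(F, G)] maps the unfolded plane affinely to the coordinate plane.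
    This is the determinant of two edges of the triangle in these coordinates,
    which gives its orientation. *)
Definition orient (st : state) (F G : 'I_3 -> R) : R :=
  (F (side_end st true) - F (side_end st false)) *
    (G (apex st) - G (side_end st false)) -
  (G (side_end st true) - G (side_end st false)) *
    (F (apex st) - F (side_end st false)).

Lemma side_end_turn b st : side_end (turn b st) b = apex st.
Proof. by case: b. Qed.
Lemma side_end_turnN b st : side_end (turn b st) (~~ b) = side_end st (~~ b).
Proof. by case: b. Qed.
Lemma apex_turn b st : apex (turn b st) = side_end st b.
Proof. by case: b. Qed.

Lemma crossing_id j F k : k != j -> cross_ j F k = F k.
Proof. by move=> kj; rewrite /crossing (negbTE kj) mul1r. Qed.

Lemma crossing_apex b st F : proper st ->
  cross_ (side_end st b) F (apex st) = F (apex st).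
Proof. by case: b => /and3P[h1 h2 h3]; apply: crossing_id. Qed.

Lemma crossing_other b st F : proper st ->
  cross_ (side_end st b) F (side_end st (~~ b)) = F (side_end st (~~ b)).
Proof. by case: b => /and3P[h1 h2 h3]; apply: crossing_id => //=; rewrite eq_sym. Qed.

Lemma crossing_side b st : proper st -> exists c : R, forall F : 'I_3 -> R,
  cross_ (side_end st b) F (side_end st b) =
  - F (side_end st b) + c * F (apex st) + (2 - c) * F (side_end st (~~ b)).
Proof.
move=> pst; exists (m (side_end st b) (apex st)) => G.
have := m_sum (side_end st b); have := m_diag (side_end st b).
rewrite /crossing eqxx !(sum_proper _ pst); case: b => /= -> h.
  have -> : m st.2 st.1.2 = 2 - m st.2 (apex st) by move: h; rewrite /apex /=; lra.
  by rewrite /apex /=; ring.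
have -> : m st.1.2 st.2 = 2 - m st.1.2 (apex st) by move: h; rewrite /apex /=; lra.
by rewrite /apex /=; ring.
Qed.

Lemma orient_turn b st F G : proper st ->
  orient (turn b st) (cross_ (side_end st b) F) (cross_ (side_end st b) G) =
  orient st F G.
Proof.
move=> pst; have [c hc] := crossing_side b pst.
have e1 := crossing_apex b _ pst; have e2 := crossing_other b _ pst.
rewrite /orient; case: b hc e1 e2 => /= hc e1 e2;
 rewrite /apex /= -?/(apex st) !hc !e1 !e2 /=; ring.
Qed.

Lemma hits_functional st G w : proper st ->
  G (apex st) = 0 -> G (side_end st false) < 0 -> 0 < G (side_end st true) ->
  follows st (cross_ (apex st) G) w -> exists x, hits st x w.
Proof.
move=> pst G0 Gl Gr Gw; set c := G (side_end st true) - G (side_end st false).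
have c0 : 0 < c by rewrite /c; lra.
have cN0 : c != 0 by rewrite gt_eqF.
exists (- G (side_end st false) / c); apply/and3P; split.
- by rewrite divr_gt0 // oppr_gt0.
- by rewrite ltr_pdivrMr // /c; lra.
- have /and3P[il ir lr] := pst.
  rewrite -(follows_scale _ _ _ c0) -crossing_scale.
  suff -> : (fun k => c * slope st (- G (side_end st false) / c) k) = G by [].
  apply/funext => k; rewrite /slope; case: (eqVneq k (apex st)) => [->|ki].
    by rewrite G0 mulr0.
  case: (eqVneq k (side_end st false)) => [->|kl]; first by field.
  by rewrite (proper_third pst ki kl) /c; field.
Qed.

Lemma orient_frontR (sl sr st pl pr pt B : R) : sl <= 0 -> 0 < sr -> 0 < B ->
  (sr - sl) * (pt - pl) - (pr - pl) * (st - sl) < 0 ->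
  (sr - sl) * B + sr * pl - pr * sl <= 0 ->
  0 < pt -> st != 0.
Proof.
move=> sl0 sr0 B0 o n pt0; apply/eqP => st0; rewrite st0 in o.
have : 0 < (sr - sl) * (pt + B) by rewrite mulr_gt0 //; lra.
nra.
Qed.

Lemma ltr_pM2l_lt0 (d y : R) : 0 < d -> d * y < 0 -> y < 0.
Proof. by move=> d0; rewrite pmulr_rlt0. Qed.

Lemma ltr_pM2l_gt0 (d y : R) : 0 < d -> 0 < d * y -> 0 < y.
Proof. by move=> d0; rewrite pmulr_rgt0. Qed.

(** In the coordinates [(F, F')], these determinants tell on which side of the
    line through the entry side the points [(0, - B)] and [(A, 0)] lie: the
    first one is behind that line if [behind] is negative, the second one is
    beyond it if [beyond] is positive, provided that [orient] is negative. *)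
Definition behind (st : state) (F F' : 'I_3 -> R) (B : R) : R :=
  (F (side_end st true) - F (side_end st false)) * B +
  F (side_end st true) * F' (side_end st false) -
  F' (side_end st true) * F (side_end st false).

Definition beyond (st : state) (F F' : 'I_3 -> R) (A : R) : R :=
  (F' (side_end st true) - F' (side_end st false)) * A +
  F (side_end st true) * F' (side_end st false) -
  F' (side_end st true) * F (side_end st false).

Definition straddles (st : state) (F : 'I_3 -> R) : bool :=
  (F (side_end st false) < 0) && (0 < F (side_end st true)).

(** The line may also pass through the left end of the side, which happens when
    that end is the vertex where it stopped. *)
Definition half_straddles (st : state) (F : 'I_3 -> R) : bool :=
  (F (side_end st false) <= 0) && (0 < F (side_end st true)).

Lemma straddles_turn b st F : proper st -> straddles st F ->
  0 < sgb b * F (apex st) -> straddles (turn b st) (cross_ (side_end st b) F).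
Proof.
move=> pst /andP[Fl Fr] Fb; have e1 := crossing_apex b F pst.
have e2 := crossing_other b F pst; rewrite /straddles.
by case: b Fb e1 e2; rewrite /sgb ?mul1r ?mulN1r ?oppr_gt0 /apex /= => Fb -> ->;
  rewrite ?Fl ?Fb ?Fr.
Qed.

Lemma half_straddles_turn b st F F' B : proper st -> half_straddles st F ->
  0 < B -> orient st F F' < 0 -> behind st F F' B <= 0 ->
  0 <= sgb b * F (apex st) -> 0 < sgb b * F' (apex st) ->
  half_straddles (turn b st) (cross_ (side_end st b) F).
Proof.
move=> pst /andP[Fl Fr] B0 o n Fb Fb'; have e1 := crossing_apex b F pst.
have e2 := crossing_other b F pst; rewrite /half_straddles.
case: b Fb Fb' e1 e2; rewrite /sgb ?mul1r ?mulN1r ?oppr_ge0 ?oppr_gt0.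
  move=> Fb Fb' e1 e2; have := orient_frontR Fl Fr B0 o n Fb'.
  by move: e1 e2; rewrite /apex /= => -> ->; rewrite Fl lt_def Fb andbT.
by move=> Fb _; rewrite /apex /= => -> ->; rewrite Fb Fr.
Qed.

Lemma behind_turnE b st F F' B : proper st ->
  (F (side_end st true) - F (side_end st false)) *
    behind (turn b st) (cross_ (side_end st b) F) (cross_ (side_end st b) F') B =
  (if b then F (apex st) - F (side_end st false)
   else F (side_end st true) - F (apex st)) * behind st F F' B +
  (if b then - F (side_end st false) else F (side_end st true)) * orient st F F'.
Proof.
move=> pst; have e1 := crossing_apex b _ pst; have e2 := crossing_other b _ pst.
rewrite /behind /orient; case: b e1 e2 => e1 e2;
  by move: e1 e2; rewrite /apex /= => e1 e2; rewrite !e1 !e2; ring.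
Qed.

Lemma behind_turn_le b st F F' B : proper st ->
  half_straddles st F -> orient st F F' < 0 -> behind st F F' B <= 0 ->
  0 <= sgb b * F (apex st) ->
  behind (turn b st) (cross_ (side_end st b) F) (cross_ (side_end st b) F') B <= 0.
Proof.
move=> pst /andP[Fl Fr] o n Fb.
have D0 : 0 < F (side_end st true) - F (side_end st false) by lra.
rewrite -(pmulr_rle0 _ D0) behind_turnE //.
case: b Fb; rewrite /sgb ?mul1r ?mulN1r => Fb.
  have h1 : (F (apex st) - F (side_end st false)) * behind st F F' B <= 0.
    by rewrite mulr_ge0_le0 //; lra.
  have h2 : 0 <= F (side_end st false) * orient st F F' by rewrite mulr_le0 // ltW.
  lra.
have h1 : (F (side_end st true) - F (apex st)) * behind st F F' B <= 0.
  by rewrite mulr_ge0_le0 //; lra.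
have h2 : F (side_end st true) * orient st F F' < 0 by rewrite pmulr_rlt0.
lra.
Qed.

Lemma behind_turn_lt b st F F' B : proper st ->
  half_straddles st F -> orient st F F' < 0 -> behind st F F' B <= 0 ->
  0 <= sgb b * F (apex st) -> (b -> F (apex st) != 0 /\ behind st F F' B < 0) ->
  behind (turn b st) (cross_ (side_end st b) F) (cross_ (side_end st b) F') B < 0.
Proof.
move=> pst /andP[Fl Fr] o n Fb nb.
have D0 : 0 < F (side_end st true) - F (side_end st false) by lra.
rewrite -(pmulr_rlt0 _ D0) behind_turnE //.
case: b Fb nb; rewrite /sgb ?mul1r ?mulN1r => Fb nb.
  have [Fn0 nb0] := nb isT; have Fb0 : 0 < F (apex st) by rewrite lt_def Fn0.
  have h1 : (F (apex st) - F (side_end st false)) * behind st F F' B < 0.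
    by rewrite pmulr_rlt0 //; lra.
  have h2 : 0 <= F (side_end st false) * orient st F F' by rewrite mulr_le0 // ltW.
  lra.
have h1 : (F (side_end st true) - F (apex st)) * behind st F F' B <= 0.
  by rewrite mulr_ge0_le0 //; lra.
have h2 : F (side_end st true) * orient st F F' < 0 by rewrite pmulr_rlt0.
lra.
Qed.

Lemma beyond_turn b st F F' A : proper st ->
  straddles st F' -> orient st F F' < 0 -> 0 < sgb b * F' (apex st) ->
  0 < beyond (turn b st) (cross_ (side_end st b) F) (cross_ (side_end st b) F') A ->
  0 < beyond st F F' A.
Proof.
move=> pst /andP[Fl Fr] o Fb.
have e1 := crossing_apex b _ pst; have e2 := crossing_other b _ pst.
have D0 : 0 < F' (side_end st true) - F' (side_end st false) by lra.
move: o Fb Fl Fr D0; rewrite /orient /beyond.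
case: b e1 e2; rewrite /sgb ?mul1r ?mulN1r /apex /= => e1 e2 o Fb Fl Fr D0;
  rewrite !e1 !e2 /=; set o1 := (_ - _) in o; set n1 := (X in 0 < X) => n0.
  have E0 : 0 < F' st.1.1 - F' st.1.2 by lra.
  apply: (ltr_pM2l_gt0 E0).
  have h1 : 0 < (F' st.2 - F' st.1.2) * n1 by rewrite mulr_gt0.
  have h2 : 0 < F' st.1.2 * o1 by rewrite nmulr_rgt0.
  set n2 := (X in 0 < X).
  have -> : n2 = (F' st.2 - F' st.1.2) * n1 + F' st.1.2 * o1.
    by rewrite /n2 /n1 /o1; ring.
  by lra.
have E0 : 0 < F' st.2 - F' st.1.1 by lra.
apply: (ltr_pM2l_gt0 E0).
have h1 : 0 < (F' st.2 - F' st.1.2) * n1 by rewrite mulr_gt0.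
have h2 : F' st.2 * o1 < 0 by rewrite pmulr_rlt0.
set n2 := (X in 0 < X).
have -> : n2 = (F' st.2 - F' st.1.2) * n1 - F' st.2 * o1.
  by rewrite /n2 /n1 /o1; ring.
by lra.
Qed.

(** The affine function that vanishes on the line through the points with
    [(F, F') = (0, - B)] and [(F, F') = (A, 0)]. *)
Definition chord (A B : R) (F F' : 'I_3 -> R) : 'I_3 -> R :=
  fun k => A * F' k - B * F k + A * B.

Lemma crossing_chord j A B F F' :
  cross_ j (chord A B F F') = chord A B (cross_ j F) (cross_ j F').
Proof.
have -> : chord A B F F' =
    (fun k => 1 * (A * F' k + (- B) * F k) + A * B * 1).
  by apply/funext => k; rewrite /chord; ring.
rewrite crossingD crossing_const crossingD.
by apply/funext => k; rewrite /chord; ring.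
Qed.

Lemma straddles_chord st F F' A B : 0 < A -> 0 < B ->
  half_straddles st F -> straddles st F' ->
  behind st F F' B < 0 -> 0 < beyond st F F' A -> straddles st (chord A B F F').
Proof.
move=> A0 B0 /andP[]; rewrite /straddles /chord /behind /beyond.
set sl := F _; set sr := F _; set pl := F' _; set pr := F' _.
move=> sl0 sr0 /andP[pl0 pr0] n p; set d := A * (pr - pl) - B * (sr - sl).
have d0 : 0 < d by rewrite /d; lra.
apply/andP; split.
  have D0 : 0 < sr - sl by lra.
  apply: (ltr_pM2l_lt0 D0).
  have h1 : sl * d <= 0 by rewrite mulr_le0_ge0 // ltW.
  have h2 : 0 < A * ((pr - pl) * A + sr * pl - pr * sl) by rewrite mulr_gt0.
  have h3 : A * ((sr - sl) * B + sr * pl - pr * sl) < 0 by rewrite pmulr_rlt0.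
  have -> : (sr - sl) * (A * pl - B * sl + A * B) =
    sl * d + A * ((sr - sl) * B + sr * pl - pr * sl) by rewrite /d; ring.
  by lra.
have D0 : 0 < pr - pl by lra.
apply: (ltr_pM2l_gt0 D0).
have h1 : 0 < pr * d by rewrite mulr_gt0.
have h2 : 0 < B * ((pr - pl) * A + sr * pl - pr * sl) by rewrite mulr_gt0.
have -> : (pr - pl) * (A * pr - B * sr + A * B) =
  pr * d + B * ((pr - pl) * A + sr * pl - pr * sl) by rewrite /d; ring.
by lra.
Qed.

(** Each side that is entered is crossed by both lines, and it separates the two
    ends of the chord. Hence it is also crossed by the chord, which has the same
    apexes on the same sides until it meets the vertex with [F = A] and
    [F' = 0]. *)
Lemma follows_chord u st F F' A B : proper st -> 0 < A -> 0 < B ->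
  half_straddles st F -> straddles st F' -> orient st F F' < 0 ->
  behind st F F' B < 0 -> follows st F' u -> weakly_follows st F u ->
  unfolding 1 m F (letters st u) (apex (final st u)) = A ->
  [/\ 0 < beyond st F F' A, straddles st (chord A B F F') &
      follows st (chord A B F F') u].
Proof.
elim: u st F F' => [|b u IH] st F F' pst A0 B0 hF hF' o n.
  rewrite /= => /eqP F'0 _ FA.
  have p0 : 0 < beyond st F F' A.
    by move: o; rewrite /beyond /orient F'0 FA; lra.
  split => //; first exact: straddles_chord.
  by rewrite /chord F'0 FA; apply/eqP; ring.
move=> /= /andP[Fb' Fu'] /andP[Fb Fu] FA.
have nz : b -> F (apex st) != 0.
  move=> bT; move: Fb'; rewrite bT /sgb mul1r => Fb'.
  by have /andP[? ?] := hF; apply: (orient_frontR _ _ B0 o (ltW n)).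
have hF1 := half_straddles_turn pst hF B0 o (ltW n) Fb Fb'.
have hF1' := straddles_turn pst hF' Fb'.
have o1 := o; rewrite -(orient_turn b _ _ pst) in o1.
have n1 := behind_turn_lt pst hF o (ltW n) Fb (fun h => conj (nz h) n).
have [p1 c1 f1] := IH _ _ _ (proper_turn b pst) A0 B0 hF1 hF1' o1 n1 Fu' Fu FA.
have p0 := beyond_turn pst hF' o Fb' p1.
split => //; first exact: straddles_chord.
rewrite /= crossing_chord f1 andbT; move: c1; rewrite -crossing_chord.
have e1 := crossing_apex b (chord A B F F') pst.
by case: b {hF1 hF1' o1 n1 p1 f1 IH Fb Fb' nz Fu Fu' FA} e1;
  rewrite /straddles /sgb ?mul1r ?mulN1r ?oppr_gt0 /apex /= => -> /andP[].
Qed.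

(** Here the left end of the side is the first end of the chord. The triangles
    crossed next share this vertex, as long as the apexes are on the right. After
    the first apex on the left, the vertex lies behind the entry side, and the
    chord leaves it like a trajectory that starts there. *)
Lemma chord_from_left u st F F' A B : proper st -> 0 < A -> 0 < B ->
  F (side_end st false) = 0 -> F' (side_end st false) = - B ->
  0 < F (side_end st true) -> 0 < F' (side_end st true) -> orient st F F' < 0 ->
  follows st F' u -> weakly_follows st F u ->
  unfolding 1 m F (letters st u) (apex (final st u)) = A ->
  exists (r : nat) (v : seq bool), u = nseq r true ++ v /\
    (v = [::] \/ exists (u' : seq bool) (x : R), v = false :: u' /\
       hits (turn false (final st (nseq r true))) x u').
Proof.
elim: u st F F' => [|b u IH] st F F' pst A0 B0 Fl Fl' Fr Fr' o.
  by exists 0%N, [::]; split => //; left.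
move=> /= /andP[Fb' Fu'] /andP[Fb Fu] FA.
have hF : half_straddles st F by rewrite /half_straddles Fl lexx.
have hF' : straddles st F' by rewrite /straddles Fl' oppr_lt0 B0.
have n : behind st F F' B = 0 by rewrite /behind Fl Fl'; ring.
have n0 : behind st F F' B <= 0 by rewrite n.
have o1 := o; rewrite -(orient_turn b _ _ pst) in o1.
have hF1 := half_straddles_turn pst hF B0 o n0 Fb Fb'.
have hF1' := straddles_turn pst hF' Fb'.
case: b Fb' Fu' Fb Fu FA o1 hF1 hF1' => Fb' Fu' Fb Fu FA o1 hF1 hF1'.
  have e2 := crossing_other true _ pst.
  have [r [v [-> hv]]] := IH _ (cross_ (side_end st true) F) _
    (proper_turn true pst) A0 B0 (etrans (e2 F) Fl) (etrans (e2 F') Fl')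
    (proj2 (andP hF1)) (proj2 (andP hF1')) o1 Fu' Fu FA.
  by exists r.+1, v.
exists 0%N, (false :: u); split => //; right.
have n1 : behind (turn false st) (cross_ (side_end st false) F)
    (cross_ (side_end st false) F') B < 0 by apply: behind_turn_lt.
have [_ c1 f1] := follows_chord (proper_turn false pst) A0 B0 hF1 hF1' o1 n1 Fu' Fu FA.
rewrite -crossing_chord in c1 f1.
have [x hx] : exists x, hits (turn false st) x u.
  apply: (@hits_functional _ (chord A B F F')) => //; first exact: proper_turn.
  - by rewrite apex_turn /chord Fl Fl'; ring.
  - rewrite side_end_turn; have /andP[+ _] := c1.
    by rewrite side_end_turn crossing_apex.
  - rewrite (side_end_turnN false); have /andP[_] := c1.
    by rewrite (side_end_turnN false) crossing_other.
by exists u, x.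
Qed.

(** The affine function that vanishes at the starting vertex and equals 1 on the
    first crossed side. Together with the one of [slope st 0] it gives
    coordinates of the unfolded plane, see [slopeE]. *)
Definition far (st : state) : 'I_3 -> R := fun k => (k != apex st)%:R.

Lemma slopeE st x y : slope st x = fun k => 1 * slope st y k + (y - x) * far st k.
Proof.
apply/funext => k; rewrite /slope /far.
case: eqVneq => _; first by rewrite !mulr0 addr0.
by case: eqVneq => _; rewrite mulr1; ring.
Qed.

Lemma mix_slope st t x y :
  mix t (slope st x) (slope st y) = slope st ((1 - t) * x + t * y).
Proof.
apply/funext => k; rewrite /mix /slope.
by case: eqVneq => _; [|case: eqVneq => _]; ring.
Qed.

Definition at_word (st : state) (F : 'I_3 -> R) (w : seq bool) : 'I_3 -> R :=
  unfolding 1 m F (apex st :: letters st w).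

Definition vertex (st : state) (F : 'I_3 -> R) (w : seq bool) : R :=
  at_word st F w (apex (final st w)).

Lemma at_word_slope st w x y k :
  at_word st (slope st x) w k =
  at_word st (slope st y) w k + (y - x) * at_word st (far st) w k.
Proof.
by rewrite /at_word (slopeE st x y) unfoldingD mul1r.
Qed.

Lemma follows_straddles w st F : proper st -> straddles st F -> follows st F w ->
  straddles (final st w) (unfolding 1 m F (letters st w)) /\
  unfolding 1 m F (letters st w) (apex (final st w)) = 0.
Proof.
elim: w st F => [|b w IH] st F pst sF /=; first by move/eqP.
move=> /andP[Fb Fw]; apply: IH => //; first exact: proper_turn.
exact: straddles_turn.
Qed.

Lemma follows_cat w v st F : follows st F (w ++ v) ->
  follows (final st w) (unfolding 1 m F (letters st w)) v.
Proof. by elim: w st F => //= b w IH st F /andP[_ /IH]. Qed.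

Lemma follows_straddles_cat w v st F : proper st -> straddles st F ->
  follows st F (w ++ v) ->
  straddles (final st w) (unfolding 1 m F (letters st w)).
Proof.
elim: w st F => [|b w IH] st F pst sF //= /andP[Fb Fw].
by apply: IH => //; [exact: proper_turn|exact: straddles_turn].
Qed.

Lemma orient_final w st F G : proper st ->
  orient (final st w) (unfolding 1 m F (letters st w))
    (unfolding 1 m G (letters st w)) = orient st F G.
Proof.
elim: w st F G => //= b w IH st F G pst; rewrite IH ?orient_turn //.
exact: proper_turn.
Qed.

Lemma crossing_end b st F : proper st ->
  cross_ (apex st) F (side_end st b) = F (side_end st b).
Proof. by case: b => /and3P[h1 h2 h3]; apply: crossing_id; rewrite eq_sym. Qed.

Lemma slope_end b st x : proper st -> slope st x (side_end st b) = b%:R - x.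
Proof.
case: b => /and3P[/= h1 h2 h3]; rewrite /slope /apex /=.
  by rewrite eq_sym (negbTE h2) eq_sym (negbTE h3).
by rewrite eq_sym (negbTE h1) eqxx sub0r.
Qed.

Lemma straddles_slope st x : proper st -> 0 < x -> x < 1 ->
  straddles st (cross_ (apex st) (slope st x)).
Proof.
move=> pst x0 x1; rewrite /straddles !crossing_end // !slope_end //.
by rewrite sub0r oppr_lt0 subr_gt0 x0.
Qed.

Lemma orient_slope st x y : proper st ->
  orient st (cross_ (apex st) (slope st x)) (cross_ (apex st) (slope st y)) = x - y.
Proof.
move=> pst; have := m_sum (apex st); have := m_diag (apex st).
rewrite /orient !crossing_end // !slope_end // /crossing eqxx !(sum_proper _ pst).
rewrite !slope_end // /slope eqxx => -> h.
have -> : m (apex st) (side_end st true) = 2 - m (apex st) (side_end st false) by lra.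
by rewrite /=; ring.
Qed.

(** A trajectory moves away from its origin: the point where it crosses the first
    side stays behind all the sides that are entered later. *)
Lemma hits_far st x w : proper st -> hits st x w -> 1 < vertex st (far st) w.
Proof.
move=> pst /and3P[x0 x1 fw].
pose G : 'I_3 -> R := fun k => (k == apex st)%:R.
have farE : far st = fun k => 1 * 1 + -1 * G k.
  by apply/funext => k; rewrite /far /G; case: eqP => _ /=; ring.
rewrite /vertex /at_word farE unfoldingD unfolding_const.
set g := unfolding _ _ _ _ _; suff : g < 0 by lra.
rewrite {}/g /=; have pG b : cross_ (apex st) G (side_end st b) = 0.
  rewrite crossing_end // /G; have /and3P[/= h1 h2 h3] := pst.
  by case: b; rewrite /apex /= eq_sym ?(negbTE h1) ?(negbTE h2).
have oG : orient st (cross_ (apex st) (slope st x)) (cross_ (apex st) G) < 0.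
  have -> : orient st (cross_ (apex st) (slope st x)) (cross_ (apex st) G) =
      cross_ (apex st) G (apex st).
    by rewrite /orient !pG !crossing_end // !slope_end //=; ring.
  rewrite /crossing eqxx (bigD1 (apex st)) //= m_diag /G eqxx.
  by rewrite big1 ?addr0 ?mulr1 ?ltrN10 // => i /negbTE ->; rewrite mulr0.
have bG : behind st (cross_ (apex st) (slope st x)) (cross_ (apex st) G) 0 <= 0.
  by rewrite /behind !pG; lra.
have sF := straddles_slope pst x0 x1.
move: fw sF oG bG; move: (cross_ (apex st) _) => F; move: (cross_ (apex st) _) => H.
elim: w st {x x0 x1 farE pG G} pst F H => [|b w IH] st pst F H /=.
  move=> /eqP F0 /andP[sl sr] oG bG.
  have D0 : 0 < F (side_end st true) - F (side_end st false) by lra.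
  by apply: (ltr_pM2l_lt0 D0); move: oG bG; rewrite /orient /behind F0; lra.
move=> /andP[Fb Fw] sF oG bG; apply: (IH _ _ (cross_ (side_end st b) F)) => //; first exact: proper_turn.
- exact: straddles_turn.
- by rewrite orient_turn.
- have hF : half_straddles st F by case/andP: sF => h1 h2; rewrite /half_straddles ltW.
  by apply: behind_turn_le => //; exact: ltW.
Qed.

(** The coordinate of the direction is the quotient of the two coordinates of
    the final vertex. *)
Lemma hits_coord st x w : hits st x w ->
  x * vertex st (far st) w = vertex st (slope st 0) w.
Proof.
move=> /and3P[x0 x1 fw].
have : vertex st (slope st x) w = 0.
  rewrite /vertex /at_word /=.
  move: fw; move: (cross_ _ _) => F {x0 x1 x}.
  by elim: w st F => [|b w IH] st F /=; [move/eqP | case/andP=> _ /IH].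
by rewrite /vertex (at_word_slope _ _ x 0) sub0r; lra.
Qed.

Lemma hits_inj st x y w : proper st -> hits st x w -> hits st y w -> x = y.
Proof.
move=> pst hx hy; have v0 : vertex st (far st) w != 0.
  by rewrite gt_eqF // (lt_trans _ (hits_far pst hx)).
by apply: (mulIf v0); rewrite !hits_coord.
Qed.

(** Neighbouring directions among those of length at most [n]. *)
Definition isolated (st : state) (n : nat) (x x' : R) : Prop :=
  forall t u, 0 < t < 1 -> (size u <= n)%N ->
    ~~ hits st ((1 - t) * x + t * x') u.

Lemma hits_mix st t x x' u : proper st -> 0 < x < 1 -> 0 < x' < 1 -> 0 < t < 1 ->
  follows st (mix t (cross_ (apex st) (slope st x)) (cross_ (apex st) (slope st x'))) u ->
  hits st ((1 - t) * x + t * x') u.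
Proof.
move=> pst /andP[x0 x1] /andP[y0 y1] /andP[t0 t1] fu.
rewrite /hits -mix_slope crossing_mix fu andbT; apply/andP; split.
  by rewrite addr_gt0 // mulr_gt0 //; lra.
have : 0 < (1 - t) * (1 - x) + t * (1 - x').
  by rewrite addr_gt0 // mulr_gt0 //; lra.
lra.
Qed.

Lemma follows_mix_cat w u v st F F' t : 0 < t < 1 ->
  follows st F w -> follows st F' (w ++ u) ->
  follows (final st w) (mix t (unfolding 1 m F (letters st w))
                              (unfolding 1 m F' (letters st w))) v ->
  follows st (mix t F F') (w ++ v).
Proof.
move=> t01; elim: w st F F' => //= b w IH st F F' /andP[Fb Fw] /andP[Fb' Fw'] fv.
by rewrite sgb_mix ?(ltW Fb) //= crossing_mix; exact: IH.
Qed.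

Lemma isolated_prefix st n x x' w w' : proper st ->
  hits st x w -> hits st x' w' -> (size w <= size w' <= n)%N ->
  isolated st n x x' -> prefix w w'.
Proof.
move=> pst /and3P[x0 x1 fw] /and3P[x0' x1' fw'] /andP[s1 s2] iso.
have [//|p|[t [u [t01 su fu]]]] := follows_branch fw fw'.
  have /eqP e : size w' == size w by rewrite eqn_leq s1 (size_prefix p).
  by move: p; rewrite prefixE e take_size => /eqP ->; exact: prefix_refl.
exfalso; have := iso t u t01 (leq_trans (ltnW su) (leq_trans s1 s2)).
by rewrite (hits_mix pst) ?x0 ?x0'.
Qed.

Lemma isolated_neq st n x x' w w' : proper st -> x != x' ->
  hits st x w -> hits st x' w' -> (size w <= size w' <= n)%N ->
  isolated st n x x' -> exists b u, w' = w ++ b :: u.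
Proof.
move=> pst xx' hw hw' s iso.
have /prefixP[[|b u] e] := isolated_prefix pst hw hw' s iso.
  by rewrite e cats0 in hw'; rewrite (hits_inj pst hw hw') eqxx in xx'.
by exists b, u.
Qed.

(** With [x < x'], the chord joins the end point of the first trajectory, where
    [F = 0] and [F' = - B], to that of the second one, where [F = A] and
    [F' = 0]. As the directions are neighbouring, the first line extended beyond
    its end point passes the same vertices as the second one. *)
Lemma visible_right st n x x' w u : proper st ->
  hits st x w -> hits st x' (w ++ false :: u) -> (size w + size u < n)%N ->
  isolated st n x x' ->
  exists (r : nat) (v : seq bool), u = nseq r true ++ v /\
    (v = [::] \/ exists (u' : seq bool) (y : R), v = false :: u' /\
       hits (turn false (final st (w ++ false :: nseq r true))) y u').
Proof.
move=> pst hx hx' sn iso.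
have /and3P[x0 x1 fw] := hx; have /and3P[x0' x1' fw'] := hx'.
set F := cross_ (apex st) (slope st x) in fw.
set F' := cross_ (apex st) (slope st x') in fw'.
set st0 := final st w; have pst0 : proper st0 by exact: proper_final.
pose F0 := unfolding 1 m F (letters st w).
pose F0' := unfolding 1 m F' (letters st w).
have sF := straddles_slope pst x0 x1; have sF' := straddles_slope pst x0' x1'.
have [sF0 F00] := follows_straddles pst sF fw.
have sF0' := follows_straddles_cat pst sF' fw'.
have fu := follows_cat fw'; rewrite -/st0 -/F0' in fu.
have wk : weakly_follows st0 F0 (false :: u).
  have [//|[t [v [t01 sv fv]]]] := weakly_follows_or F0 fu; exfalso.
  have := iso t (w ++ v) t01; rewrite size_cat.
  have -> : (size w + size v <= n)%N.
    by rewrite (leq_trans _ sn) // -addSn leq_add // ltnW.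
  move=> /(_ isT); rewrite (hits_mix pst) ?x0 ?x0' //.
  exact: follows_mix_cat fw fw' fv.
move: fu wk => /= /andP[Fb' Fu'] /andP[_ Fu].
have B0 : 0 < - F0' (apex st0) by move: Fb'; rewrite /sgb mulN1r.
have e1 := crossing_apex false _ pst0; have e2 := crossing_other false _ pst0.
have vE y : vertex st (slope st y) (w ++ false :: u) =
  unfolding 1 m (cross_ (side_end st0 false) (unfolding 1 m
    (cross_ (apex st) (slope st y)) (letters st w)))
    (letters (turn false st0) u) (apex (final (turn false st0) u)).
  by rewrite /vertex /at_word /= letters_cat final_cat unfolding_cat.
have o0 : orient st0 F0 F0' < 0.
  have : orient st0 F0 F0' = x - x' by rewrite orient_final // orient_slope.
  move: Fb'; rewrite /sgb mulN1r => Fb' o.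
  rewrite o subr_lt0 ltNge; apply/negP => xx.
  have : F0' (apex st0) = F0 (apex st0) + (x - x') * at_word st (far st) w (apex st0).
    by rewrite -(at_word_slope st w x' x).
  rewrite (F00 : F0 (apex st0) = 0) add0r => e; move: Fb'; rewrite e.
  have := hits_far pst hx; rewrite /vertex => f1.
  have : 0 <= (x - x') * at_word st (far st) w (apex st0).
    by rewrite mulr_ge0 ?subr_ge0 // ltW // (lt_trans _ f1).
  lra.
have xx' : x < x' by move: o0; rewrite orient_final // orient_slope // subr_lt0.
pose A := vertex st (slope st x) (w ++ false :: u).
have A0 : 0 < A.
  have : vertex st (slope st x') (w ++ false :: u) = 0.
    have := follows_straddles (proper_turn false pst0) (@straddles_turn false _ _ pst0 sF0' Fb') Fu'.
    by case=> _; rewrite vE.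
  rewrite /A /vertex (at_word_slope st _ x x') => ->; rewrite add0r.
  by rewrite mulr_gt0 ?subr_gt0 // (lt_trans ltr01) // (hits_far pst hx').
have [||||||r [v [-> hv]]] := @chord_from_left u (turn false st0)
   (cross_ (side_end st0 false) F0) (cross_ (side_end st0 false) F0') A
   (- F0' (apex st0)) (proper_turn false pst0) A0 B0 _ _ _ _ _ Fu' Fu _.
- by rewrite (side_end_turn false) e1.
- by rewrite (side_end_turn false) e1 opprK.
- by rewrite (side_end_turnN false) e2; case/andP: sF0.
- by rewrite (side_end_turnN false) e2; case/andP: sF0'.
- by rewrite orient_turn.
- by rewrite /A vE.
exists r, v; split => //; rewrite final_cat; exact: hv.
Qed.

Lemma map_negbK : involutive (map negb).
Proof. exact: mapK negbK. Qed.

Lemma isolated_mirror st n x x' : proper st ->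
  isolated st n x x' -> isolated (mirror st) n (1 - x) (1 - x').
Proof.
move=> pst iso t u t01 su; have := iso t (map negb u) t01; rewrite size_map su.
have -> : (1 - t) * (1 - x) + t * (1 - x') = 1 - ((1 - t) * x + t * x') by ring.
by rewrite -(hits_mirror _ _ pst) map_negbK; apply.
Qed.

(** Two vertices met in neighbouring directions see each other: the segment
    between them is a side of a triangle of the unfolding, or it is followed
    by a trajectory from the first to the second. *)
Lemma visible st n x x' w b u : proper st ->
  hits st x w -> hits st x' (w ++ b :: u) -> (size w + size u < n)%N ->
  isolated st n x x' ->
  exists (r : nat) (v : seq bool), u = nseq r (~~ b) ++ v /\
    (v = [::] \/ exists (u' : seq bool) (y : R), v = b :: u' /\
       hits (turn b (final st (w ++ b :: nseq r (~~ b)))) y u').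
Proof.
case: b => pst hx hx' sn iso; last exact: visible_right hx hx' sn iso.
have pm := proper_mirror pst.
rewrite -(hits_mirror _ _ pst) in hx; rewrite -(hits_mirror _ _ pst) map_cat in hx'.
have sn' : (size (map negb w) + size (map negb u) < n)%N by rewrite !size_map.
have [r [v [eu hv]]] := @visible_right _ _ _ _ _ (map negb u) pm hx hx' sn' (isolated_mirror pst iso).
exists r, (map negb v); split.
  by rewrite -[u]map_negbK eu map_cat map_nseq.
case: hv => [->|[u' [y [-> hy]]]]; [by left|right].
exists (map negb u'), (1 - y); split => //; move: hy.
rewrite final_mirror turn_mirror map_cat map_negbK map_cons map_nseq => hy.
set st2 := turn _ _ in hy *; have pst2 : proper st2.
  by apply: proper_turn; apply: proper_final.
by rewrite -(hits_mirror _ _ pst2) map_negbK subKr.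
Qed.

End Following.

(** * Words and the trajectories that they describe *)

Fixpoint words (n : nat) : seq (seq bool) :=
  [::] :: if n is n'.+1 then
    [seq true :: w | w <- words n'] ++ [seq false :: w | w <- words n'] else [::].

Lemma mem_words n w : (w \in words n) = (size w <= n)%N.
Proof.
elim: n w => [|n IH] [|b w] //=.
rewrite inE /= mem_cat ltnS -IH; case: b; rewrite mem_map ?orbF //.
- by apply/orP/idP => [[//|/mapP[]//]|]; left.
- by move=> ? ? [].
- by apply/orP/idP => [[/mapP[]//|//]|]; right.
- by move=> ? ? [].
Qed.

Lemma uniq_words n : uniq (words n).
Proof.
elim: n => //= n IH; rewrite cat_uniq !map_inj_uniq ?IH; try by move=> ? ? [].
rewrite mem_cat andbT /=; apply/andP; split.
  by apply/negP => /orP[] /mapP[].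
by apply/hasPn => w /mapP[v _ ->]; apply/negP => /mapP[].
Qed.

Lemma size_words n : (size (words n) <= 2 ^ n.+1)%N.
Proof.
apply: ltnW; elim: n => //= n IH; rewrite size_cat !size_map expnS mul2n -addnn.
by rewrite -addSn -addnS leq_add // ltnW.
Qed.

Section Diagonals.
Variable R : realFieldType.
Variable m : 'I_3 -> 'I_3 -> R.

Definition diagonals (st : state) (n : nat) : seq (seq bool) :=
  [seq w <- words n | `[< exists x, hits m st x w >]].

Definition states : seq state := [seq st <- enum {: 'I_3 * 'I_3 * 'I_3} | proper st].

Lemma mem_states st : (st \in states) = proper st.
Proof. by rewrite mem_filter mem_enum andbT. Qed.

(** There are six starting triangles, two for each vertex: a generalized
    diagonal is counted with both orders of the ends of the first side. *)
Definition num_diagonals (n : nat) : nat :=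
  \sum_(st <- states) size (diagonals st n).

Lemma mem_diagonals st n w : (w \in diagonals st n) =
  (size w <= n)%N && `[< exists x, hits m st x w >].
Proof. by rewrite mem_filter mem_words andbC. Qed.

Lemma uniq_diagonals st n : uniq (diagonals st n).
Proof. by rewrite filter_uniq // uniq_words. Qed.

End Diagonals.

(** * The unfolded triangles are congruent *)

Section Congruence.
Variable R : rcfType.
Local Notation C := R[i].
Local Notation toC := (real_complex R).
Local Notation conjc := (@conjc R).
Local Notation Re := (@complex.Re R).
Local Notation Im := (@complex.Im R).

Lemma normc_ge0 (z : C) : 0 <= normc z.
Proof. by case: z => a b; rewrite sqrtr_ge0. Qed.

Lemma normc_conj (z : C) : normc (conjc z) = normc z.
Proof. by case: z => a b; rewrite /normc /= sqrrN. Qed.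

Lemma normc_real (x : R) : normc (toC x) = `|x|.
Proof. by rewrite /normc /= expr0n addr0 sqrtr_sqr. Qed.

Lemma normc_unit_conj (z : C) : normc z = 1 -> conjc z = z^-1.
Proof.
move=> z1; have zn0 : z != 0 by apply: contra_eq_neq z1 => ->; rewrite normc0 eq_sym oner_eq0.
apply: (mulfI zn0); rewrite divff //.
case: z z1 {zn0} => a b; rewrite /normc /= => h.
have {}h : a ^+ 2 + b ^+ 2 = 1.
  by rewrite -(@sqr_sqrtr _ (a ^+ 2 + b ^+ 2)) ?h ?expr1n // addr_ge0 // sqr_ge0.
by apply/eqP; rewrite eq_complex /=; apply/andP; split; apply/eqP; lra.
Qed.

(** The determinant of two vectors of the plane. *)
Definition cross (z w : C) : R := Im (conjc z * w).

Lemma crossE z w : cross z w = Re z * Im w - Im z * Re w.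
Proof. by case: z w => a b [c d]; rewrite /cross /=; lra. Qed.

Lemma cross_le z w : `|cross z w| <= normc z * normc w.
Proof.
rewrite -(normc_conj z) -normcM /cross; move: (_ * w) => [a b] /=.
by rewrite -sqrtr_sqr ler_wsqrtr // lerDr sqr_ge0.
Qed.

Variable m : 'I_3 -> 'I_3 -> R.
Hypothesis m_diag : forall j, m j j = -1.
Hypothesis m_sum : forall j, \sum_i m j i = 1.

Variables (T omega tau : 'I_3 -> C).
Hypothesis omega_unit : forall j, normc (omega j) = 1.
Hypothesis reflectionP : forall j k,
  crossing 1 (fun j k => toC (m j k)) j T k = omega j * conjc (T k) + tau j.

Definition placed (js : seq 'I_3) : 'I_3 -> C :=
  unfolding 1 (fun j k => toC (m j k)) T js.

Definition conj_if (b : bool) (z : C) : C := if b then conjc z else z.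

Lemma conj_ifD b x y : conj_if b (x + y) = conj_if b x + conj_if b y.
Proof. by case: b => //; exact: rmorphD. Qed.
Lemma conj_ifM b x y : conj_if b (x * y) = conj_if b x * conj_if b y.
Proof. by case: b => //; exact: rmorphM. Qed.
Lemma conj_ifJ b x : conj_if b (conjc x) = conj_if (~~ b) x.
Proof. by case: b => //=; rewrite conjcK. Qed.
Lemma normc_conj_if b x : normc (conj_if b x) = normc x.
Proof. by case: b => //=; rewrite normc_conj. Qed.

(** Unfolding commutes with the isometries of the plane. *)
Lemma unfolding_affine b (kappa sigma : C) js :
  unfolding 1 (fun j k => toC (m j k)) (fun k => kappa * conj_if b (T k) + sigma) js =
  (fun k => kappa * conj_if b (placed js k) + sigma).
Proof.
have -> : (fun k => kappa * conj_if b (T k) + sigma) =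
    (fun k => kappa * conj_if b (T k) + sigma * 1) by apply/funext => k; rewrite mulr1.
rewrite unfoldingD; apply/funext => k; congr (_ * _ + _).
  rewrite /placed; case: b => //=.
  have real : (fun j k => conjc (toC (m j k))) = (fun j k => toC (m j k)).
    by apply/funext => i; apply/funext => j; exact: conjc_real.
  by have := unfolding_rmorph conjc 1 (fun j k => toC (m j k)) js T; rewrite real rmorph1 => ->.
have -> : (fun=> 1 : C) = (fun k : 'I_3 => toC 1) by [].
rewrite -[X in unfolding X](rmorph1 toC) unfolding_rmorph unfolding_const //.
by rewrite rmorph1 mulr1.
Qed.

Definition rotation (e : 'I_3 -> int) : C := \prod_i omega i ^ e i.

(** The linear parts of reflections are [z |-> omega j * conjc z]; a composite of
    them only depends on the exponents of the [omega j] that it collects, with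
    alternating signs. *)
Lemma placed_congruent js : exists e sigma,
  (forall i, `|e i| <= (size js)%:Z) /\
  (forall k, placed js k = rotation e * conj_if (odd (size js)) (T k) + sigma).
Proof.
elim/last_ind: js => [|js j [e [sigma [eb pl]]]].
  exists (fun=> 0), 0; split => [i|k]; first by rewrite normr0.
  by rewrite /rotation big1 ?mul1r ?addr0 // => i _; rewrite expr0z.
set b := odd (size js) in pl.
exists (fun i => e i + (i == j)%:Z * (-1) ^+ b).
exists (rotation e * conj_if b (tau j) + sigma); rewrite size_rcons; split=> [i|k].
  rewrite -[(size js).+1]addn1 PoszD (le_trans (ler_normD _ _)) // lerD //.
  by rewrite normrM normrX normrN1 expr1n mulr1; case: eqP.
rewrite /placed -cats1 unfolding_cat -/(placed js) /=.
have -> : placed js = fun k => rotation e * conj_if b (T k) + sigma by apply/funext.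
have := unfolding_affine b (rotation e) sigma [:: j] => /= ->.
rewrite /placed /= reflectionP conj_ifD conj_ifM conj_ifJ.
have -> : rotation (fun i => e i + (i == j)%:Z * (-1) ^+ b) =
    rotation e * conj_if b (omega j).
  rewrite /rotation (eq_bigr (fun i => omega i ^ e i *
      omega i ^ ((i == j)%:Z * (-1) ^+ b))); last first.
    move=> i _; rewrite expfzDr //; apply: contra_eq_neq (omega_unit i) => ->.
    by rewrite normc0 eq_sym oner_eq0.
  rewrite big_split /=; congr (_ * _).
  rewrite (bigD1 j) //= eqxx mul1r big1 ?mulr1; last first.
    by move=> i /negbTE ->; rewrite mul0r expr0z.
  by case: (b) => /=; rewrite ?expr1z // normc_unit_conj // exprN1.
by ring.
Qed.

Variables (L Delta : R).
Hypothesis Delta_gt0 : 0 < Delta.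
Hypothesis sides_le : forall i j, normc (T i - T j) <= L.
Hypothesis area_ge : forall st, proper st -> Delta <=
  `|cross (T (side_end st false) - T (apex st))
          (T (side_end st true) - T (side_end st false))|.

Lemma normcB_le x y z : normc (x - z) <= normc (x - y) + normc (y - z) :> R.
Proof. by have := le_normcD (x - y) (y - z); rewrite subrKA. Qed.

Lemma L_ge0 : 0 <= L.
Proof. exact: le_trans (normc_ge0 _) (sides_le 0 0). Qed.

Lemma normc_rotation e : normc (rotation e) = 1.
Proof.
rewrite /rotation; elim/big_ind: _ => [|x y hx hy|i _]; first exact: normc1.
  by rewrite normcM hx hy mulr1.
have h p : normc (omega i ^+ p) = 1.
  by elim: p => [|p IH]; rewrite ?normc1 // exprS normcM IH omega_unit mulr1.
by case: (e i) => p; rewrite ?NegzE -?exprnN -?exprnP ?normcV h ?invr1.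
Qed.

Lemma placed_sides js i j : normc (placed js i - placed js j) <= L.
Proof.
have [e [sigma [_ pl]]] := placed_congruent js; rewrite !pl.
rewrite opprD addrACA subrr addr0 -mulrBr normcM.
rewrite normc_rotation mul1r; have -> : conj_if (odd (size js)) (T i) - conj_if (odd (size js)) (T j) =
    conj_if (odd (size js)) (T i - T j).
  by case: odd => //=; rewrite rmorphB.
by rewrite normc_conj_if.
Qed.

Lemma placed_bound js v k : normc (placed js k - T v) <= L * (size js).+1%:R.
Proof.
elim/last_ind: js k => [|js j IH] k; first by rewrite mulr1.
have [k' kj] : exists k', k' != j.
  by exists (j + 1); rewrite -subr_eq0 addrAC subrr add0r.
apply: le_trans (normcB_le _ (placed (rcons js j) k') _) _.
rewrite size_rcons -[(size js).+2]add1n natrD mulrDr mulr1 lerD ?placed_sides //.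
have -> : placed (rcons js j) k' = placed js k'; last exact: IH.
by rewrite /placed -cats1 unfolding_cat /= /crossing (negbTE kj) mul1r.
Qed.

Definition endpoint (st : state) (w : seq bool) : C :=
  placed (apex st :: letters st w) (apex (final st w)).

Definition base1 (st : state) : C := T (side_end st false) - T (apex st).
Definition base2 (st : state) : C := T (side_end st true) - T (side_end st false).

Lemma unfolding_toC (F : 'I_3 -> R) js :
  unfolding 1 (fun j k => toC (m j k)) (fun k => toC (F k)) js =
  (fun k => toC (unfolding 1 m F js k)).
Proof. by rewrite -[X in unfolding X](rmorph1 toC) unfolding_rmorph. Qed.

(** The two coordinates of a vertex of the unfolding are its coefficients on the
    basis given by two sides of the first triangle. *)
Lemma endpointE st w : proper st -> endpoint st w =
  T (apex st) + toC (vertex m st (far R st) w) * base1 st +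
  toC (vertex m st (slope st 0) w) * base2 st.
Proof.
move=> pst; rewrite /endpoint /placed /vertex /at_word.
set js := _ :: _; set i := apex (final st w).
have eT : T = (fun k => 1 * (T (apex st) * toC 1 + base1 st * toC (far R st k))
                        + base2 st * toC (slope st 0 k)).
  apply/funext => k; rewrite /base1 /base2 /far /slope.
  case: (eqVneq k (apex st)) => [->|ki]; first by rewrite !rmorph0 rmorph1; ring.
  case: (eqVneq k (side_end st false)) => [->|kl].
    by rewrite oppr0 rmorph0 !rmorph1; ring.
  by rewrite (proper_third pst ki kl) subr0 !rmorph1; ring.
rewrite [X in unfolding _ _ X _ _]eT unfoldingD unfoldingD.
rewrite !(unfolding_toC (fun=> 1)) !unfolding_toC unfolding_const // rmorph1.
by ring.
Qed.

Lemma base1_le st : normc (base1 st) <= L. Proof. exact: sides_le. Qed.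
Lemma base2_le st : normc (base2 st) <= L. Proof. exact: sides_le. Qed.

Lemma crossDl z z' w : cross (z + z') w = cross z w + cross z' w.
Proof. by case: z z' w => a b [c d] [e f]; rewrite !crossE /=; ring. Qed.
Lemma crossZl (x : R) z w : cross (toC x * z) w = x * cross z w.
Proof. by case: z w => a b [c d]; rewrite !crossE /=; ring. Qed.
Lemma crossDr z w w' : cross z (w + w') = cross z w + cross z w'.
Proof. by case: z w w' => a b [c d] [e f]; rewrite !crossE /=; ring. Qed.
Lemma crossZr (x : R) z w : cross z (toC x * w) = x * cross z w.
Proof. by case: z w => a b [c d]; rewrite !crossE /=; ring. Qed.
Lemma crossvv z : cross z z = 0.
Proof. by case: z => a b; rewrite crossE /=; ring. Qed.

(** Each reflection moves the triangle by at most a side length. *)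
Lemma far_le st w : proper st ->
  `|vertex m st (far R st) w| * Delta <= L ^+ 2 * (size w + 2)%:R.
Proof.
move=> pst; have e := endpointE w pst.
have : `|cross (endpoint st w - T (apex st)) (base2 st)| <=
    L * (size w + 2)%:R * L.
  apply: le_trans (cross_le _ _) _; apply: ler_pM; rewrite ?normc_ge0 ?base2_le //.
  by have := placed_bound (apex st :: letters st w) (apex st) (apex (final st w));
    rewrite /= size_letters addn2.
rewrite e addrC !addrA addNr add0r crossDl !crossZl crossvv mulr0 addr0 normrM.
have -> : L * (size w + 2)%:R * L = L ^+ 2 * (size w + 2)%:R by ring.
by apply: le_trans; rewrite ler_wpM2l // area_ge.
Qed.

Lemma diagonal_ge st x w : proper st -> hits m st x w ->
  Delta <= L * normc (endpoint st w - T (apex st)).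
Proof.
move=> pst hx; have v1 := hits_far m_diag m_sum pst hx; have e := endpointE w pst.
have := cross_le (endpoint st w - T (apex st)) (base2 st).
rewrite {1}e addrC !addrA addNr add0r crossDl !crossZl crossvv mulr0 addr0 normrM => h.
rewrite mulrC; apply: le_trans (ler_wpM2l (normc_ge0 _) (base2_le st)).
apply: le_trans h; apply: le_trans (area_ge pst) _.
by rewrite ler_peMl // ger0_norm ltW // (lt_trans ltr01).
Qed.

Lemma side_ge i j : i != j -> Delta <= L * normc (T i - T j).
Proof.
move=> ij; have [st [pst ei ej]] : exists st : state,
    [/\ proper st, side_end st false = i & apex st = j].
  have [k /andP[ki kj]] : exists k, (k != i) && (k != j).
    apply/existsP/contraT; rewrite negb_exists => /forallP h.
    suff : (#|[set: 'I_3]| <= #|[set i; j]|)%N by rewrite cardsT card_ord cards2 ij.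
    apply/subset_leq_card/fintype.subsetP => k _; have := h k.
    by rewrite negb_and !negbK !inE.
  by exists (j, i, k); split => //; apply/and3P; split; rewrite //= eq_sym.
rewrite -ei -ej mulrC; apply: le_trans (area_ge pst) _.
apply: le_trans (cross_le _ _) _; apply: ler_wpM2l; rewrite ?normc_ge0 //.
Qed.

(** The sides of the triangle and the trajectories of length at most [k], drawn
    from a triangle in its initial position. *)
Definition short_vectors (k : nat) : seq C :=
  [seq T p.1 - T p.2 | p <- enum {: 'I_3 * 'I_3}] ++
  flatten [seq [seq endpoint st w - T (apex st) | w <- diagonals m st k] | st <- states].

(** Among these vectors are the images of the short ones by the linear parts of
    at most [n] successive reflections. The exponents between [- n] and [n] are
    shifted in order to range over an ordinal type. *)
Definition steps (n k : nat) : seq C :=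
  [seq f.1.1 * conj_if f.1.2 f.2 | f <-
    [seq (f, z) | f <- [seq (rotation (fun i => (e i : 'I_(2 * n).+1)%:Z - n%:Z), b) |
        e : {ffun 'I_3 -> 'I_(2 * n).+1} <- enum {ffun 'I_3 -> 'I_(2 * n).+1}, b <- [:: true; false]],
      z <- short_vectors k]].

Lemma size_short_vectors k : size (short_vectors k) = (9 + num_diagonals m k)%N.
Proof.
rewrite size_cat size_map -cardE card_prod card_ord; congr (_ + _)%N.
rewrite size_flatten /shape -map_comp sumnE big_map; apply: eq_bigr => st _.
by rewrite /= size_map.
Qed.

Lemma size_steps n k :
  size (steps n k) = ((2 * n).+1 ^ 3 * 2 * (9 + num_diagonals m k))%N.
Proof.
by rewrite size_map !size_allpairs -cardE card_ffun !card_ord size_short_vectors.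
Qed.

Lemma mem_steps n k (e : 'I_3 -> int) b z :
  (forall i, `|e i| <= n%:Z) -> z \in short_vectors k ->
  rotation e * conj_if b z \in steps n k.
Proof.
move=> en zk; apply/mapP; exists (rotation e, b, z) => //.
apply/allpairsP; exists ((rotation e, b), z); split => //.
apply/allpairsP.
have eb i : (absz (e i + n%:Z)%R < (2 * n).+1)%N.
  by have := en i; lia.
exists ([ffun i => Ordinal (eb i)], b); split => //.
- by rewrite mem_enum.
- by case: (b); rewrite !inE.
congr (_, _); rewrite /rotation; apply: eq_bigr => i _; congr (_ ^ _).
by rewrite ffunE /=; have := en i; lia.
Qed.

Lemma placed_cat js ks : exists e b sigma, (forall i, `|e i| <= (size js)%:Z) /\
  forall k, placed (js ++ ks) k = rotation e * conj_if b (placed ks k) + sigma /\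
            placed js k = rotation e * conj_if b (T k) + sigma.
Proof.
have [e [sigma [eb pl]]] := placed_congruent js.
exists e, (odd (size js)), sigma; split => // k; split => //.
rewrite {1}/placed unfolding_cat -/(placed js).
have -> : placed js = fun k => rotation e * conj_if (odd (size js)) (T k) + sigma.
  exact/funext.
by rewrite unfolding_affine.
Qed.

Lemma crossing_other_side (K : comNzRingType) (mK : 'I_3 -> 'I_3 -> K) b st Q :
  proper st -> crossing 1 mK (side_end st (~~ b)) Q (side_end st b) = Q (side_end st b).
Proof.
move=> /and3P[h1 h2 h3]; rewrite /crossing mul1r.
by case: b; rewrite /= ?(negbTE h3) // eq_sym (negbTE h3).
Qed.

(** Successive triangles with their apexes on the same side of the line share a
    vertex. *)
Lemma unfolding_fan (K : comNzRingType) (mK : 'I_3 -> 'I_3 -> K) b r st Q : proper st ->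
  let w := nseq r (~~ b) in
  unfolding 1 mK Q (letters st w) (side_end (final st w) b) = Q (side_end st b).
Proof.
elim: r st Q => //= r IH st Q pst.
have e3 := side_end_turnN (~~ b) st; rewrite negbK in e3.
by rewrite IH ?proper_turn // e3 crossing_other_side.
Qed.

Lemma endpoint_fan st w b r : proper st ->
  let w1 := w ++ b :: nseq r (~~ b) in
  endpoint st w = placed (apex st :: letters st w1) (side_end (final st w1) b).
Proof.
move=> pst /=; have pst0 := proper_final w pst.
rewrite /endpoint /placed letters_cat final_cat -cat_cons [in RHS]unfolding_cat.
rewrite [letters (final st w) _]/= [final (final st w) _]/= [unfolding _ _ _ (_ _ b :: _)]/=.
rewrite unfolding_fan ?proper_turn // side_end_turn /crossing mul1r.
case: eqP => // /eqP; have /and3P[h1 h2 h3] := pst0.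
by case: b; rewrite /apex /= ?(negbTE h1) ?(negbTE h2).
Qed.

(** The segment between the end points of neighbouring trajectories is drawn
    from the last triangle that contains the first end point, which is an
    isometric image of the initial one. *)
Lemma visible_step st n k x x' w w' : proper st -> x != x' ->
  hits m st x w -> hits m st x' w' -> (size w <= size w' <= n)%N ->
  (size w' - size w <= k)%N -> isolated m st n x x' ->
  endpoint st w' - endpoint st w \in steps n.+1 k /\
  Delta <= L * normc (endpoint st w' - endpoint st w).
Proof.
move=> pst xx' hw hw' sw sk iso.
have [b [u eu]] := isolated_neq m_diag m_sum pst xx' hw hw' sw iso.
have [_ swn] := andP sw; subst w'; rewrite size_cat /= in swn sk.
have sn : (size w + size u < n)%N by rewrite -addnS.
have [r [v [eu hv]]] := visible m_diag m_sum pst hw hw' sn iso.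
set w1 := w ++ b :: nseq r (~~ b).
have ew : w ++ b :: u = w1 ++ v by rewrite eu /w1 -catA.
set js := apex st :: letters st w1; set st1 := final st w1 in hv.
have pst1 : proper st1 by exact: proper_final.
have sjs : (size js <= n.+1)%N.
  rewrite /= size_letters ltnS (leq_trans _ swn) // /w1 size_cat /= leq_add2l.
  by rewrite ltnS eu size_cat leq_addr.
suff [z [zk zD [e [b' [eb ->]]]]] : exists z, [/\ z \in short_vectors k,
    Delta <= L * normc z & exists e b', (forall i, `|e i| <= (size js)%:Z) /\
    endpoint st (w ++ b :: u) - endpoint st w = rotation e * conj_if b' z].
  rewrite normcM normc_rotation mul1r normc_conj_if; split => //.
  by apply: mem_steps => // i; apply: le_trans (eb i) _; rewrite lez_nat.
rewrite (endpoint_fan w b r pst) -/w1 -/js -/st1 ew.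
have sub_conj b' (y z : C) : conj_if b' y - conj_if b' z = conj_if b' (y - z).
  by case: b' => //=; rewrite rmorphB.
case: hv => [v0|[u' [y [ev hy]]]]; [exists (T (apex st1) - T (side_end st1 b))|
  exists (endpoint (turn b st1) u' - T (apex (turn b st1)))].
- split.
  + rewrite mem_cat; apply/orP; left; apply/mapP.
    by exists (apex st1, side_end st1 b); rewrite ?mem_enum.
  + by apply: side_ge; have /and3P[] := pst1; case: (b).
  + have [e [b' [sigma [eb pl]]]] := placed_cat js [::].
    exists e, b'; split => //; have [_ p1] := pl (apex st1).
    have [_ p2] := pl (side_end st1 b).
    by rewrite v0 cats0 /endpoint -/js -/st1 p1 p2 -sub_conj; ring.
- have pst2 := proper_turn b pst1; split.
  + rewrite mem_cat; apply/orP; right; apply/flattenP.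
    exists [seq endpoint (turn b st1) w0 - T (apex (turn b st1)) |
       w0 <- diagonals m (turn b st1) k].
      by apply/mapP; exists (turn b st1); rewrite ?mem_states.
    apply/mapP; exists u' => //; rewrite mem_diagonals; apply/andP; split.
      by move: sk; rewrite eu ev size_cat /=; lia.
    by apply/asboolP; exists y.
  + exact: diagonal_ge hy.
  + have [e [b' [sigma [eb pl]]]] := placed_cat js (letters st1 v).
    exists e, b'; split => //.
    have -> : endpoint st (w1 ++ v) = placed (js ++ letters st1 v) (apex (final (turn b st1) u')).
      by rewrite /endpoint letters_cat final_cat -/st1 ev.
    have [-> _] := pl (apex (final (turn b st1) u')).
    have [_ ->] := pl (side_end st1 b).
    rewrite -sub_conj /endpoint apex_turn ev /=; ring.
Qed.

(** * The direction of a short vector *)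

(** The coordinate, on the first crossed side, of the line with direction [d]
    through the starting vertex. *)
Definition direction (st : state) (d : C) : R :=
  cross (base1 st) d / cross d (base2 st).

Definition spread (n : nat) : R := 4 * L ^+ 4 * (n + 2)%:R / Delta ^+ 2.

Lemma L_gt0 : 0 < L.
Proof.
rewrite lt_def L_ge0 andbT; apply/eqP => L0.
have := @side_ge 0 1 isT; rewrite L0 mul0r leNgt Delta_gt0 //.
Qed.

(** In the coordinates of [endpointE], the end points are [(l, l * x)] and
    [(l', l' * x')], so that their difference [d] has the direction
    [x + l' * (x' - x) / (l' - l)]. The number [l'] is bounded by [far_le]. If
    [l' - l] were small, then [x' - x] would have to be large, because the
    length of [d] is bounded from below. *)
Lemma direction_close st x x' w w' n : proper st ->
  hits m st x w -> hits m st x' w' -> (size w' <= n)%N ->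
  Delta <= L * normc (endpoint st w' - endpoint st w) ->
  2 <= spread n * `|x' - x| \/
  `|direction st (endpoint st w' - endpoint st w) - x| <= spread n * `|x' - x|.
Proof.
move=> pst hw hw' swn.
set l := vertex m st (far R st) w; set l' := vertex m st (far R st) w'.
have l1 : 1 < l := hits_far m_diag m_sum pst hw.
have l1' : 1 < l' := hits_far m_diag m_sum pst hw'.
have ed : endpoint st w' - endpoint st w =
    toC (l' - l) * base1 st + toC (l' * x' - l * x) * base2 st.
  rewrite !endpointE // -/l -/l' !rmorphB -(hits_coord hw) -(hits_coord hw').
  rewrite -/l -/l' !rmorphM; ring.
set d := _ - _ in ed *; set c := cross (base1 st) (base2 st).
have c0 : c != 0.
  have := area_ge pst; rewrite -/(base1 st) -/(base2 st) -/c => h.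
  by apply/eqP => c0; move: h; rewrite c0 normr0 leNgt Delta_gt0.
have cr1 : cross (base1 st) d = (l' * x' - l * x) * c.
  by rewrite ed crossDr !crossZr crossvv mulr0 add0r.
have cr2 : cross d (base2 st) = (l' - l) * c.
  by rewrite ed crossDl !crossZl crossvv mulr0 addr0.
have L0 := L_gt0; set g := `|x' - x|.
have g0 : 0 <= g by rewrite normr_ge0.
move=> hd; set M := L ^+ 2 * (n + 2)%:R / Delta.
have M0 : 0 < M by rewrite /M divr_gt0 // mulr_gt0 ?exprn_gt0 // ltr0n addn2.
have lM : l' <= M.
  rewrite /M ler_pdivlMr // -(ger0_norm (ltW (lt_trans ltr01 l1'))).
  apply: le_trans (far_le w' pst) _.
  by rewrite ler_wpM2l ?exprn_ge0 ?L_ge0 // ler_nat leq_add2r.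
have KE : spread n = 4 * L ^+ 2 * M / Delta.
  by rewrite /spread /M; field; rewrite gt_eqF.
have [h|h] := leP 2 (spread n * g); [by left|right].
have nd : normc d <= 2 * L * `|l' - l| + l' * g * L.
  have -> : d = toC (l' - l) * (base1 st + toC x * base2 st) +
                toC (l' * (x' - x)) * base2 st.
    by rewrite ed !rmorphB !rmorphM !rmorphB; ring.
  apply: le_trans (le_normcD _ _) _; apply: lerD.
    rewrite normcM normc_real mulrC ler_wpM2r //.
    apply: le_trans (le_normcD _ _) _; rewrite normcM normc_real.
    have /and3P[x0 x1 _] := hw.
    have h1 := base1_le st; have h2 := base2_le st.
    rewrite mulr_natl mulr2n lerD // gtr0_norm //.
    by apply: le_trans (ler_piMl _ (ltW x1)) h2; exact: normc_ge0.
  rewrite normcM normc_real normrM (gtr0_norm (lt_trans ltr01 l1')).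
  by rewrite ler_wpM2l ?base2_le // mulr_ge0 // ltW // (lt_trans ltr01).
have Mg : L ^+ 2 * M * g < Delta / 2.
  move: h; rewrite KE => h; rewrite -(ltr_pM2l (_ : 0 < 4 / Delta)) ?divr_gt0 //.
  have -> : 4 / Delta * (Delta / 2) = 2 by field; rewrite gt_eqF.
  by have -> : 4 / Delta * (L ^+ 2 * M * g) = 4 * L ^+ 2 * M / Delta * g; [field; rewrite gt_eqF|].
have sl : Delta / (4 * L ^+ 2) <= `|l' - l|.
  rewrite ler_pdivrMr ?mulr_gt0 ?exprn_gt0 //.
  have h1 : L * normc d <= L * (2 * L * `|l' - l| + l' * g * L) by rewrite ler_pM2l.
  have h2 : L ^+ 2 * (l' * g) <= L ^+ 2 * (M * g).
    by rewrite ler_wpM2l ?exprn_ge0 ?L_ge0 // ler_wpM2r.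
  have e1 : L * (2 * L * `|l' - l| + l' * g * L) =
     2 * (L ^+ 2 * `|l' - l|) + L ^+ 2 * (l' * g) by ring.
  have e2 : `|l' - l| * (4 * L ^+ 2) = 4 * (L ^+ 2 * `|l' - l|) by ring.
  have e3 : L ^+ 2 * (M * g) = L ^+ 2 * M * g by ring.
  lra.
have s0 : 0 < `|l' - l| by apply: lt_le_trans sl; rewrite divr_gt0 // mulr_gt0 // exprn_gt0.
have sn0 : l' - l != 0 by rewrite -normr_gt0.
have -> : direction st d - x = l' * (x' - x) / (l' - l).
  by rewrite /direction cr1 cr2; field; rewrite c0 sn0.
rewrite normrM normrM normfV -/g (gtr0_norm (lt_trans ltr01 l1')).
rewrite ler_pdivrMr // KE.
have h1 : l' * g <= M * g by rewrite ler_wpM2r.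
apply: le_trans h1 _.
have -> : 4 * L ^+ 2 * M / Delta * g * `|l' - l| =
  M * g * (`|l' - l| / (Delta / (4 * L ^+ 2))) by field; rewrite !gt_eqF.
have D0 : 0 < Delta / (4 * L ^+ 2) by rewrite divr_gt0 // mulr_gt0 // exprn_gt0.
apply: ler_peMr; first by rewrite mulr_ge0 // ltW.
by rewrite ler_pdivlMr // mul1r.
Qed.

Lemma spread_gt0 n : 0 < spread n.
Proof. by rewrite /spread divr_gt0 ?mulr_gt0 ?exprn_gt0 ?L_gt0 // ltr0n addn2. Qed.

Lemma isolatedC st n x x' : isolated m st n x x' -> isolated m st n x' x.
Proof.
move=> iso t u /andP[t0 t1] su; have := iso (1 - t) u.
rewrite subr_gt0 t1 ltrBlDr ltrDl t0 => /(_ isT su).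
by have -> : (1 - (1 - t)) * x + (1 - t) * x' = (1 - t) * x' + t * x by ring.
Qed.

(** Both previous results together, applied to the two end points in the order of
    the lengths of the words. *)
Lemma neighbour_direction st n k x x' w w' : proper st -> x != x' ->
  hits m st x w -> hits m st x' w' -> (size w <= n)%N -> (size w' <= n)%N ->
  (size w' <= size w + k)%N -> (size w <= size w' + k)%N -> isolated m st n x x' ->
  2 <= (spread n + 1) * `|x' - x| \/ exists2 y, y \in map (direction st) (steps n.+1 k) &
    `|y - x| <= (spread n + 1) * `|x' - x|.
Proof.
move=> pst xx' hw hw' sw sw' k1 k2 iso.
have g0 : 0 <= `|x' - x| by [].
have K0 := spread_gt0 n.
case: (leqP (size w) (size w')) => ww.
  have s1 : (size w <= size w' <= n)%N by rewrite ww sw'.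
  have s2 : (size w' - size w <= k)%N by rewrite leq_subLR.
  have [ds dD] := visible_step pst xx' hw hw' s1 s2 iso.
  have [h|h] := direction_close pst hw hw' sw' dD; [left|right].
    by rewrite mulrDl mul1r ler_wpDr.
  exists (direction st (endpoint st w' - endpoint st w)); first exact: map_f.
  by rewrite mulrDl mul1r ler_wpDr.
have s1 : (size w' <= size w <= n)%N by rewrite ltnW.
have s2 : (size w - size w' <= k)%N by rewrite leq_subLR.
rewrite eq_sym in xx'.
have [ds dD] := visible_step pst xx' hw' hw s1 s2 (isolatedC iso).
have [h|h] := direction_close pst hw' hw sw dD; rewrite (distrC x x') in h; [left|right].
  by rewrite mulrDl mul1r ler_wpDr.
exists (direction st (endpoint st w - endpoint st w')); first exact: map_f.
rewrite mulrDl mul1r; set y := direction _ _ in h *.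
have -> : y - x = (y - x') + (x' - x) by ring.
by apply: le_trans (ler_normD _ _) _; rewrite lerD2r.
Qed.

End Congruence.

(** * Counting gaps with a logarithmic potential *)

Section Gaps.
Variable R : realType.

Lemma ln_ge (x : R) : 0 < x -> 1 - x^-1 <= ln x.
Proof.
move=> x0; rewrite -[x in ln x]invrK lnV ?posrE ?invr_gt0 //.
have := @le_ln1Dx R (x^-1 - 1); rewrite ltrBrDl subrr invr_gt0 x0 => /(_ isT).
by rewrite addrC subrK; lra.
Qed.

(** A monotone version, cut off at distance [delta], of the logarithm of the
    distance to [y], with opposite signs on both sides of [y]. It increases by a
    fixed amount across each gap comparable to its distance to [y], whereas its
    total increase is logarithmic in [delta]. *)
Definition potential (delta y z : R) : R :=
  ln (Num.max (z - y) 0 + delta) - ln (Num.max (y - z) 0 + delta).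

Lemma max0_gt0 (delta u : R) : 0 < delta -> 0 < Num.max u 0 + delta.
Proof. by move=> d0; rewrite ltr_wpDl // le_max lexx orbT. Qed.

Lemma potential_le (delta y u v : R) : 0 < delta -> u <= v ->
  potential delta y u <= potential delta y v.
Proof.
move=> d0 uv; rewrite /potential lerB // ler_ln ?posrE ?max0_gt0 // lerD2r;
  by rewrite ge_max !le_max lexx !orbT andbT; lra.
Qed.

Lemma ln_max_le (delta u : R) : 0 < delta ->
  ln (Num.max (u + 1) 0 + delta) - ln (Num.max u 0 + delta) <= ln (1 + delta^-1).
Proof.
move=> d0; rewrite -ln_div ?posrE ?max0_gt0 // ler_ln ?posrE; last first.
- by rewrite addr_gt0 // invr_gt0.
- by rewrite divr_gt0 ?max0_gt0.
rewrite ler_pdivrMr ?max0_gt0 //.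
have h : 1 <= delta^-1 * (Num.max u 0 + delta).
  rewrite ler_pdivlMl // mulr1; have : 0 <= Num.max u 0 by rewrite le_max lexx orbT.
  lra.
rewrite mulrDl mul1r.
have : Num.max (u + 1) 0 <= Num.max u 0 + 1.
  by rewrite ge_max; apply/andP; split; [rewrite lerD2r le_max lexx|
    rewrite addr_ge0 // le_max lexx orbT].
lra.
Qed.

Lemma potential_total (delta y : R) : 0 < delta ->
  potential delta y 1 - potential delta y 0 <= 2 * ln (1 + delta^-1).
Proof.
move=> d0; rewrite /potential.
have h1 := ln_max_le (0 - y) d0; have h2 := ln_max_le (y - 1) d0.
have e1 : 0 - y + 1 = 1 - y by ring.
have e2 : y - 1 + 1 = y - 0 by ring.
by rewrite e1 in h1; rewrite e2 in h2; lra.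
Qed.

Lemma ln_ratio (K a b g : R) : 0 <= K -> 0 < a -> 0 < b -> a + g = b -> 0 < g ->
  a <= (K + 1) * g -> (K + 2)^-1 <= ln b - ln a.
Proof.
move=> K0 a0 b0 ab g0 ag; rewrite -ln_div ?posrE //.
apply: le_trans (ln_ge (divr_gt0 b0 a0)).
rewrite invf_div; have -> : 1 - a / b = g / b by rewrite -ab; field; rewrite ab gt_eqF.
rewrite ler_pdivlMr // mulrC ler_pdivrMr; last by lra.
by rewrite -ab; nra.
Qed.

Lemma potential_step (K delta y u v : R) : 0 <= K -> 0 < delta -> delta <= v - u ->
  `|y - u| <= K * (v - u) -> (K + 2)^-1 <= potential delta y v - potential delta y u.
Proof.
move=> K0 d0 duv; rewrite ler_norml => /andP[yu1 yu2].
have g0 : 0 < v - u by exact: lt_le_trans duv.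
have [yu|uy] := leP y u.
  rewrite /potential (max_l (_ : 0 <= v - y)) ?(max_r (_ : y - v <= 0)); try lra.
  rewrite (max_l (_ : 0 <= u - y)) ?(max_r (_ : y - u <= 0)); try lra.
  have := @ln_ratio K (u - y + delta) (v - y + delta) (v - u) K0.
  by move=> h; have := h ltac:(lra) ltac:(lra) ltac:(lra) ltac:(lra) ltac:(lra); lra.
rewrite /potential (max_r (_ : u - y <= 0)) ?(max_l (_ : 0 <= y - u)); try lra.
have [yv|vy] := leP y v.
  (* For [y] in the gap, the increase is the logarithm of a product of distances
     over [delta ^+ 2]; this quotient is at least 2. *)
  rewrite (max_l (_ : 0 <= v - y)) ?(max_r (_ : y - v <= 0)); try lra.
  have h1 : (K + 2)^-1 <= 2^-1 :> R by rewrite lef_pV2 ?posrE; lra.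
  have h2 : (v - u + 2 * delta) ^+ 2 >= 0 by exact: sqr_ge0.
  have h3 : ln (2 * delta ^+ 2) <= ln ((v - y + delta) * (y - u + delta)).
    rewrite ler_ln ?posrE ?mulr_gt0 ?exprn_gt0 //; try lra.
    have : 0 <= (v - y) * (y - u) by rewrite mulr_ge0; lra.
    have : delta * delta <= delta * (v - u) by rewrite ler_pM2l.
    nra.
  rewrite !lnM ?posrE ?exprn_gt0 // in h3; try lra.
  have h4 : 1 - 2^-1 <= ln 2 :> R by exact: ln_ge.
  rewrite !add0r; lra.
rewrite (max_r (_ : v - y <= 0)) ?(max_l (_ : 0 <= y - v)); try lra.
have := @ln_ratio K (y - v + delta) (y - u + delta) (v - u) K0.
by move=> h; have := h ltac:(lra) ltac:(lra) ltac:(lra) ltac:(lra) ltac:(lra); lra.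
Qed.

(** The potentials of all points of [ys] are added, and a linear function takes
    care of the large gaps: the sum is monotone, and it increases by at least
    [(K + 2)^-1] across each gap that is counted. *)
Lemma count_gaps (xs ys : seq R) (K delta : R) (P : pred nat) :
  0 <= K -> 0 < delta -> (forall x, x \in xs -> 0 <= x <= 1) ->
  (forall j, (j.+1 < size xs)%N -> delta <= xs`_j.+1 - xs`_j) ->
  (forall j, (j.+1 < size xs)%N -> P j ->
     2 <= K * (xs`_j.+1 - xs`_j) \/
     exists2 y, y \in ys & `|y - xs`_j| <= K * (xs`_j.+1 - xs`_j)) ->
  (count P (iota 0 (size xs).-1))%:R <=
    2 * (K + 2) * (size ys)%:R * ln (1 + delta^-1) + K.
Proof.
move=> K0 d0 x01 gap hP; have K2 : 0 < K + 2 by lra.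
have l0 : 0 <= ln (1 + delta^-1) by rewrite ln_ge0 // lerDl invr_ge0 ltW.
have [s0|s0] := posnP (size xs).
  by rewrite s0 /= addr_ge0 // !mulr_ge0 // ltW.
pose Psi z := \sum_(y <- ys) potential delta y z + K / (2 * (K + 2)) * z.
have c0 : 0 <= K / (2 * (K + 2)) by rewrite divr_ge0 // mulr_ge0 // ltW.
have Psi_le u v : u <= v -> Psi u <= Psi v.
  by move=> uv; rewrite lerD ?ler_wpM2l //; apply: ler_sum => y _; exact: potential_le.
have Psi_total : Psi 1 - Psi 0 <=
    (size ys)%:R * (2 * ln (1 + delta^-1)) + K / (2 * (K + 2)).
  rewrite /Psi mulr1 mulr0 addr0 addrAC lerD2r -sumrB.
  rewrite (_ : _ * _ = \sum_(y <- ys) (2 * ln (1 + delta^-1))); last first.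
    by rewrite big_const_seq count_predT iter_addr_0 mulr_natl.
  apply: ler_sum => y _; exact: potential_total.
have step j : (j.+1 < size xs)%N -> (P j)%:R * (K + 2)^-1 <= Psi xs`_j.+1 - Psi xs`_j.
  move=> js; have g := gap _ js.
  have uv : xs`_j <= xs`_j.+1 by rewrite -subr_ge0 (le_trans (ltW d0)).
  have [Pj|_] := boolP (P j); last by rewrite mul0r subr_ge0 Psi_le.
  rewrite mul1r; have [h|[y yys hy]] := hP _ js Pj.
    have : \sum_(y <- ys) potential delta y xs`_j <= \sum_(y <- ys) potential delta y xs`_j.+1.
      by apply: ler_sum => y _; exact: potential_le.
    have : (K + 2)^-1 <= K / (2 * (K + 2)) * (xs`_j.+1 - xs`_j).
      have -> : K / (2 * (K + 2)) * (xs`_j.+1 - xs`_j) =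
        (K * (xs`_j.+1 - xs`_j)) / 2 * (K + 2)^-1 by field; rewrite gt_eqF.
      by rewrite ler_peMl ?invr_ge0 ?(ltW K2) //; lra.
    rewrite /Psi mulrBr; lra.
  have : (K + 2)^-1 <= \sum_(z <- ys) potential delta z xs`_j.+1 - \sum_(z <- ys) potential delta z xs`_j.
    apply: le_trans (potential_step K0 d0 g hy) _.
    rewrite -sumrB (big_rem y) //= lerDl; apply: sumr_ge0 => z _.
    by rewrite subr_ge0 potential_le.
  have : 0 <= K / (2 * (K + 2)) * (xs`_j.+1 - xs`_j) by rewrite mulr_ge0 // subr_ge0.
  rewrite /Psi mulrBr; lra.
have tele N : (N < size xs)%N ->
    (count P (iota 0 N))%:R * (K + 2)^-1 <= Psi xs`_N - Psi xs`_0.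
  elim: N => [|N IH] sN; first by rewrite mul0r subrr.
  rewrite -addn1 iotaD count_cat /= addn0 natrD mulrDl add0n addn1.
  by have := IH (ltnW sN); have := step _ sN; lra.
have := tele _ (_ : (size xs).-1 < size xs)%N; rewrite prednK // leqnn => /(_ isT) h.
have /andP[x0 _] := x01 _ (mem_nth 0 s0).
have s1 : ((size xs).-1 < size xs)%N by rewrite prednK.
have /andP[_ x1] := x01 _ (mem_nth 0 s1).
have h0 := Psi_le _ _ x0; have h1 := Psi_le _ _ x1.
have : (count P (iota 0 (size xs).-1))%:R * (K + 2)^-1 <=
  (size ys)%:R * (2 * ln (1 + delta^-1)) + K / (2 * (K + 2)) by lra.
rewrite ler_pdivrMr // => h2; apply: le_trans h2 _.
have -> : ((size ys)%:R * (2 * ln (1 + delta^-1)) + K / (2 * (K + 2))) * (K + 2) =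
  2 * (K + 2) * (size ys)%:R * ln (1 + delta^-1) + K / 2 by field; rewrite gt_eqF.
by rewrite lerD2l; lra.
Qed.

End Gaps.

(** * Functions that are controlled by halving the argument *)

Section Growth.
Variable R : realType.

(** Induction on the halved argument: [n `^ eps] decreases by the factor
    [2^-1 `^ eps] when [n] is halved, and what is gained exceeds, from some rank
    [n0] on, the logarithm of the polynomial factor. *)
Lemma weakly_exponential (f : nat -> nat) (A : R) (p : nat) : 0 < A ->
  (forall n, (0 < n)%N -> (f n)%:R <= A * n.+1%:R ^+ p * (f n./2)%:R) ->
  forall eps : R, 0 < eps ->
    exists2 C : R, 0 < C & forall n : nat, (f n)%:R <= C * expR (n%:R `^ eps).
Proof.
move=> A0 hf eps e0.
pose c := 1 - 2^-1 `^ eps : R.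
have c0 : 0 < c.
  have : 2^-1 `^ eps < 1 `^ eps :> R.
    by apply: gt0_ltr_powR; rewrite ?nnegrE ?invf_lt1 ?ltr1n.
  by rewrite powR1 /c subr_gt0.
pose b := p%:R * (2 / eps) : R.
have b0 : 0 <= b by rewrite mulr_ge0 // divr_ge0 // ltW.
pose a := `|ln A| + p%:R : R.
have a0 : 0 <= a by rewrite addr_ge0.
pose z0 := 1 + (a + b) / c.
have z01 : 1 <= z0.
  by rewrite /z0 lerDl; apply: divr_ge0; [exact: addr_ge0 | exact: ltW].
pose n0 := (Num.truncn (z0 `^ (2 / eps))).+1.
have large n : (n0 <= n)%N -> ln A + p%:R * ln n.+1%:R <= c * n%:R `^ eps.
  move=> nn; have n1 : (0 < n)%N by exact: leq_trans nn.
  have zn : z0 `^ (2 / eps) <= n%:R.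
    by apply/ltW; apply: lt_le_trans (truncnS_gt _) _; rewrite ler_nat.
  set z := n%:R `^ (eps / 2).
  have z0z : z0 <= z.
    have -> : z0 = (z0 `^ (2 / eps)) `^ (eps / 2).
      rewrite -powRrM; have -> : 2 / eps * (eps / 2) = 1 by field; rewrite gt_eqF.
      by rewrite powRr1 // (le_trans ler01).
    by apply: ge0_ler_powR; rewrite ?nnegrE ?powR_ge0 ?divr_ge0 // ltW.
  have zE : n%:R `^ eps = z ^+ 2.
    rewrite /z -powR_mulrn ?powR_ge0 // -powRrM; congr (_ `^ _).
    by field.
  have z1 : 1 <= z by lra.
  have lnz : ln z <= z.
    by apply/ltW/ln_sublinear; lra.
  have lnn : ln n.+1%:R <= 1 + 2 / eps * z.
    have -> : ln n.+1%:R = ln n%:R + ln (1 + n%:R^-1) :> R.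
      have nR : 0 < n%:R :> R by rewrite ltr0n.
      rewrite -lnM ?posrE // ?addr_gt0 ?invr_gt0 //.
      by congr ln; rewrite mulrDr mulr1 divff ?pnatr_eq0 -?lt0n // -natr1.
    have : ln (1 + n%:R^-1) <= 1 :> R.
      apply: le_trans (le_ln1Dx _) _; first by rewrite (lt_le_trans (ltrN10 _)) // invr_ge0.
      by rewrite invf_le1 ?ltr0n // ler1n.
    have : ln n%:R <= 2 / eps * z.
      have -> : ln n%:R = 2 / eps * ln z by rewrite /z ln_powR; field; rewrite gt_eqF.
      by rewrite ler_wpM2l // divr_ge0 // ltW.
    lra.
  rewrite zE; have h1 : ln A <= `|ln A| by exact: ler_norm.
  have h2 : p%:R * ln n.+1%:R <= p%:R * (1 + 2 / eps * z) by rewrite ler_wpM2l.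
  have h3 : a + b * z <= c * z ^+ 2.
    have : (a + b) <= c * z.
      rewrite mulrC -ler_pdivrMr //; apply: le_trans z0z; rewrite lerDr //.
    move=> h; have : (a + b) * z <= c * z * z by rewrite ler_wpM2r //; lra.
    have : a * 1 <= a * z by rewrite ler_wpM2l.
    rewrite expr2 mulrA; lra.
  move: h3; rewrite /a /b; lra.
exists (1 + \sum_(i < n0) (f i)%:R); first by rewrite ltr_pwDl // sumr_ge0.
set C := 1 + _; have C0 : 0 <= C by rewrite /C addr_ge0 // sumr_ge0.
elim/ltn_ind => n IH; have [nn|nn] := ltnP n n0.
  apply: le_trans (_ : C <= _).
    rewrite /C (bigD1 (Ordinal nn)) //= addrCA lerDl addr_ge0 // sumr_ge0 //.
  by rewrite ler_peMr // -(@expR0 R) ler_expR powR_ge0.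
have n1 : (0 < n)%N by exact: leq_trans nn.
have n2 : (n./2 < n)%N by rewrite ltn_half_double -addnn -{1}[n]addn0 ltn_add2l.
apply: le_trans (hf _ n1) _.
have P0 : 0 < A * n.+1%:R ^+ p by rewrite mulr_gt0 // exprn_gt0.
apply: le_trans (ler_wpM2l (ltW P0) (IH _ n2)) _.
rewrite mulrCA ler_wpM2l // -[X in X * _](lnK P0) -expRD ler_expR.
rewrite lnM ?posrE ?exprn_gt0 // lnXn // -[_ *+ p]mulr_natl.
have h := large _ nn.
have : (n./2)%:R `^ eps <= 2^-1 `^ eps * n%:R `^ eps.
  rewrite -powRM // ?invr_ge0 //; apply: (ge0_ler_powR (ltW e0)); rewrite ?nnegrE //.
  rewrite mulrC ler_pdivlMr // -natrM ler_nat muln2.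
  by rewrite -{2}[n]odd_double_half leq_addl.
move: h; rewrite /c; lra.
Qed.

End Growth.

(** * The recursive bound on the number of words *)

Lemma count_nth_le (T : Type) (x0 : T) (p : pred T) (s : seq T) a n :
  (a + n <= size s)%N ->
  (count (fun j => p (nth x0 s (a + j))) (iota 0 n) <= count p s)%N.
Proof.
move=> h; have -> : count (fun j => p (nth x0 s (a + j))) (iota 0 n) =
    count p (take n (drop a s)).
  rewrite -[in RHS](@mkseq_nth _ x0 (take n (drop a s))) /mkseq count_map.
  rewrite size_take size_drop.
  have -> : (if (n < size s - a)%N then n else (size s - a)%N) = n by case: ltnP; lia.
  apply: eq_in_count => j; rewrite mem_iota => /andP[_ jn].
  by rewrite /= nth_take // nth_drop.
apply: (@leq_trans (count p (drop a s))).
  by rewrite -{2}(cat_take_drop n (drop a s)) count_cat leq_addr.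
by rewrite -{2}(cat_take_drop a s) count_cat leq_addl.
Qed.

Lemma count_sub_in (T : eqType) (a b : pred T) (s : seq T) :
  (forall x, x \in s -> a x -> b x) -> (count a s <= count b s)%N.
Proof.
elim: s => //= x s IH h; apply: leq_add; last first.
  by apply: IH => y ys; apply: h; rewrite inE ys orbT.
by have := h x (mem_head _ _); case: (a x) => // ->.
Qed.

Section Recursion.
Variable R : realType.
Local Notation C := R[i].
Variable m : 'I_3 -> 'I_3 -> R.
Hypothesis m_diag : forall j, m j j = -1.
Hypothesis m_sum : forall j, \sum_i m j i = 1.

Definition coord (st : state) (w : seq bool) : R :=
  vertex m st (slope st 0) w / vertex m st (far R st) w.

Lemma coordE st x w : proper st -> hits m st x w -> coord st w = x.
Proof.
move=> pst hx; rewrite /coord -(hits_coord hx) mulfK // gt_eqF //.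
exact: lt_trans ltr01 (hits_far m_diag m_sum pst hx).
Qed.

Lemma coord_hits st n w : proper st -> w \in diagonals m st n ->
  hits m st (coord st w) w.
Proof.
by move=> pst; rewrite mem_diagonals => /andP[_ /asboolP[x hx]]; rewrite (coordE pst hx).
Qed.

Lemma follows_uniq st F w w' : follows m st F w -> follows m st F w' -> w = w'.
Proof.
elim: w w' st F => [|b w IH] [|b' w'] st F //=.
- by move=> /eqP -> /andP[]; rewrite mulr0 ltxx.
- by move=> /andP[+ _] /eqP F0; rewrite F0 mulr0 ltxx.
move=> /andP[Fb fw] /andP[Fb' fw']; have eb : b = b'.
  by move: Fb Fb'; case: b {fw}; case: b' {fw'} => //; rewrite /sgb; lra.
by move: fw'; rewrite -eb => fw'; rewrite (IH _ _ _ fw fw').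
Qed.

Lemma coord_inj st n : proper st -> {in diagonals m st n &, injective (coord st)}.
Proof.
move=> pst w w' hw hw' e; have /and3P[_ _ fw] := coord_hits pst hw.
have /and3P[_ _ fw'] := coord_hits pst hw'.
by rewrite e in fw; exact: follows_uniq fw fw'.
Qed.

Variables (T omega tau : 'I_3 -> C) (L Delta : R).
Hypothesis omega_unit : forall j, normc (omega j) = 1.
Hypothesis reflectionP : forall j k,
  crossing 1 (fun j k => real_complex R (m j k)) j T k = omega j * conjc (T k) + tau j.
Hypothesis Delta_gt0 : 0 < Delta.
Hypothesis sides_le : forall i j, normc (T i - T j) <= L.
Hypothesis area_ge : forall st, proper st -> Delta <=
  `|cross (T (side_end st false) - T (apex st))
          (T (side_end st true) - T (side_end st false))|.

Variable delta : nat -> R.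
Hypothesis delta_gt0 : forall n, 0 < delta n.
Hypothesis separation : forall n st w w', proper st ->
  w \in diagonals m st n -> w' \in diagonals m st n -> w != w' ->
  delta n <= `|coord st w - coord st w'|.

(** If the lengths of neighbouring trajectories differ by more than [k], then one
    of them has length at most [k], because [n <= 2 * k + 1]; each short
    trajectory is counted at most twice in this way. The other gaps are counted
    with the directions of the vectors of [visible_step] as points [ys]. *)
Lemma size_diagonals st n k : proper st -> (n <= k.*2.+1)%N ->
  (size (diagonals m st n))%:R <=
    1 + 2 * (size (diagonals m st k))%:R +
    (2 * (spread L Delta n + 3) *
       ((2 * n.+1).+1 ^ 3 * 2 * (9 + num_diagonals m k))%:R * ln (1 + (delta n)^-1)
     + (spread L Delta n + 1)) :> R.
Proof.
move=> pst nk; pose leT u v := coord st u <= coord st v.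
pose ws := sort leT (diagonals m st n); pose xs := map (coord st) ws.
have tr : transitive leT by move=> x y z; exact: le_trans.
have tot : total leT by move=> x y; exact: le_total.
have wsP w : (w \in ws) = (w \in diagonals m st n) by rewrite mem_sort.
have sws : size ws = size (diagonals m st n) by rewrite size_sort.
have uws : uniq ws by rewrite sort_uniq uniq_diagonals.
have sxs : size xs = size ws by rewrite size_map.
have so : sorted leT ws by exact: sort_sorted.
have nthx j : (j < size ws)%N -> xs`_j = coord st (nth [::] ws j).
  by move=> js; rewrite (nth_map [::]).
have mono i j : (i <= j)%N -> (j < size ws)%N -> xs`_i <= xs`_j.
  move=> ij js; have is_ := leq_ltn_trans ij js.
  rewrite !nthx //; exact: (sorted_leq_nth tr (fun x => lexx _) [::] so).
have neq i j : (i < size ws)%N -> (j < size ws)%N -> i != j -> xs`_i != xs`_j.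
  move=> is_ js ij; rewrite !nthx //; apply: contra ij => /eqP e.
  have := @coord_inj st n pst (nth [::] ws i) (nth [::] ws j).
  rewrite -!wsP !mem_nth // => /(_ isT isT e) e'.
  by rewrite -(nth_uniq [::] is_ js uws) e'.
pose P j := ((size (nth [::] ws j) <= size (nth [::] ws j.+1) + k) &&
             (size (nth [::] ws j.+1) <= size (nth [::] ws j) + k))%N.
pose K := spread L Delta n + 1.
have K0 : 0 <= K.
  by rewrite addr_ge0 // ltW // (spread_gt0 Delta_gt0 sides_le area_ge).
pose ys := map (direction T st) (steps m T omega n.+1 k).
have memw j : (j < size ws)%N -> nth [::] ws j \in diagonals m st n.
  by move=> js; rewrite -wsP mem_nth.
have hitw j : (j < size ws)%N -> hits m st xs`_j (nth [::] ws j).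
  by move=> js; rewrite nthx //; exact: coord_hits (memw _ js).
have x01 x : x \in xs -> 0 <= x <= 1.
  move=> /mapP[w]; rewrite wsP => /(coord_hits pst) /and3P[h1 h2 _] ->.
  by rewrite !ltW.
have gap j : (j.+1 < size xs)%N -> delta n <= xs`_j.+1 - xs`_j.
  rewrite sxs => js; have js' := ltnW js.
  rewrite -[leRHS]ger0_norm ?subr_ge0 ?mono // !nthx //.
  by apply: separation => //; [exact: memw..|rewrite nth_uniq // gtn_eqF].
have hP j : (j.+1 < size xs)%N -> P j -> 2 <= K * (xs`_j.+1 - xs`_j) \/
     exists2 y, y \in ys & `|y - xs`_j| <= K * (xs`_j.+1 - xs`_j).
  rewrite sxs => js /andP[k1 k2]; have js' := ltnW js.
  have e : xs`_j.+1 - xs`_j = `|xs`_j.+1 - xs`_j|.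
    by rewrite ger0_norm // subr_ge0 mono.
  rewrite e; apply: (neighbour_direction m_diag m_sum omega_unit reflectionP
     Delta_gt0 sides_le area_ge pst _ (hitw _ js') (hitw _ js)) => //.
  - by rewrite neq // ltn_eqF.
  - by have := memw _ js'; rewrite mem_diagonals => /andP[].
  - by have := memw _ js; rewrite mem_diagonals => /andP[].
  - move=> t u /andP[t0 t1] su; apply/negP => hu.
    set y := _ + _ in hu.
    have uD : u \in diagonals m st n.
      by rewrite mem_diagonals su; apply/asboolP; exists y.
    have ey := coordE pst hu.
    have g0 : 0 < xs`_j.+1 - xs`_j by apply: lt_le_trans (gap _ _); rewrite ?sxs.
    have : xs`_j < y < xs`_j.+1.
      rewrite /y; apply/andP; split.
        by have := mulr_gt0 t0 g0; lra.
      have t1' : 0 < 1 - t by rewrite subr_gt0.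
      by have := mulr_gt0 t1' g0; lra.
    move: uD; rewrite -wsP => uD; set i := index u ws.
    have is_ : (i < size ws)%N by rewrite index_mem.
    have -> : y = xs`_i by rewrite nthx // nth_index.
    case: (leqP i j) => ij /andP[h1 h2].
      by have := mono _ _ ij js'; rewrite leNgt h1.
    by have := mono _ _ ij is_; rewrite leNgt h2.
have := count_gaps K0 (delta_gt0 n) x01 gap hP.
have -> : size ys = ((2 * n.+1).+1 ^ 3 * 2 * (9 + num_diagonals m k))%N.
  by rewrite size_map size_steps.
rewrite sxs => good.
have cs : (count (fun w : seq bool => size w <= k) ws <= size (diagonals m st k))%N.
  rewrite -size_filter; apply: uniq_leq_size; first by rewrite filter_uniq.
  by move=> w; rewrite mem_filter wsP !mem_diagonals => /andP[-> /andP[_ ->]].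
have [s0|s0] := posnP (size ws).
  have l0 : 0 <= ln (1 + (delta n)^-1) by rewrite ln_ge0 // lerDl invr_ge0 ltW.
  have K1 : 0 <= spread L Delta n.
    exact: ltW (spread_gt0 Delta_gt0 sides_le area_ge n).
  rewrite -sws s0 mulr0n; set N := (X in _ * X%:R * _); set M := size (diagonals _ _ _).
  have h1 : 0 <= 2 * (spread L Delta n + 3) * N%:R * ln (1 + (delta n)^-1).
    by apply: mulr_ge0 => //; apply: mulr_ge0 => //; apply: mulr_ge0 => //; apply: addr_ge0.
  have h2 : 0 <= M%:R :> R by [].
  by lra.
have bad : (count (predC P) (iota 0 (size ws).-1) <= 2 * size (diagonals m st k))%N.
  pose short w := (size (w : seq bool) <= k)%N.
  have sub : forall j, j \in iota 0 (size ws).-1 -> predC P j ->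
     (predU (fun j => short (nth [::] ws (0 + j))) (fun j => short (nth [::] ws (1 + j)))) j.
    move=> j; rewrite mem_iota add0n => /andP[_ js]; rewrite /= /short add0n add1n.
    have js1 : (j.+1 < size ws)%N by rewrite -(prednK s0) ltnS.
    have := memw _ js1; have := memw _ (ltnW js1); rewrite !mem_diagonals.
    move=> /andP[s1 _] /andP[s2 _]; rewrite /P negb_and -!ltnNge => h.
    case/orP: h => h; apply/orP; [right|left].
      by have := leq_trans h (leq_trans s1 nk); rewrite ltnS -addnn leq_add2r.
    by have := leq_trans h (leq_trans s2 nk); rewrite ltnS -addnn leq_add2r.
  apply: leq_trans (count_sub_in sub) _.
  set a := (X in predU X _); set b := (X in predU _ X); set io := iota 0 _.
  apply: (@leq_trans (count a io + count b io)%N).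
    by rewrite -count_predUI leq_addr.
  rewrite mul2n -addnn leq_add // (leq_trans _ cs) //.
    by apply: count_nth_le; rewrite add0n leq_pred.
  by apply: count_nth_le; rewrite add1n prednK.
have := count_predC P (iota 0 (size ws).-1); rewrite size_iota => e.
rewrite -sws -(prednK s0) -e -addn1 natrD natrD.
have : (count (predC P) (iota 0 (size ws).-1))%:R <= 2 * (size (diagonals m st k))%:R :> R.
  by rewrite -natrM ler_nat.
rewrite /K in good; have : spread L Delta n + 1 + 2 = spread L Delta n + 3 by ring.
move=> e3; rewrite e3 in good; lra.
Qed.

Variable B : R.
Hypothesis B_ge0 : 0 <= B.
Hypothesis delta_exp : forall n, delta n = expR (- (B * n.+1%:R ^+ 2)).

Lemma ln_delta n : ln (1 + (delta n)^-1) <= (1 + B) * n.+1%:R ^+ 2.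
Proof.
have z1 : 1 <= n.+1%:R ^+ 2 :> R by rewrite exprn_ege1 // ler1n.
set z := n.+1%:R ^+ 2 in z1 *; have Bz : 0 <= B * z by rewrite mulr_ge0 //; lra.
have e1 : 1 <= expR (B * z) by rewrite -(@expR0 R) ler_expR.
rewrite delta_exp -/z expRN invrK; apply: (@le_trans _ _ (ln (2 * expR (B * z)))).
  by rewrite ler_ln ?posrE; lra.
rewrite lnM ?posrE ?expR_gt0 // expRK mulrDl mul1r lerD2r (le_trans _ z1) //.
by have := @le_ln1Dx R 1; apply; lra.
Qed.

(** The spread, the number of short vectors and the logarithm of the smallest gap
    contribute the powers 1, 3 and 2 of [n]. *)
Lemma num_diagonals_recursion : exists2 A : R, 0 < A & forall n,
  (num_diagonals m n).+1%:R <= A * n.+1%:R ^+ 6 * (num_diagonals m n./2).+1%:R.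
Proof.
pose s0 := 8 * L ^+ 4 / Delta ^+ 2; pose c := (size states)%:R : R.
have s00 : 0 <= s0 by rewrite divr_ge0 ?mulr_ge0 ?exprn_ge0 ?(ltW Delta_gt0) ?(L_ge0 sides_le).
have c0 : 0 <= c by [].
(* Here 972 = 2 * 3 ^ 3 * 2 * 9, since [(2 * n.+1).+1 <= 3 * n.+1]. *)
have [q q0 qE] : exists2 q : R, 0 <= q & q = 972 by exists 972; [exact: ler0n | reflexivity].
exists (3 + c + c * (q * (s0 + 3) * (1 + B) + s0 + 1)).
  have : 0 <= c * (q * (s0 + 3) * (1 + B) + s0 + 1).
    by rewrite mulr_ge0 // !addr_ge0 // !mulr_ge0 // addr_ge0.
  lra.
move=> n; set k := n./2; set f := num_diagonals m k.
pose z := n.+1%:R : R; pose F := f.+1%:R : R; pose W := z ^+ 6 * F.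
have z1 : 1 <= z by rewrite ler1n.
have F1 : 1 <= F by rewrite ler1n.
have zW : z <= W.
  have z5 : 1 <= z ^+ 5 * F by apply: mulr_ege1 => //; rewrite exprn_ege1.
  by rewrite /W exprS -mulrA ler_peMr //; lra.
have FW : F <= W by rewrite ler_peMl ?exprn_ege1 //; lra.
have W1 : 1 <= W by lra.
have nk : (n <= k.*2.+1)%N.
  by rewrite -{1}[n]odd_double_half -addn1 addnC leq_add2l; case: odd.
have sp : spread L Delta n <= s0 * z.
  have -> : spread L Delta n = s0 / 2 * (n + 2)%:R.
    by rewrite /spread /s0; field; rewrite gt_eqF.
  have h : (n + 2)%:R <= 2 * z.
    by rewrite /z -natrM ler_nat addn2 mul2n doubleS !ltnS -addnn leq_addr.
  have -> : s0 * z = s0 / 2 * (2 * z) by field.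
  by apply: ler_wpM2l => //; apply: divr_ge0.
have sp0 := ltW (spread_gt0 Delta_gt0 sides_le area_ge n).
have ln0 : 0 <= ln (1 + (delta n)^-1) by rewrite ln_ge0 // lerDl invr_ge0 ltW.
pose X := (q * (s0 + 3) * (1 + B) + s0 + 1) * W.
have bound st : st \in states ->
    (size (diagonals m st n))%:R <= 1 + 2 * (size (diagonals m st k))%:R + X.
  rewrite mem_states => pst; apply: le_trans (size_diagonals pst nk) _.
  have -> : X = q * (s0 + 3) * (1 + B) * W + (s0 + 1) * W by rewrite /X; ring.
  rewrite lerD2l; apply: lerD; last first.
    apply: (@le_trans _ _ ((s0 + 1) * z)); last by rewrite ler_wpM2l ?addr_ge0.
    by rewrite mulrDl mul1r lerD.
  have hY : ((2 * n.+1).+1 ^ 3 * 2 * (9 + num_diagonals m k))%:R <=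
      (3 * z) ^+ 3 * 2 * (9 * F).
    rewrite natrM; apply: ler_pM; [exact: ler0n|exact: ler0n| |].
      rewrite natrM ler_wpM2r // natrX lerXn2r ?nnegrE ?ler0n //.
        by apply: mulr_ge0; [exact: ler0n|lra].
      by rewrite -natrM ler_nat -add1n (mulSn 2) leq_add2r.
    by rewrite natrD /F -natr1 -/f; have : 0 <= f%:R :> R by []; lra.
  set Y := _%:R in hY *; have Y0 : 0 <= Y by exact: ler0n.
  have -> : q * (s0 + 3) * (1 + B) * W =
     2 * ((s0 + 3) * z) * ((3 * z) ^+ 3 * 2 * (9 * F)) * ((1 + B) * z ^+ 2).
    by rewrite /W qE; ring.
  have sp3 : 0 <= spread L Delta n + 3 by apply: addr_ge0.
  apply: ler_pM; [|exact: ln0| |exact: ln_delta].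
    by apply: mulr_ge0 => //; apply: mulr_ge0.
  apply: ler_pM => //; first by apply: mulr_ge0.
  apply: ler_wpM2l => //; rewrite mulrDl; apply: lerD => //.
  by rewrite ler_peMr.
have tot : (num_diagonals m n)%:R <= c + 2 * f%:R + c * X.
  rewrite /num_diagonals natr_sum.
  apply: (@le_trans _ _ (\sum_(st <- states) (1 + 2 * (size (diagonals m st k))%:R + X))).
    by rewrite !big_seq; apply: ler_sum.
  rewrite !big_split /= -mulr_sumr -natr_sum !big_const_seq !count_predT.
  by rewrite !iter_addr_0 -[X *+ _]mulr_natl.
rewrite -addn1 natrD; apply: le_trans (lerD tot (lexx _)) _.
rewrite -mulrA -/z -/F -/W; have -> : c + 2 * f%:R + c * X + 1 =
  1 + 2 * f%:R + c + c * X by ring.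
rewrite !mulrDl /X mulrA lerD2r; apply: lerD; last by rewrite ler_peMr.
have : F = f%:R + 1 by rewrite /F -natr1.
lra.
Qed.

Lemma num_diagonals_weakly_exponential (eps : R) : 0 < eps ->
  exists2 C : R, 0 < C &
    forall n, (num_diagonals m n).+1%:R <= C * expR (n%:R `^ eps).
Proof.
have [A A0 hA] := num_diagonals_recursion.
apply: (@weakly_exponential R (fun n => (num_diagonals m n).+1) A 6 A0) => n _.
exact: hA.
Qed.

End Recursion.

Local Open Scope classical_set_scope.
Local Open Scope ring_scope.

(** * Small values of integer polynomials at cotangents *)

Section Cotangent.
Variable R : realType.

(** Extended by zero, in order to be measurable on the whole line. *)
Definition cot (a : R) : R := (fun a => cos a / sin a) \_ `]0, pi[ a.
Definition acot (x : R) : R := pi / 2 - atan x.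

Lemma cotE a : 0 < a < pi -> cot a = cos a / sin a.
Proof. by move=> h; rewrite /cot patchT // inE /= in_itv. Qed.

Lemma cotK a : 0 < a < pi -> acot (cot a) = a.
Proof.
move=> h; rewrite cotE // /acot.
have -> : cos a / sin a = tan (pi / 2 - a).
  rewrite /tan -opprB cosN sinN sinBpihalf cosBpihalf opprK //.
rewrite tanK; first by ring.
by rewrite in_itv /=; move: h => /andP[h1 h2]; apply/andP; split; lra.
Qed.

Lemma atan_lipschitz (x y : R) : `|atan x - atan y| <= `|x - y|.
Proof.
wlog xy : x y / x <= y.
  move=> h; case: (leP x y) => [|/ltW] xy; first exact: h.
  by rewrite distrC (distrC x); exact: h.
have [|c _ e] := @MVT_segment R atan (fun x => (1 + x ^+ 2)^-1) x y xy.
- by apply: continuous_subspaceT => z; exact: continuous_atan.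
rewrite distrC e normrM (distrC x) ler_piMl //.
rewrite ger0_norm ?invr_ge0 ?addr_ge0 ?sqr_ge0 //.
by rewrite invf_le1 ?lerDl ?sqr_ge0 // ltr_wpDr ?sqr_ge0.
Qed.

(** The inverse cotangent is Lipschitz with constant 1: a cotangent close to [x]
    comes from an angle close to [acot x]. *)
Lemma cot_near a x : 0 < a < pi -> `|a - acot x| <= `|cot a - x|.
Proof.
move=> h; rewrite -{1}(cotK h) /acot.
have -> : pi / 2 - atan (cot a) - (pi / 2 - atan x) = - (atan (cot a) - atan x) by ring.
by rewrite normrN atan_lipschitz.
Qed.

Lemma measurable_cot : measurable_fun setT cot.
Proof.
suff h : measurable_fun (`]0, pi[ : set R) (fun a => cos a / sin a).
  by apply: (proj1 (measurable_restrictT _ _)) h; exact: measurable_itv.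
apply: open_continuous_measurable_fun; first by apply: interval_open.
move=> a; rewrite inE /= in_itv /= => h.
apply: (@continuousM _ _ cos (fun a => (sin a)^-1)); first exact: continuous_cos.
apply: (@continuousV _ _ sin); last exact: continuous_sin.
by rewrite gt_eqF // sin_gt0_pi.
Qed.

(** The angles whose cotangents may be closer than [rho] to a point of [xs]. *)
Definition near_angles (xs : seq R) (rho : R) : set R :=
  \big[setU/set0]_(x <- xs) [set` `[acot x - rho, acot x + rho]].

Lemma measurable_near_angles xs rho : measurable (near_angles xs rho).
Proof. by apply: bigsetU_measurable => x _; exact: measurable_itv. Qed.

Lemma near_angles_le xs rho : 0 <= rho ->
  (lebesgue_measure (near_angles xs rho) <= ((size xs)%:R * (2 * rho))%:E)%E.
Proof.
move=> r0; elim: xs => [|x xs IH]; first by rewrite /near_angles big_nil measure0 mul0r.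
rewrite /near_angles big_cons.
apply: le_trans; first apply: measureU2.
- exact: measurable_itv.
- exact: measurable_near_angles.
rewrite /= -natr1 mulrDl mul1r addrC EFinD leeD //.
rewrite lebesgue_measure_itv /=; case: ifP => _; last by rewrite lee_fin mulr_ge0.
by rewrite -EFinB lee_fin; lra.
Qed.

Lemma near_angles_out xs rho a : 0 < a < pi -> ~ near_angles xs rho a ->
  forall x, x \in xs -> rho <= `|cot a - x|.
Proof.
move=> h na x xxs; rewrite leNgt; apply/negP => cx; apply: na.
rewrite /near_angles -bigcup_seq; exists x => //=.
have := le_lt_trans (cot_near x h) cx; rewrite ltr_norml in_itv /=.
by move=> /andP[h1 h2]; apply/andP; split; lra.
Qed.

(** Over the complex numbers the polynomial splits, and a real number is at least
    as far from a complex root as from the real part of that root. *)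
Lemma poly_lower_bound (p : {poly R}) : exists xs : seq R,
  size xs = (size p).-1 /\
  forall u, `|lead_coef p| * \prod_(x <- xs) `|u - x| <= `|p.[u]|.
Proof.
pose toC := real_complex R; pose q := map_poly toC p.
have [r qr] := closed_field_poly_normal q.
have [p0|p0] := eqVneq p 0.
  by exists [::]; rewrite p0 size_poly0 lead_coef0 normr0; split=> // u; rewrite mul0r.
have lq : lead_coef q = toC (lead_coef p) by rewrite lead_coef_map.
exists (map (@complex.Re R) r); split.
  rewrite size_map -(size_map_poly toC p) -/q qr size_scale; last first.
    by rewrite lq fmorph_eq0 lead_coef_eq0.
  by rewrite size_prod_XsubC.
move=> u; have nR (x : R) : normc (toC x) = `|x|.
  by rewrite /normc /= expr0n addr0 sqrtr_sqr.
have nprod (s : seq R[i]) (F : R[i] -> R[i]) :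
    normc (\prod_(z <- s) F z) = \prod_(z <- s) normc (F z).
  by elim: s => [|z s IH]; rewrite ?big_nil ?normc1 // !big_cons normcM IH.
have e : toC p.[u] = q.[toC u] by rewrite /q /toC horner_map.
rewrite -(nR p.[u]) e qr lq hornerZ normcM nR ler_wpM2l //.
rewrite horner_prod nprod big_map; apply: ler_prod => z _.
rewrite normr_ge0 hornerXsubC /=; case: z => a b /=.
by rewrite -sqrtr_sqr ler_wsqrtr // lerDl sqr_ge0.
Qed.

End Cotangent.

Section Evaluation.
Variable R : realType.
Local Notation Zuv := {poly {poly int}}.

Definition eval1 (u : R) (c : {poly int}) : R := (map_poly intr c).[u].
HB.instance Definition _ u :=
  GRing.RMorphism.copy (eval1 u) (horner_eval u \o map_poly (intr : int -> R)).

Definition eval2 (u v : R) (Q : Zuv) : R := (map_poly (eval1 u) Q).[v].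
HB.instance Definition _ u v :=
  GRing.RMorphism.copy (eval2 u v) (horner_eval v \o map_poly (eval1 u)).

Lemma eval1E u (c : {poly int}) : eval1 u c = \sum_(i < size c) (c`_i)%:~R * u ^+ i.
Proof.
rewrite /eval1 (@horner_coef_wide _ (size c)) ?size_poly //.
by apply: eq_bigr => i _; rewrite coef_map.
Qed.

Lemma eval2E u v Q : eval2 u v Q = \sum_(i < size Q) eval1 u Q`_i * v ^+ i.
Proof.
rewrite /eval2 (@horner_coef_wide _ (size Q)) ?size_poly //.
by apply: eq_bigr => i _; rewrite coef_map.
Qed.

Definition degree_le (k : nat) (Q : Zuv) : Prop :=
  (size Q <= k.+1)%N /\ forall i, (size (Q`_i)%R <= k.+1)%N.

Lemma degree_leW k l Q : (k <= l)%N -> degree_le k Q -> degree_le l Q.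
Proof.
by move=> kl [h1 h2]; split=> [|i]; [apply: leq_trans h1 _|apply: leq_trans (h2 i) _].
Qed.

Lemma degree_le0 k : degree_le k 0.
Proof. by split=> [|i]; rewrite ?coef0 size_poly0. Qed.

Lemma degree_leD k P Q : degree_le k P -> degree_le k Q -> degree_le k (P + Q).
Proof.
move=> [p1 p2] [q1 q2]; split=> [|i].
  by apply: leq_trans (size_polyD _ _) _; rewrite geq_max p1.
by rewrite coefD; apply: leq_trans (size_polyD _ _) _; rewrite geq_max p2 q2.
Qed.

Lemma degree_leN k P : degree_le k P -> degree_le k (- P).
Proof. by move=> [p1 p2]; split=> [|i]; rewrite ?coefN size_polyN. Qed.

Lemma degree_leM k l P Q : degree_le k P -> degree_le l Q -> degree_le (k + l) (P * Q).
Proof.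
move=> [p1 p2] [q1 q2]; split=> [|i].
  apply: leq_trans (size_polyMleq _ _) _.
  by move: p1 q1; case: (size P) => [|a]; case: (size Q) => [|b] /=; lia.
rewrite coefM; apply: leq_trans (size_sum _ _ _) _; apply/bigmax_leqP => j _.
apply: leq_trans (size_polyMleq _ _) _; move: (p2 j) (q2 (i - j)%N).
by case: (size _) => [|a]; case: (size _) => [|b] /=; lia.
Qed.

Lemma degree_le_sum k (I : Type) (s : seq I) (F : I -> Zuv) :
  (forall i, degree_le k (F i)) -> degree_le k (\sum_(i <- s) F i).
Proof.
move=> h; elim: s => [|i s IH]; first by rewrite big_nil; exact: degree_le0.
by rewrite big_cons; exact: degree_leD.
Qed.

Lemma measurable_eval2 Q :
  measurable_fun setT (fun z : R * R => eval2 (cot z.1) (cot z.2) Q).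
Proof.
have -> : (fun z : R * R => eval2 (cot z.1) (cot z.2) Q) = fun z =>
    \sum_(i < size Q) (\sum_(j < size Q`_i) ((Q`_i)`_j)%:~R * cot z.1 ^+ j) * cot z.2 ^+ i.
  by apply/funext => z; rewrite eval2E; apply: eq_bigr => i _; rewrite eval1E.
have m1 : measurable_fun setT (fun z : R * R => cot z.1).
  by apply: measurableT_comp; [exact: measurable_cot|exact: measurable_fst].
have m2 : measurable_fun setT (fun z : R * R => cot z.2).
  by apply: measurableT_comp; [exact: measurable_cot|exact: measurable_snd].
apply: measurable_sum => i; apply: measurable_funM; last exact: measurable_funX.
apply: measurable_sum => j; apply: measurable_funM; first exact: measurable_cst.
exact: measurable_funX.
Qed.

Definition small_set (Q : Zuv) (c : R) : set (R * R) :=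
  [set z | [/\ 0 < z.1 < pi, 0 < z.2 < pi & `|eval2 (cot z.1) (cot z.2) Q| < c]].

Lemma measurable_small_set Q c : measurable (small_set Q c).
Proof.
have -> : small_set Q c = ((`]0, pi[ : set R) `*` (`]0, pi[ : set R)) `&`
    ((fun z : R * R => eval2 (cot z.1) (cot z.2) Q) @^-1` (`](- c), c[ : set R)).
  apply/seteqP; split => z; rewrite /small_set /= !in_itv /= => h.
    by case: h => h1 h2; rewrite ltr_norml => h3; split.
  by case: h => [[h1 h2]] h3; rewrite ltr_norml; split.
apply: measurableI; first by apply: measurableX; exact: measurable_itv.
rewrite -[X in measurable X]setTI; apply: measurable_eval2 => //.
Qed.

(** The leading coefficient, a non-zero integer, has absolute value at least 1. *)
Lemma int_poly_lower_bound (c : {poly int}) : c != 0 -> exists xs : seq R,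
  size xs = (size c).-1 /\ forall u, \prod_(x <- xs) `|u - x| <= `|eval1 u c|.
Proof.
move=> c0; have [xs [sx hx]] := poly_lower_bound (map_poly (intr : int -> R) c).
have inj : injective (intr : int -> R) by exact: intr_inj.
exists xs; split; first by rewrite sx size_map_inj_poly.
move=> u; apply: le_trans (hx u); rewrite ler_peMl //.
  by rewrite prodr_ge0.
rewrite lead_coef_map_inj // -intr_norm -[1](mulr1z 1) ler_int.
by rewrite -gtz0_ge1 normr_gt0 lead_coef_eq0.
Qed.

Lemma prod_far (xs : seq R) (k : nat) (rho u : R) : (size xs <= k)%N ->
  0 < rho -> rho <= 1 -> (forall x, x \in xs -> rho <= `|u - x|) ->
  rho ^+ k <= \prod_(x <- xs) `|u - x|.
Proof.
move=> sk r0 r1 h; apply: (@le_trans _ _ (rho ^+ size xs)).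
  by rewrite ler_wiXn2l // ltW.
elim: xs {sk} h => [|x xs IH] h; first by rewrite big_nil.
rewrite big_cons exprS ler_pM ?exprn_ge0 ?(ltW r0) //.
  by apply: h; rewrite mem_head.
by apply: IH => y ys; apply: h; rewrite inE ys orbT.
Qed.

(** The outer leading coefficient of [Q] is a non-zero integer polynomial, and
    it is bounded from below as soon as the first angle is away from few angles.
    For such a first angle, [Q] becomes a polynomial in one variable whose
    leading coefficient is bounded from below, and it is small only if the
    second angle is close to few angles. *)
Lemma small_set_le (Q : Zuv) (k : nat) (rho : R) : Q != 0 -> degree_le k Q ->
  0 < rho -> rho <= 1 ->
  ((@lebesgue_measure R \x @lebesgue_measure R)%E (small_set Q (rho ^+ (k + k))) <=
     (4 * pi * k%:R * rho)%:E)%E.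
Proof.
move=> Q0 [dQ dc] r0 r1; set A := small_set _ _.
have mA : measurable A by exact: measurable_small_set.
have q0 : lead_coef Q != 0 by rewrite lead_coef_eq0.
have [xs1 [s1 b1]] := int_poly_lower_bound q0.
have sk1 : (size xs1 <= k)%N by rewrite s1 -subn1 leq_subLR add1n; exact: dc.
pose J := near_angles xs1 rho; pose I : set R := `]0, pi[%classic.
have mJ : measurable J by exact: measurable_near_angles.
have mI : measurable I by exact: measurable_itv.
have pi0 : 0 <= pi :> R by exact: pi_ge0.
have kr0 : 0 <= k%:R * (2 * rho) by rewrite mulr_ge0 // mulr_ge0 // ltW.
have muI : lebesgue_measure I = pi%:E.
  by rewrite /I lebesgue_measure_itv /= lte_fin pi_gt0 -EFinB subr0.
have section x : (lebesgue_measure (xsection A x) <=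
    pi%:E * (\1_J x)%:E + (k%:R * (2 * rho))%:E * (\1_I x)%:E)%E.
  have mx : measurable (xsection A x) by exact: measurable_xsection.
  rewrite !indicE; have [xI|xI] := boolP (x \in I); last first.
    have -> : xsection A x = set0.
      apply/seteqP; split => y //; rewrite /xsection /= inE => -[h1 _ _].
      by move: xI; rewrite notin_setE; apply; rewrite /I /= in_itv.
    rewrite measure0 mule0 adde0 -EFinM lee_fin mulr_ge0 //.
  have hx : 0 < x < pi by move: xI; rewrite inE /I /= in_itv.
  rewrite mule1; have [xJ|xJ] := boolP (x \in J).
    rewrite mule1; apply: (@le_trans _ _ (lebesgue_measure I)).
      apply: le_measure; rewrite ?inE //.
      move=> y; rewrite /xsection /= inE => -[_ h2 _].
      by rewrite /I /= in_itv.
    by rewrite muI leeDl // lee_fin.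
  rewrite mule0 add0e; have nJ : ~ J x by move: xJ; rewrite notin_setE.
  set u := cot x; have lq : rho ^+ k <= `|eval1 u (lead_coef Q)|.
    by apply: le_trans (b1 u); apply: prod_far => //; exact: near_angles_out.
  pose p := map_poly (eval1 u) Q.
  have lq0 : eval1 u (lead_coef Q) != 0.
    by rewrite -normr_gt0; apply: lt_le_trans lq; rewrite exprn_gt0.
  have sp : size p = size Q by rewrite size_poly_eq.
  have lp : lead_coef p = eval1 u (lead_coef Q).
    by rewrite lead_coefE sp coef_map.
  have [xs2 [s2 b2]] := poly_lower_bound p.
  have sk2 : (size xs2 <= k)%N by rewrite s2 sp -subn1 leq_subLR add1n.
  apply: (@le_trans _ _ (lebesgue_measure (near_angles xs2 rho))).
    apply: le_measure; rewrite ?inE //; first exact: measurable_near_angles.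
    move=> y; rewrite /xsection /= inE => -[_ h2]; rewrite /eval2 /= => hQ.
    apply: contrapT => ny; move: hQ; apply/negP; rewrite -leNgt.
    apply: le_trans (b2 _); rewrite lp exprD ler_pM ?exprn_ge0 ?(ltW r0) //.
    by apply: prod_far => //; exact: near_angles_out.
  apply: le_trans (near_angles_le _ (ltW r0)) _.
  by rewrite lee_fin ler_wpM2r ?ler_nat // mulr_ge0 // ltW.
rewrite /product_measure1.
have i0 (B : set R) x : (0 <= (\1_B x : R)%:E)%E by rewrite lee_fin indicE.
have mi (B : set R) : measurable B -> measurable_fun setT (fun x : R => (\1_B x : R)%:E).
  by move=> mB; apply/measurable_EFinP; exact: measurable_indic.
apply: (@le_trans _ _ (\int[@lebesgue_measure R]_x (pi%:E * (\1_J x)%:E +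
    (k%:R * (2 * rho))%:E * (\1_I x)%:E))%E).
  apply: ge0_le_integral => //=.
  - exact: measurable_fun_xsection.
  - by apply: emeasurable_funD; apply: measurable_funeM; exact: mi.
rewrite ge0_integralD //; try (by move=> x _; rewrite mule_ge0 // lee_fin);
  try (by apply: measurable_funeM; exact: mi).
rewrite !ge0_integralZl_EFin //; try exact: mi.
rewrite !integral_indic // !setIT.
apply: (@le_trans _ _ (pi%:E * ((size xs1)%:R * (2 * rho))%:E +
    (k%:R * (2 * rho))%:E * pi%:E)%E).
  apply: leeD; last by rewrite -muI.
  by apply: lee_wpmul2l; [rewrite lee_fin|exact: near_angles_le (ltW r0)].
rewrite -!EFinM -EFinD lee_fin.
have : (size xs1)%:R * (2 * rho) <= k%:R * (2 * rho).
  by rewrite ler_wpM2r ?ler_nat // mulr_ge0 // ltW.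
move=> /(ler_wpM2l pi0); lra.
Qed.

End Evaluation.

Section Family.
Variable R : realType.
Local Notation Zuv := {poly {poly int}}.

Local Notation mu := ((@lebesgue_measure R \x @lebesgue_measure R)%E).

(** Small enough for [4 ^ n * n.+1 * rho n] to be summable. *)
Definition rho (n : nat) : R := 16^-1 ^+ n.+1.

Lemma rho_gt0 n : 0 < rho n.
Proof. by rewrite /rho exprn_gt0 // invr_gt0. Qed.

Lemma rho_le1 n : rho n <= 1.
Proof. by rewrite /rho exprn_ile1 // ?invr_ge0 // invf_le1 // ler1n. Qed.

(** The union over [F n] of the sets where a polynomial is small has a measure
    that is summable in [n]; by the lemma of Borel and Cantelli, almost every
    pair of angles belongs to only finitely many of these unions. *)
Lemma ae_not_small (F : nat -> seq Zuv) (a b : nat) :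
  (forall n, (size (F n) <= a * 4 ^ n)%N) ->
  (forall n Q, Q \in F n -> degree_le (b * n.+1) Q) ->
  {ae (@lebesgue_measure R \x @lebesgue_measure R)%E, forall z : R * R,
    0 < z.1 < pi -> 0 < z.2 < pi ->
    exists n0, forall n, (n0 <= n)%N -> forall Q, Q \in F n -> Q != 0 ->
      rho n ^+ (b * n.+1 + b * n.+1) <= `|eval2 (cot z.1) (cot z.2) Q|}.
Proof.
move=> sF dF.
pose S n Q := small_set Q (rho n ^+ (b * n.+1 + b * n.+1)).
pose B n (s : seq Zuv) : set (R * R) := \big[setU/set0]_(Q <- s | Q != 0) S n Q.
pose A n := B n (F n).
have mA n : measurable (A n).
  by apply: bigsetU_measurable => Q _; exact: measurable_small_set.
pose C : R := 4 * pi * b%:R * a%:R.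
have C0 : 0 <= C by rewrite /C !mulr_ge0 // pi_ge0.
have muA n : (mu (A n) <= (2 * C / (2 ^ n.+1)%:R)%:E)%E.
  pose t : R := 4 * pi * (b * n.+1)%:R * rho n.
  have t0 : 0 <= t by rewrite /t !mulr_ge0 ?pi_ge0 // ltW // rho_gt0.
  have h (s : seq Zuv) : {subset s <= F n} ->
      (mu (B n s) <= ((size s)%:R * t)%:E)%E.
    elim: s => [|Q s IH] sub; first by rewrite /B big_nil measure0 mul0r.
    have IHs : (mu (B n s) <= ((size s)%:R * t)%:E)%E.
      by apply: IH => P Ps; apply: sub; rewrite inE Ps orbT.
    have le1 : ((size s)%:R * t <= (size (Q :: s))%:R * t).
      by rewrite ler_wpM2r // ler_nat /=.
    rewrite /B big_cons; case: ifPn => Q0; last first.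
      by apply: le_trans IHs _; rewrite lee_fin.
    apply: le_trans; first apply: measureU2.
    - exact: measurable_small_set.
    - by apply: bigsetU_measurable => P _; exact: measurable_small_set.
    rewrite /= -natr1 mulrDl mul1r addrC EFinD leeD //.
    apply: small_set_le => //; [|exact: rho_gt0|exact: rho_le1].
    by apply: dF; apply: sub; rewrite mem_head.
  apply: le_trans (h _ (fun Q => id)) _; rewrite lee_fin.
  apply: (@le_trans _ _ ((a * 4 ^ n)%:R * t)).
    by rewrite ler_wpM2r // ler_nat.
  have n2 : n.+1%:R <= 2 ^+ n :> R.
    by rewrite -natrX ler_nat; exact: ltn_expl.
  have -> : (a * 4 ^ n)%:R * t = C * n.+1%:R * (4 ^+ n * rho n).
    by rewrite /t /C !natrM natrX; ring.
  have -> : 2 * C / (2 ^ n.+1)%:R = C * 2 ^+ n * (2^-1 ^+ n * 2^-1 ^+ n).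
    rewrite natrX exprS !exprVn; field.
    by rewrite expf_neq0.
  have r0 := ltW (rho_gt0 n).
  apply: ler_pM; [exact: mulr_ge0|by rewrite mulr_ge0 // exprn_ge0|by rewrite ler_wpM2l|].
  rewrite /rho exprS mulrCA -exprMn -exprMn.
  have -> : 4 / 16 = 2^-1 * 2^-1 :> R by field.
  by rewrite ler_piMl // ?exprn_ge0 // ?mulr_ge0 ?invr_ge0 // invf_le1 // ler1n.
have lim0 : mu (lim_sup_set A) = 0.
  apply: lim_sup_set_cvg0 => //.
  apply: (@le_lt_trans _ _ (\sum_(n <oo) (2 * C / (2 ^ n.+1)%:R)%:E)%E).
    by apply: lee_nneseries => n _ //; exact: muA.
  apply: (@le_lt_trans _ _ (2 * C)%:E); last exact: ltry.
  by apply: epsilon_trick0; rewrite mulr_ge0.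
exists (lim_sup_set A); split.
- apply: bigcap_measurable => [|n _]; first by exists 0%N.
  by apply: bigcup_measurable => j _; exact: mA.
- exact: lim0.
move=> z /= nz n _ /=; apply: contrapT => nA; apply: nz => h1 h2.
exists n => j nj Q QF Q0; rewrite leNgt; apply/negP => sm; apply: nA.
exists j => //=; rewrite /A /B -bigcup_seq_cond; exists Q => //=.
by rewrite QF Q0.
Qed.

End Family.

(** * Directions as quotients of integer polynomials *)

Section Mirror.
Variable K : comNzRingType.

Definition den (u v : K) : K := (u + v) * (1 + u ^+ 2) * (1 + v ^+ 2).

(** With cotangents [u] and [v] of the angles at the first two vertices, the
    triangle is similar to the one with vertices [(0, 0)], [(u + v, 0)] and
    [(u, 1)]. The mirror image of the vertex [j] has the barycentric coordinate
    [-1] at [j]; the other two are determined by the projection of [j] on the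
    opposite side, and have the squared length of that side as denominator. The
    squared lengths are [(u + v) ^+ 2], [1 + u ^+ 2] and [1 + v ^+ 2]; all
    denominators divide [den u v], which multiplies the coordinates. *)
Definition mirror_num (u v : K) (j k : 'I_3) : K :=
  match (j : nat), (k : nat) with
  | 0, 1 => (1 - u * v) * (u + v) * (1 + u ^+ 2) *+ 2
  | 0, 2 => v * (u + v) ^+ 2 * (1 + u ^+ 2) *+ 2
  | 1, 0 => (1 - u * v) * (u + v) * (1 + v ^+ 2) *+ 2
  | 1, 2 => u * (u + v) ^+ 2 * (1 + v ^+ 2) *+ 2
  | 2, 0 => v * (1 + u ^+ 2) * (1 + v ^+ 2) *+ 2
  | 2, 1 => u * (1 + u ^+ 2) * (1 + v ^+ 2) *+ 2
  | _, _ => - den u v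
  end.

Lemma crossing_den (D : K) (m : 'I_3 -> 'I_3 -> K) j F :
  crossing D (fun j k => D * m j k) j F = (fun k => D * crossing 1 m j F k).
Proof.
apply/funext => k; rewrite /crossing mul1r; case: ifP => // _.
by rewrite mulr_sumr; apply: eq_bigr => i _; rewrite mulrA.
Qed.

Lemma unfolding_den (D : K) (m : 'I_3 -> 'I_3 -> K) js F :
  unfolding D (fun j k => D * m j k) F js =
  (fun k => D ^+ size js * unfolding 1 m F js k).
Proof.
elim: js F => [|j js IH] F; first by apply/funext => k; rewrite mul1r.
rewrite [unfolding _ _ _ _]/= crossing_den IH unfolding_scale.
by apply/funext => k; rewrite mulrA -exprSr.
Qed.

End Mirror.

Lemma den_rmorph (K L : comNzRingType) (f : {rmorphism K -> L}) u v :
  f (den u v) = den (f u) (f v).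
Proof. by rewrite /den !(rmorphM, rmorphD, rmorphXn, rmorph1). Qed.

Lemma mirror_num_rmorph (K L : comNzRingType) (f : {rmorphism K -> L}) u v j k :
  f (mirror_num u v j k) = mirror_num (f u) (f v) j k.
Proof.
by case: j => [[|[|[|?]]] ?] //; case: k => [[|[|[|?]]] ?] //;
  rewrite /mirror_num /= ?(rmorphN, den_rmorph)
    ?(rmorphMn, rmorphM, rmorphB, rmorphD, rmorphXn, rmorph1).
Qed.

Section MirrorField.
Variable R : realFieldType.

Definition mirror_coef (u v : R) (j k : 'I_3) : R := mirror_num u v j k / den u v.

Variables u v : R.
Hypothesis uv0 : 0 < u + v.

Lemma den_gt0 : 0 < den u v.
Proof. by rewrite /den !mulr_gt0 // ltr_pwDl ?sqr_ge0. Qed.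

Lemma mirror_diag j : mirror_coef u v j j = -1.
Proof.
have d0 := gt_eqF den_gt0.
by case: j => [[|[|[|?]]] ?] //; rewrite /mirror_coef /= mulNr divff // d0.
Qed.

Lemma mirror_sum j : \sum_i mirror_coef u v j i = 1.
Proof.
rewrite !big_ord_recl big_ord0; have d0 := gt_eqF den_gt0.
have u2 : 1 + u ^+ 2 != 0 by rewrite gt_eqF // ltr_pwDl ?sqr_ge0.
have v2 : 1 + v ^+ 2 != 0 by rewrite gt_eqF // ltr_pwDl ?sqr_ge0.
have uvn : u + v != 0 by rewrite gt_eqF.
by case: j => [[|[|[|?]]] ?] //; rewrite /mirror_coef /mirror_num /den /=; field;
  rewrite uvn u2 v2.
Qed.

End MirrorField.

Section IntegerForm.
Local Notation Zuv := {poly {poly int}}.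

Definition varU : Zuv := ('X)%:P.
Definition varV : Zuv := 'X.

(** Numerators, as polynomials in both cotangents, of the two coordinates of the
    final vertex of a word. *)
Definition far_num (st : state) (w : seq bool) : Zuv :=
  unfolding (den varU varV) (mirror_num varU varV) (fun k => (k != apex st)%:R)
    (apex st :: letters st w) (apex (final st w)).

Definition pos_num (st : state) (w : seq bool) : Zuv :=
  unfolding (den varU varV) (mirror_num varU varV)
    (fun k => (k == side_end st true)%:R)
    (apex st :: letters st w) (apex (final st w)).

(** The numerator of the difference of the directions of two words. *)
Definition comparison (st : state) (w w' : seq bool) : Zuv :=
  pos_num st w * far_num st w' - pos_num st w' * far_num st w.

Definition comparisons (n : nat) : seq Zuv :=
  [seq comparison p.1 p.2 q | p <- [seq (st, w) | st <- states, w <- words n], q <- words n].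

Lemma size_comparisons n : (size (comparisons n) <= (4 * size states) * 4 ^ n)%N.
Proof.
rewrite !size_allpairs; have h := size_words n.
apply: (@leq_trans (size states * 2 ^ n.+1 * 2 ^ n.+1)%N).
  by rewrite leq_mul // leq_mul.
by rewrite -mulnA -expnMn expnS mulnCA mulnA.
Qed.

Lemma degree_le_var : degree_le 1 varU /\ degree_le 1 varV.
Proof.
split; split=> [|i]; rewrite ?size_polyX //.
- by apply: leq_trans (size_polyC_leq1 _) _.
- by rewrite coefC; case: ifP; rewrite ?size_polyX ?size_poly0.
- by rewrite coefX; case: eqP; rewrite ?size_poly1 ?size_poly0.
Qed.

Lemma degree_le1 : degree_le 0 1.
Proof.
split=> [|i]; first by rewrite size_poly1.
by rewrite coef1; case: eqP; rewrite ?size_poly1 ?size_poly0.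
Qed.

Lemma degree_le_nat n : degree_le 0 n%:R.
Proof.
elim: n => [|n IH]; first exact: degree_le0.
by rewrite -natr1; apply: degree_leD => //; exact: degree_le1.
Qed.

Lemma degree_le_mirror : degree_le 5 (den varU varV) /\
  forall j k, degree_le 5 (mirror_num varU varV j k).
Proof.
have [dU dV] := degree_le_var; have d1 := degree_le1.
have dUV : degree_le 1 (varU + varV) by exact: degree_leD.
have dUV2 : degree_le 2 ((varU + varV) ^+ 2).
  by rewrite expr2; exact: (degree_leM dUV dUV).
have d0W k P : degree_le 0 P -> degree_le k P by exact: degree_leW.
have dU2 : degree_le 2 (1 + varU ^+ 2).
  by apply: degree_leD; [exact: d0W|rewrite expr2; exact: (degree_leM dU dU)].
have dV2 : degree_le 2 (1 + varV ^+ 2).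
  by apply: degree_leD; [exact: d0W|rewrite expr2; exact: (degree_leM dV dV)].
have dN : degree_le 2 (1 - varU * varV).
  by apply: degree_leD; [exact: d0W|apply: degree_leN; exact: (degree_leM dU dV)].
have dden : degree_le 5 (den varU varV) := degree_leM (degree_leM dUV dU2) dV2.
have dD k P : degree_le k P -> degree_le k (P *+ 2).
  by move=> h; rewrite mulr2n; exact: degree_leD.
split=> // j k.
by case: j => [[|[|[|?]]] ?] //; case: k => [[|[|[|?]]] ?] //;
  rewrite /mirror_num /=; try exact: degree_leN; apply: dD;
  do ?[exact: (degree_leM (degree_leM dN dUV) dU2)
      |exact: (degree_leM (degree_leM dV dUV2) dU2)
      |exact: (degree_leM (degree_leM dN dUV) dV2)
      |exact: (degree_leM (degree_leM dU dUV2) dV2)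
      |exact: (degree_leM (degree_leM dV dU2) dV2)
      |exact: (degree_leM (degree_leM dU dU2) dV2)].
Qed.

Lemma degree_le_unfolding js F d : (forall k, degree_le d (F k)) -> forall k,
  degree_le (5 * size js + d) (unfolding (den varU varV) (mirror_num varU varV) F js k).
Proof.
have [dD dM] := degree_le_mirror.
elim: js F d => [|j js IH] F d hF k; first by rewrite muln0 add0n.
rewrite (_ : 5 * size (j :: js) + d = 5 * size js + (5 + d))%N; last by rewrite /=; lia.
apply: (IH (crossing (den varU varV) (mirror_num varU varV) j F)) => i.
rewrite /crossing; case: ifP => _; last exact: degree_leM.
by apply: degree_le_sum => l; exact: degree_leM.
Qed.

Lemma degree_comparisons n Q : Q \in comparisons n -> degree_le (10 * n.+1) Q.
Proof.
have h (P : pred 'I_3) st w : w \in words n -> degree_le (5 * n.+1)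
    (unfolding (den varU varV) (mirror_num varU varV) (fun k => (P k)%:R)
      (apex st :: letters st w) (apex (final st w))).
  rewrite mem_words => sw; apply: (@degree_leW (5 * size (apex st :: letters st w) + 0)).
    by rewrite addn0 leq_mul2l /= size_letters ltnS.
  by apply: degree_le_unfolding => k; exact: degree_le_nat.
move=> /allpairsP[[[st w] w'] [/allpairsP[[st0 w0] [_ hw [-> ->]]] hw' ->]].
rewrite -[10%N]/(5 + 5)%N mulnDl.
apply: degree_leD; [|apply: degree_leN].
  by apply: degree_leM; [exact: (h (fun k => k == _))|exact: (h (fun k => k != _))].
by apply: degree_leM; [exact: (h (fun k => k == _))|exact: (h (fun k => k != _))].
Qed.

Variable R : realType.
Variables u v : R.
Hypothesis uv0 : 0 < u + v.

Lemma eval2_var : eval2 u v varU = u /\ eval2 u v varV = v.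
Proof.
split; first by rewrite /eval2 /varU map_polyC hornerC /= /eval1 map_polyX hornerX.
by rewrite /eval2 /varV map_polyX hornerX.
Qed.

Lemma eval2_unfolding (P : pred 'I_3) js k :
  eval2 u v (unfolding (den varU varV) (mirror_num varU varV) (fun k => (P k)%:R) js k) =
  den u v ^+ size js * unfolding 1 (mirror_coef u v) (fun k => (P k)%:R) js k.
Proof.
have [eU eV] := eval2_var; have d0 := lt0r_neq0 (den_gt0 uv0).
have <- := f_equal (fun f => f k) (unfolding_den (den u v) (mirror_coef u v) js (fun k => (P k)%:R)).
have -> : (fun j k => den u v * mirror_coef u v j k) =
    (fun j k => eval2 u v (mirror_num varU varV j k)).
  apply/funext => i; apply/funext => j.
  rewrite [RHS]mirror_num_rmorph /= eU eV /mirror_coef.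
  by rewrite mulrC divfK.
have -> : den u v = eval2 u v (den varU varV).
  by rewrite den_rmorph /= eU eV.
have -> : (fun k => (P k)%:R : R) = (fun k => eval2 u v (P k)%:R).
  by apply/funext => i; rewrite rmorph_nat.
by rewrite unfolding_rmorph.
Qed.

Lemma eval2_far st w : eval2 u v (far_num st w) =
  den u v ^+ (size w).+1 * vertex (mirror_coef u v) st (far R st) w.
Proof. by rewrite /far_num (eval2_unfolding (fun k => k != _)) /= size_letters. Qed.

Lemma eval2_pos st w : proper st -> eval2 u v (pos_num st w) =
  den u v ^+ (size w).+1 * vertex (mirror_coef u v) st (slope st 0) w.
Proof.
move=> pst.
have e : (fun k => (k == side_end st true)%:R : R) = slope st 0.
  apply/funext => k; rewrite /slope.
  have /and3P[h1 h2 h3] : [&& apex st != side_end st false,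
    apex st != side_end st true & side_end st false != side_end st true] := pst.
  case: (eqVneq k (apex st)) => [->|k1]; first by rewrite (negbTE h2).
  case: (eqVneq k (side_end st false)) => [->|k2]; first by rewrite (negbTE h3) oppr0.
  by rewrite (proper_third pst k1 k2) eqxx subr0.
by rewrite /pos_num (eval2_unfolding (fun k => k == _)) e /= size_letters.
Qed.

Local Notation mc := (mirror_coef u v).

Lemma coord_sub st n w w' : proper st ->
  w \in diagonals mc st n -> w' \in diagonals mc st n ->
  den u v ^+ ((size w).+1 + (size w').+1) * vertex mc st (far R st) w *
    vertex mc st (far R st) w' * (coord mc st w - coord mc st w') =
  eval2 u v (comparison st w w').
Proof.
move=> pst hw hw'.
have f1 := hits_far (mirror_diag uv0) (mirror_sum uv0) pst (coord_hits (mirror_diag uv0) (mirror_sum uv0) pst hw).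
have f2 := hits_far (mirror_diag uv0) (mirror_sum uv0) pst (coord_hits (mirror_diag uv0) (mirror_sum uv0) pst hw').
rewrite /comparison rmorphB !rmorphM /= !eval2_far !eval2_pos // /coord exprD.
by field; rewrite !gt_eqF //; exact: lt_trans ltr01 _.
Qed.

(** The comparison polynomial of two words is the difference of their directions
    multiplied by a power of [den u v] and by the distances of the two final
    vertices. These factors are at most exponential in [n], and the lower bound
    on the polynomial is exponential in [n.+1 ^ 2]. *)
Lemma separation_of_comparisons (L Delta : R) : 0 < Delta ->
  (forall st w, proper st -> `|vertex mc st (far R st) w| * Delta <=
     L ^+ 2 * (size w + 2)%:R) ->
  (exists n0, forall n, (n0 <= n)%N -> forall Q, Q \in comparisons n -> Q != 0 ->
      rho R n ^+ (10 * n.+1 + 10 * n.+1) <= `|eval2 u v Q|) ->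
  exists2 B : R, 0 <= B & forall n st w w', proper st ->
    w \in diagonals mc st n -> w' \in diagonals mc st n -> w != w' ->
    expR (- (B * n.+1%:R ^+ 2)) <= `|coord mc st w - coord mc st w'|.
Proof.
move=> D0 far_ub [n0 hn0].
pose a := 20 * ln 16 : R; pose d := `|ln (den u v)|; pose c := L ^+ 2 * 2 / Delta.
have a0 : 0 <= a by apply: mulr_ge0; [exact: ler0n|apply: ln_ge0; rewrite ler1n].
have c0 : 0 <= c.
  by apply: divr_ge0; [apply: mulr_ge0 => //; exact: sqr_ge0|exact: ltW].
have d0 : 0 <= d by exact: normr_ge0.
pose B := a + 2 * d + 2 * c; have B0 : 0 <= B.
  by apply: addr_ge0; [apply: addr_ge0 => //|]; apply: mulr_ge0.
have large n st w w' : (n0 <= n)%N -> proper st ->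
    w \in diagonals mc st n -> w' \in diagonals mc st n -> w != w' ->
    expR (- (B * n.+1%:R ^+ 2)) <= `|coord mc st w - coord mc st w'|.
  move=> nn pst hw hw' ww; set z := n.+1%:R ^+ 2 : R.
  have md := mirror_diag uv0; have ms := mirror_sum uv0.
  have z1 : n.+1%:R <= z by rewrite /z expr2 ler_peMl // ler1n.
  have sw : (size w <= n)%N by move: hw; rewrite mem_diagonals => /andP[].
  have sw' : (size w' <= n)%N by move: hw'; rewrite mem_diagonals => /andP[].
  have far_exp w0 : w0 \in diagonals mc st n ->
      0 < vertex mc st (far R st) w0 <= expR (c * z).
    move=> h0; have f1 := hits_far md ms pst (coord_hits md ms pst h0).
    have f0 := lt_trans ltr01 f1; rewrite f0 /=.
    apply: le_trans (_ : c * z <= _); last first.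
      by apply: le_trans (expR_ge1Dx _); rewrite lerDr.
    have := far_ub st w0 pst; rewrite gtr0_norm // -ler_pdivlMr // => h.
    apply: le_trans h _; apply: (@le_trans _ _ (c * n.+1%:R)); last by rewrite ler_wpM2l.
    have -> : c * n.+1%:R = L ^+ 2 * (2 * n.+1%:R) / Delta by rewrite /c; ring.
    rewrite ler_wpM2r ?invr_ge0 ?(ltW D0) // ler_wpM2l ?sqr_ge0 //.
    rewrite -natrM ler_nat; move: h0; rewrite mem_diagonals => /andP[h0 _].
    by rewrite addn2 mul2n doubleS !ltnS (leq_trans h0) // -addnn leq_addr.
  have /andP[f1 f2] := far_exp _ hw; have /andP[f1' f2'] := far_exp _ hw'.
  have cs := coord_sub pst hw hw'; set x := coord mc st w - _ in cs *.
  have x0 : x != 0.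
    rewrite subr_eq0; apply: contra ww => /eqP e.
    by apply/eqP; apply: (coord_inj md ms pst hw hw' e).
  set e := ((size w).+1 + (size w').+1)%N in cs.
  have dn0 := den_gt0 uv0.
  have den_exp : den u v ^+ e <= expR (2 * d * z).
    have -> : den u v ^+ e = expR (e%:R * ln (den u v)).
      by rewrite expRM_natl lnK ?posrE.
    rewrite ler_expR; apply: (@le_trans _ _ (e%:R * d)).
      by rewrite ler_wpM2l // ler_norm.
    rewrite mulrAC ler_wpM2r //; apply: (@le_trans _ _ (2 * n.+1%:R)).
      by rewrite -natrM ler_nat mul2n -addnn leq_add.
    by rewrite ler_wpM2l.
  have Q0 : comparison st w w' != 0.
    apply/eqP => Q0; move: cs; rewrite Q0 rmorph0 => /eqP.
    by rewrite mulf_eq0 (negbTE x0) orbF !mulf_eq0 (gt_eqF f1) (gt_eqF f1') !orbF expf_eq0 (gt_eqF dn0) andbF.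
  have QF : comparison st w w' \in comparisons n.
    apply/allpairsP; exists ((st, w), w'); split; rewrite ?mem_words //.
    by apply/allpairsP; exists (st, w); split; rewrite ?mem_states ?mem_words.
  have := hn0 n nn _ QF Q0; rewrite -cs !normrM => low.
  have rhoE : rho R n ^+ (10 * n.+1 + 10 * n.+1) = expR (- (a * z)).
    rewrite /rho.
    have -> : 16^-1 = expR (- ln 16) :> R by rewrite expRN lnK // posrE.
    rewrite -exprM -expRM_natl; congr expR; rewrite /a /z !natrM natrD !natrM; ring.
  rewrite rhoE in low.
  have up : `|den u v ^+ e| * `|vertex mc st (far R st) w| *
      `|vertex mc st (far R st) w'| <= expR ((2 * d + 2 * c) * z).
    have -> : (2 * d + 2 * c) * z = 2 * d * z + c * z + c * z by ring.
    rewrite !expRD (gtr0_norm f1) (gtr0_norm f1') gtr0_norm ?exprn_gt0 //.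
    apply: ler_pM => //; [by rewrite mulr_ge0 ?exprn_ge0 // ltW|exact: ltW|].
    by apply: ler_pM => //; [rewrite exprn_ge0 // ltW|exact: ltW].
  have low2 : expR (- (a * z)) <= expR ((2 * d + 2 * c) * z) * `|x|.
    by apply: le_trans low _; rewrite ler_wpM2r.
  have -> : expR (- (B * z)) = expR (- (a * z)) / expR ((2 * d + 2 * c) * z).
    by rewrite -expRN -expRD /B; congr expR; ring.
  by rewrite ler_pdivrMr ?expR_gt0 // [leRHS]mulrC.
(* A rank [n] below [n0] is replaced by [N = maxn n n0], and
   [N.+1 <= n0.+1 * n.+1]. *)
exists (B * n0.+1%:R ^+ 2); first by rewrite mulr_ge0 // sqr_ge0.
move=> n st w w' pst hw hw' ww; pose N := maxn n n0.
have sub w0 : w0 \in diagonals mc st n -> w0 \in diagonals mc st N.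
  rewrite !mem_diagonals => /andP[h ->]; rewrite andbT.
  exact: leq_trans h (leq_maxl _ _).
apply: le_trans (large N st w w' (leq_maxr _ _) pst (sub _ hw) (sub _ hw') ww).
rewrite ler_expR lerN2 -mulrA ler_wpM2l // -exprMn lerXn2r ?nnegrE //.
rewrite -natrM ler_nat /N; case: (leqP n n0) => _; [exact: leq_pmulr|exact: leq_pmull].
Qed.

End IntegerForm.

(** * Triangles in the complex plane *)

Section ComplexTriangle.
Variable R : realType.
Local Notation C := R[i].
Local Notation toC := (real_complex R).
Local Notation conjc := (@conjc R).
Local Notation Re := (@complex.Re R).
Local Notation Im := (@complex.Im R).

Definition dot (z w : C) : R := Re (conjc z * w).

Lemma conjcB (z w : C) : conjc (z - w) = conjc z - conjc w.
Proof. exact: rmorphB. Qed.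

Lemma dotE z w : dot z w = Re z * Re w + Im z * Im w.
Proof. by case: z w => a b [c d]; rewrite /dot /=; ring. Qed.

Lemma normc_sqr (z : C) : normc z ^+ 2 = Re z ^+ 2 + Im z ^+ 2.
Proof. by case: z => a b; rewrite /normc sqr_sqrtr // addr_ge0 // sqr_ge0. Qed.

Lemma dot_cross z w : dot z w ^+ 2 + cross z w ^+ 2 = (normc z * normc w) ^+ 2.
Proof. by rewrite exprMn !normc_sqr dotE crossE; ring. Qed.

Lemma dot_le z w : `|dot z w| <= normc z * normc w.
Proof.
rewrite -[leRHS]ger0_norm ?mulr_ge0 ?normc_ge0 //.
by rewrite -ler_sqr ?nnegrE // !real_normK ?num_real // -dot_cross lerDl sqr_ge0.
Qed.

Definition plane (p : 'rV[R]_2) : C := Complex (p 0 0) (p 0 1).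

Lemma planeD p q : plane (p + q) = plane p + plane q.
Proof. by rewrite /plane !mxE. Qed.
Lemma planeB p q : plane (p - q) = plane p - plane q.
Proof. by rewrite /plane !mxE. Qed.
Lemma planeZ a p : plane (a *: p) = toC a * plane p.
Proof. by apply/eqP; rewrite eq_complex /= !mxE !mul0r subr0 addr0 !eqxx. Qed.

Lemma dotvE p q : dotv p q = dot (plane p) (plane q).
Proof.
rewrite dotE /dotv mxE !big_ord_recl big_ord0 addr0 !mxE /plane /=.
by congr (_ * _ + _ * _); congr (_ _ _); apply: val_inj.
Qed.

Lemma euclidE p : euclid p = normc (plane p).
Proof. by rewrite /euclid dotvE dotE /normc /plane /= -!expr2. Qed.

Lemma angle_bound (X Z : C) : -1 <= dot X Z / (normc X * normc Z) <= 1.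
Proof.
rewrite -ler_norml normrM normfV (ger0_norm (mulr_ge0 (normc_ge0 X) (normc_ge0 Z))).
have [->|n0] := eqVneq (normc X * normc Z) 0; first by rewrite invr0 mulr0.
have np : 0 < normc X * normc Z by rewrite lt_def n0 mulr_ge0 ?normc_ge0.
by rewrite ler_pdivrMr // mul1r dot_le.
Qed.

Lemma cos_angle x y z :
  cos (angle x y z) = dot (plane x - plane y) (plane z - plane y) /
    (normc (plane x - plane y) * normc (plane z - plane y)).
Proof.
rewrite /angle dotvE !euclidE !planeB acosK // in_itv /=; exact: angle_bound.
Qed.

Lemma cot_angle x y z : 0 < angle x y z < pi ->
  cross (plane x - plane y) (plane z - plane y) != 0 ->
  cot (angle x y z) = dot (plane x - plane y) (plane z - plane y) /
     `|cross (plane x - plane y) (plane z - plane y)|.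
Proof.
move=> h; rewrite cotE // cos_angle.
have -> : sin (angle x y z) = Num.sqrt (1 - cos (angle x y z) ^+ 2).
  rewrite -sin2cos2 sqrtr_sqr gtr0_norm // sin_gt0_pi //.
rewrite cos_angle; set X := _ - _; set Z := _ - _; move=> c0.
have np : 0 < normc X * normc Z.
  rewrite lt_def mulr_ge0 ?normc_ge0 // andbT; apply: contra c0 => /eqP n0.
  by rewrite -normr_le0 -n0 cross_le.
have -> : 1 - (dot X Z / (normc X * normc Z)) ^+ 2 =
    (cross X Z / (normc X * normc Z)) ^+ 2.
  rewrite !exprMn exprVn -[1](@divff _ ((normc X * normc Z) ^+ 2)) ?expf_neq0 ?gt_eqF //.
  by rewrite -mulrBl -dot_cross addrAC subrr add0r.
rewrite sqrtr_sqr normrM normfV (gtr0_norm np); field.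
rewrite normr_eq0 c0 /= andbC; move: (gt_eqF np) => /negbT.
by rewrite mulf_eq0 negb_or.
Qed.

Lemma ord3P (i : 'I_3) : [\/ i = 0, i = 1 | i = 2%:R].
Proof.
by case: i => [[|[|[|?]]] h] //; [constructor 1|constructor 2|constructor 3]; exact: val_inj.
Qed.

Variable T : 'I_3 -> 'rV[R]_2.
Let Tc (i : 'I_3) : C := plane (T i).
Let p := Tc 1 - Tc 0.
Let c := Tc 2%:R - Tc 0.

(** Twice the area of the triangle. *)
Definition area : R := `|cross (plane (T 1) - plane (T 0)) (plane (T 2%:R) - plane (T 0))|.

Lemma noncollinear_area : noncollinear T -> 0 < area.
Proof.
move=> nc; rewrite normr_gt0; apply/eqP => c0.
have [B hB] := row_freeP nc.
have cr : (T 1 - T 0) 0 0 * (T 2%:R - T 0) 0 1 = (T 1 - T 0) 0 1 * (T 2%:R - T 0) 0 0.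
  by apply/eqP; rewrite -subr_eq0; apply/eqP; rewrite -[RHS]c0 -!planeB crossE.
have ker (a b : R) : (forall i, a * (T 1 - T 0) 0 i + b * (T 2%:R - T 0) 0 i = 0) ->
    a = 0 /\ b = 0.
  move=> h; pose z : 'rV[R]_(1 + 1) := row_mx a%:M b%:M.
  have z0 : z = 0.
    rewrite -[z]mulmx1 -hB mulmxA mul_row_col !mul_scalar_mx.
    rewrite (_ : _ + _ = 0) ?mul0mx //; apply/rowP => i.
    by rewrite !mxE; have := h i; rewrite !mxE.
  split.
    move/rowP: (z0) => /(_ (lshift 1 0)).
    by rewrite row_mxEl !mxE eqxx mulr1n.
  move/rowP: (z0) => /(_ (rshift 1 0)).
  by rewrite row_mxEr !mxE eqxx mulr1n.
have [h1 h2] : (T 2%:R - T 0) 0 0 = 0 /\ - (T 1 - T 0) 0 0 = 0.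
  apply: ker => i; have [->|->] : i = 0 \/ i = 1.
    by case: i => [[|[|?]] ?] //; [left|right]; exact: val_inj.
    by ring.
  by rewrite mulNr cr; ring.
have [h3 h4] : (T 2%:R - T 0) 0 1 = 0 /\ - (T 1 - T 0) 0 1 = 0.
  apply: ker => i; have [->|->] : i = 0 \/ i = 1.
    by case: i => [[|[|?]] ?] //; [left|right]; exact: val_inj.
    by rewrite mulNr mulrC cr; ring.
  by ring.
have [/eqP] : (1 : R) = 0 /\ (0 : R) = 0.
  apply: ker => i; rewrite mul1r mul0r addr0; have [->|->] : i = 0 \/ i = 1.
    by case: i => [[|[|?]] ?] //; [left|right]; exact: val_inj.
    by apply/eqP; rewrite -oppr_eq0 h2.
  by apply/eqP; rewrite -oppr_eq0 h4.
by rewrite oner_eq0.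
Qed.

Lemma cross_perm (x y z : C) : `|cross (y - x) (z - y)| = `|cross (x - y) (z - x)| /\
  `|cross (y - x) (z - y)| = `|cross (z - x) (y - z)|.
Proof.
by split; [rewrite -normrN|rewrite -normrN]; congr `|_|; rewrite !crossE;
  case: x y z => a0 b0 [a1 b1] [a2 b2] /=; ring.
Qed.

Lemma area_cross st : proper st ->
  `|cross (Tc (side_end st false) - Tc (apex st))
          (Tc (side_end st true) - Tc (side_end st false))| = area.
Proof.
have h0 : `|cross (Tc 1 - Tc 0) (Tc 2%:R - Tc 1)| = area.
  by congr `|_|; rewrite !crossE /=; ring.
case: st => [[i l] r]; rewrite /proper /apex /side_end /=.
have [h1 h2] := cross_perm (Tc 0) (Tc 1) (Tc 2%:R).
have [h3 h4] := cross_perm (Tc 1) (Tc 0) (Tc 2%:R).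
have [h5 h6] := cross_perm (Tc 2%:R) (Tc 0) (Tc 1).
case: (ord3P i) => ->; case: (ord3P l) => ->; case: (ord3P r) => -> //= _; lra.
Qed.

Definition axis (j : 'I_3) : C := Tc (j + 2%:R) - Tc (j + 1).
(** The square of the unit vectors along the side: multiplication by it after the
    complex conjugation is the linear part of the reflection in that side. *)
Definition omega (j : 'I_3) : C := axis j / conjc (axis j).
Definition tau (j : 'I_3) : C := Tc (j + 1) - omega j * conjc (Tc (j + 1)).
Definition reflection (j : 'I_3) (z : C) : C := omega j * conjc z + tau j.

Lemma ord3_add : [/\ (0 + 1 : 'I_3) = 1, (0 + 2%:R : 'I_3) = 2%:R,
  [/\ (1 + 1 : 'I_3) = 2%:R & (1 + 2%:R : 'I_3) = 0] &
  [/\ (2%:R + 1 : 'I_3) = 0 & (2%:R + 2%:R : 'I_3) = 1]].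
Proof. by split; [| |split|split]; apply: val_inj. Qed.

Hypothesis T_noncollinear : noncollinear T.
Variables u v : R.
Hypothesis cot_u : dot p c = u * area.
Hypothesis cot_v : normc p ^+ 2 - dot p c = v * area.

Lemma area_gt0 : 0 < area. Proof. exact: noncollinear_area. Qed.

Lemma cross_area : cross p c ^+ 2 = area ^+ 2.
Proof. by rewrite /area real_normK ?num_real. Qed.

Lemma norm_p : normc p ^+ 2 = (u + v) * area.
Proof. by rewrite mulrDl -cot_u -cot_v; ring. Qed.

Lemma cot_sum_gt0 : 0 < u + v.
Proof.
rewrite -(pmulr_lgt0 _ area_gt0) -norm_p exprn_gt0 // lt_def normc_ge0 andbT.
apply/eqP => p0; have := area_gt0; rewrite /area => h.
have := cross_le p c; rewrite p0 mul0r => h2; have : 0 < `|cross p c| by exact: h.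
by lra.
Qed.

Lemma norm_c : normc c ^+ 2 * (u + v) = (1 + u ^+ 2) * area.
Proof.
have a0 := area_gt0; apply: (mulIf (lt0r_neq0 a0)).
transitivity (normc c ^+ 2 * normc p ^+ 2); first by rewrite norm_p mulrA.
transitivity (dot p c ^+ 2 + cross p c ^+ 2); first by rewrite dot_cross exprMn mulrC.
by rewrite cot_u cross_area; ring.
Qed.

(** The barycentric coordinates of the mirror image of a vertex come from its
    projection on the opposite side. *)
Lemma mirror_axis j : mirror_coef u v j (j + 2%:R) * normc (axis j) ^+ 2 =
  2 * dot (Tc j - Tc (j + 1)) (axis j).
Proof.
have s0 := cot_sum_gt0; have sn := lt0r_neq0 s0.
have u2 : 1 + u ^+ 2 != 0 by rewrite gt_eqF // ltr_pwDl ?sqr_ge0.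
have v2 : 1 + v ^+ 2 != 0 by rewrite gt_eqF // ltr_pwDl ?sqr_ge0.
have np := norm_p; have nc := norm_c; have cu := cot_u.
have nc' : normc c ^+ 2 = (1 + u ^+ 2) * area / (u + v).
  by rewrite -nc mulfK.
have [a1 a2 [a3 a4] [a5 a6]] := ord3_add.
have pc : p = Tc 1 - Tc 0 by []; have cc : c = Tc 2%:R - Tc 0 by [].
rewrite /axis; case: (ord3P j) => ->; rewrite ?a1 ?a2 ?a3 ?a4 ?a5 ?a6.
- have -> : Tc 2%:R - Tc 1 = c - p by rewrite pc cc; ring.
  have -> : Tc 0 - Tc 1 = - p by rewrite pc; ring.
  have -> : normc (c - p) ^+ 2 = (1 + v ^+ 2) * area / (u + v).
    have -> : normc (c - p) ^+ 2 = normc c ^+ 2 + normc p ^+ 2 - 2 * dot p c.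
      by rewrite !normc_sqr dotE; case: (c) (p) => a b [d e] /=; ring.
    by rewrite nc' np cu; field.
  have -> : dot (- p) (c - p) = v * area.
    rewrite -cot_v normc_sqr !dotE; case: (c) (p) => a b [d e] /=; ring.
  by rewrite /mirror_coef /mirror_num /den /=; field; rewrite sn u2 v2.
- have -> : Tc 0 - Tc 2%:R = - c by rewrite cc; ring.
  have -> : Tc 1 - Tc 2%:R = p - c by rewrite pc cc; ring.
  have -> : normc (- c) ^+ 2 = (1 + u ^+ 2) * area / (u + v) by rewrite normcN nc'.
  have -> : dot (p - c) (- c) = normc c ^+ 2 - dot p c.
    by rewrite normc_sqr !dotE; case: (c) (p) => a b [d e] /=; ring.
  rewrite nc' cu /mirror_coef /mirror_num /den /=; field; by rewrite sn u2 v2.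
- rewrite -pc -cc np; have -> : dot c p = u * area by rewrite -cu !dotE; ring.
  by rewrite /mirror_coef /mirror_num /den /=; field; rewrite sn u2 v2.
Qed.

Lemma axis_neq0 j : axis j != 0.
Proof.
have [st [pst e1 e2]] : exists st : state, [/\ proper st, side_end st false = j + 2%:R &
    apex st = j + 1].
  exists (j + 1, j + 2%:R, j); split => //.
  by case: (ord3P j) => ->.
apply/eqP => a0; have := area_cross pst; rewrite e1 e2 -/(axis j) a0 => h.
have := area_gt0; rewrite -h /cross rmorph0 mul0r /= normr0 ltxx //.
Qed.

Lemma omega_unit j : normc (omega j) = 1.
Proof.
have n0 : normc (axis j) != 0.
  by apply: contra (axis_neq0 j) => /eqP/eq0_normc ->.
by rewrite /omega normcM normcV normc_conj divff.
Qed.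

Lemma ord3_other (j k : 'I_3) : k != j -> k = j + 1 \/ k = j + 2%:R.
Proof.
have [a1 a2 [a3 a4] [a5 a6]] := ord3_add.
case: (ord3P j) => ->; case: (ord3P k) => -> // _; rewrite ?a1 ?a2 ?a3 ?a4 ?a5 ?a6;
  by [left|right].
Qed.

Lemma conj_axis_neq0 j : conjc (axis j) != 0.
Proof. by rewrite conjc_eq0 axis_neq0. Qed.

Lemma reflection_fixed j k : k != j -> reflection j (Tc k) = Tc k.
Proof.
have n0 := conj_axis_neq0 j; rewrite /reflection /tau.
case/ord3_other => ->; first by ring.
have -> : omega j * conjc (Tc (j + 2%:R)) + (Tc (j + 1) - omega j * conjc (Tc (j + 1))) =
    Tc (j + 1) + omega j * conjc (axis j) by rewrite /axis rmorphB; ring.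
by rewrite /omega divfK // /axis; ring.
Qed.

(** The coefficients [mirror_coef], which depend only on the cotangents of the
    angles, compute the mirror images of the vertices of the actual triangle. *)
Lemma crossing_reflection j k :
  crossing 1 (fun j k => toC (mirror_coef u v j k)) j Tc k = reflection j (Tc k).
Proof.
rewrite /crossing mul1r; case: eqVneq => [->|kj]; last by rewrite reflection_fixed.
have s0 := cot_sum_gt0; have md := mirror_diag s0 j; have ms := mirror_sum s0 j.
have pst : proper (j, j + 1, j + 2%:R) by case: (ord3P j) => ->.
rewrite (sum_proper _ pst) /apex /side_end /=; rewrite (sum_proper _ pst) /= in ms.
set a := mirror_coef u v j (j + 2%:R).
rewrite md in ms; rewrite /apex /= md.
have -> : mirror_coef u v j (j + 1) = 2 - a by move: ms; rewrite /a /apex /=; lra.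
have ma : a * normc (axis j) ^+ 2 = 2 * dot (Tc j - Tc (j + 1)) (axis j).
  exact: mirror_axis.
clearbody a; apply: (mulIf (conj_axis_neq0 j)).
have -> : reflection j (Tc j) * conjc (axis j) =
    axis j * conjc (Tc j - Tc (j + 1)) + Tc (j + 1) * conjc (axis j).
  have e z : omega j * z * conjc (axis j) = axis j * z.
    by rewrite mulrAC /omega divfK // conj_axis_neq0.
  rewrite (conjcB (Tc j)) /reflection /tau.
  transitivity (omega j * conjc (Tc j) * conjc (axis j) + Tc (j + 1) * conjc (axis j)
     - omega j * conjc (Tc (j + 1)) * conjc (axis j)); first by ring.
  by rewrite !e; ring.
have e2 : toC a * (axis j * conjc (axis j)) =
    (Tc j - Tc (j + 1)) * conjc (axis j) + axis j * conjc (Tc j - Tc (j + 1)).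
  have -> : axis j * conjc (axis j) = toC (normc (axis j) ^+ 2).
    by rewrite normc_sqr; case: (axis j) => x y; apply/eqP; rewrite eq_complex /=;
      apply/andP; split; apply/eqP; ring.
  rewrite -rmorphM ma; case: (_ - _) (axis j) => x y [x' y'].
  by apply/eqP; rewrite eq_complex dotE /=; apply/andP; split; apply/eqP; ring.
have -> : Tc (j + 2%:R) = axis j + Tc (j + 1) by rewrite /axis subrK.
have -> : toC (-1) = -1 by rewrite rmorphN rmorph1.
have -> : toC (2 - a) = 2 - toC a by rewrite rmorphB rmorph_nat.
have -> : (-1 * Tc j + (2 - toC a) * Tc (j + 1) + toC a * (axis j + Tc (j + 1))) * conjc (axis j) =
  toC a * (axis j * conjc (axis j)) + (2 * Tc (j + 1) - Tc j) * conjc (axis j) by ring.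
by rewrite e2; ring.
Qed.

End ComplexTriangle.

(** * Generalized diagonals are coded by words *)

Section Coding.
Variable R : realType.
Local Notation C := R[i].
Local Notation toC := (real_complex R).
Local Notation conjc := (@conjc R).
Local Notation Re := (@complex.Re R).
Local Notation Im := (@complex.Im R).

Variable T : 'I_3 -> 'rV[R]_2.
Hypothesis T_noncollinear : noncollinear T.
Variables u v : R.
Hypothesis cot_u : dot (plane (T 1) - plane (T 0)) (plane (T 2%:R) - plane (T 0)) = u * area T.
Hypothesis cot_v : normc (plane (T 1) - plane (T 0)) ^+ 2 -
  dot (plane (T 1) - plane (T 0)) (plane (T 2%:R) - plane (T 0)) = v * area T.
Local Notation m := (mirror_coef u v).
Let Tc (i : 'I_3) : C := plane (T i).
Let p := Tc 1 - Tc 0.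
Let c := Tc 2%:R - Tc 0.
Let S := cross p c.

Let S0 : S != 0.
Proof. by rewrite -normr_gt0; exact: (noncollinear_area T_noncollinear). Qed.

Lemma toC_1B (x y : R) : toC (1 - x - y) = 1 - toC x - toC y.
Proof. by rewrite !rmorphB rmorph1. Qed.

(** The affine function of the plane with values [F] at the vertices, by the
    formula of Cramer. *)
Definition interpolate (F : 'I_3 -> R) (z : C) : R :=
  F 0 + (F 1 - F 0) * (cross (z - plane (T 0)) (plane (T 2%:R) - plane (T 0)) /
    cross (plane (T 1) - plane (T 0)) (plane (T 2%:R) - plane (T 0))) +
  (F 2%:R - F 0) * (cross (plane (T 1) - plane (T 0)) (z - plane (T 0)) /
    cross (plane (T 1) - plane (T 0)) (plane (T 2%:R) - plane (T 0))).

Definition bary (i : 'I_3) (z : C) : R := interpolate (fun k => (k == i)%:R) z.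

Lemma interpolateT F k : interpolate F (plane (T k)) = F k.
Proof.
rewrite /interpolate -/(Tc k) -/(Tc 0) -/(Tc 1) -/(Tc 2%:R) -/p -/c -/S.
have c0 w : cross 0 w = 0 by rewrite crossE /= !mul0r subr0.
have c0' w : cross w 0 = 0 by rewrite crossE /= !mulr0 subr0.
case: (ord3P k) => ->; rewrite ?subrr -?/p -?/c ?c0 ?c0' ?crossvv ?mul0r ?mulr0 ?addr0 //.
  by rewrite -/S divff // mulr1 addrC subrK.
by rewrite -/S divff // mulr1 addrC subrK.
Qed.

Lemma interpolate_conv F (a b : R) z w : a + b = 1 ->
  interpolate F (toC a * z + toC b * w) = a * interpolate F z + b * interpolate F w.
Proof.
move=> ab; have -> : a = 1 - b by lra.
rewrite /interpolate -/(Tc 0) -/(Tc 1) -/(Tc 2%:R) -/p -/c -/S.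
have -> : toC (1 - b) * z + toC b * w - Tc 0 =
    toC (1 - b) * (z - Tc 0) + toC b * (w - Tc 0) by rewrite rmorphB rmorph1; ring.
by rewrite (crossDl _ _ c) (crossDr p) !(crossZl _ _ c) !(crossZr _ p); ring.
Qed.

Lemma interpolate_bary F z : interpolate F z = \sum_k bary k z * F k.
Proof.
rewrite /bary !big_ord_recl big_ord0 addr0.
have -> : lift ord0 (ord0 : 'I_2) = 1 by apply: val_inj.
have -> : lift ord0 (lift ord0 (ord0 : 'I_1)) = 2%:R by apply: val_inj.
have -> : (ord0 : 'I_3) = 0 by apply: val_inj.
by rewrite /interpolate /=; ring.
Qed.

Lemma bary_sum z : \sum_k bary k z = 1.
Proof.
transitivity (interpolate (fun=> 1) z).
  by rewrite interpolate_bary; apply: eq_bigr => k _; rewrite mulr1.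
by rewrite /interpolate subrr !mul0r !addr0.
Qed.

Lemma interpolate_sum F (a : 'I_3 -> R) (z : 'I_3 -> C) : \sum_k a k = 1 ->
  interpolate F (\sum_k toC (a k) * z k) = \sum_k a k * interpolate F (z k).
Proof.
rewrite !(sum_proper _ (isT : proper (0, 1, 2%:R))) /apex /= => a1.
have e : a 0 = 1 - a 1 - a 2%:R by lra.
rewrite /interpolate -/(Tc 0) -/(Tc 1) -/(Tc 2%:R) -/p -/c -/S e.
have -> : toC (1 - a 1 - a 2%:R) * z 0 + toC (a 1) * z 1 + toC (a 2%:R) * z 2%:R - Tc 0 =
    toC (1 - a 1 - a 2%:R) * (z 0 - Tc 0) + (toC (a 1) * (z 1 - Tc 0) +
    toC (a 2%:R) * (z 2%:R - Tc 0)).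
  move: (a 1) (a 2%:R) (z 0) (z 1) (z 2%:R) (Tc 0) => x y z0 z1 z2 t.
  by rewrite toC_1B; ring.
move: (z 0 - Tc 0) (z 1 - Tc 0) (z 2%:R - Tc 0) => z0 z1 z2.
by rewrite !(crossDl _ _ c) !(crossDr p) !(crossZl _ _ c) !(crossZr _ p); ring.
Qed.

Lemma plane_bary z : z = \sum_k toC (bary k z) * plane (T k).
Proof.
rewrite !(sum_proper _ (isT : proper (0, 1, 2%:R))) /apex /=.
have := bary_sum z; rewrite !(sum_proper _ (isT : proper (0, 1, 2%:R))) /apex /= => s1.
have -> : bary 0 z = 1 - bary 1 z - bary 2%:R z by lra.
rewrite -/(Tc 0) -/(Tc 1) -/(Tc 2%:R).
have -> : toC (1 - bary 1 z - bary 2%:R z) * Tc 0 + toC (bary 1 z) * Tc 1 + toC (bary 2%:R z) * Tc 2%:R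
    = Tc 0 + toC (bary 1 z) * p + toC (bary 2%:R z) * c.
  have gen x y (t0 t1 t2 : C) : toC (1 - x - y) * t0 + toC x * t1 + toC y * t2 =
      t0 + toC x * (t1 - t0) + toC y * (t2 - t0) by rewrite toC_1B; ring.
  exact: gen.
have -> : bary 1 z = cross (z - Tc 0) c / S.
  by rewrite /bary /interpolate /= -/(Tc 0) -/(Tc 1) -/(Tc 2%:R) -/p -/c -/S; ring.
have -> : bary 2%:R z = cross p (z - Tc 0) / S.
  by rewrite /bary /interpolate /= -/(Tc 0) -/(Tc 1) -/(Tc 2%:R) -/p -/c -/S; ring.
have eS : S = cross p c by [].
apply/eqP; rewrite -subr_eq0; set w := z - Tc 0.
have -> : z = w + Tc 0 by rewrite /w subrK.
move: S0; rewrite eS; case: (p) (c) w (Tc 0) => p0 p1 [c0 c1] [w0 w1] [t0 t1].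
rewrite !crossE /= => n0; rewrite eq_complex /=; apply/andP; split; apply/eqP; by field.
Qed.

Lemma reflection_sum j (a : 'I_3 -> R) (z : 'I_3 -> C) : \sum_k a k = 1 ->
  reflection T j (\sum_k toC (a k) * z k) = \sum_k toC (a k) * reflection T j (z k).
Proof.
rewrite !(sum_proper _ (isT : proper (0, 1, 2%:R))) /apex /= => a1.
have -> : a 0 = 1 - a 1 - a 2%:R by lra.
have conjZ (x : R) w : conjc (toC x * w) = toC x * conjc w.
  by rewrite rmorphM /= oppr0.
have conjD (x y : C) : conjc (x + y) = conjc x + conjc y by exact: rmorphD.
by rewrite /reflection !conjD !conjZ toC_1B; ring.
Qed.

Lemma interpolate_crossing F j z :
  interpolate (crossing 1 m j F) z = interpolate F (reflection T j z).
Proof.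
have uv0 := cot_sum_gt0 T_noncollinear cot_u cot_v.
rewrite {2}(plane_bary z) reflection_sum ?bary_sum //.
rewrite interpolate_sum ?bary_sum // interpolate_bary; apply: eq_bigr => k _.
congr (_ * _); rewrite -(crossing_reflection T_noncollinear cot_u cot_v) /crossing.
case: eqP => _; last by rewrite !mul1r interpolateT.
rewrite interpolate_sum ?(mirror_sum uv0) //.
by apply: eq_bigr => i _; rewrite interpolateT.
Qed.

Lemma bary_interior z : triangle_interior T z -> forall k, 0 < bary k (plane z).
Proof.
move=> [w [w0 w1 ->]] k.
have -> : plane (\sum_i w i *: T i) = \sum_i toC (w i) * plane (T i).
  by rewrite !(sum_proper _ (isT : proper (0, 1, 2%:R))) !planeD !planeZ.
rewrite /bary interpolate_sum // (bigD1 k) //= interpolateT eqxx mulr1.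
rewrite big1 ?addr0 // => i ik; by rewrite interpolateT (negbTE ik) mulr0.
Qed.

(** The middle of the segment is in the interior. *)
Lemma bary_segment y z : open_segment y z `<=` triangle_interior T ->
  forall k, 0 < bary k (plane y) + bary k (plane z).
Proof.
move=> h k; have h2 : 0 < 2^-1 :> R by rewrite invr_gt0.
have mid : open_segment y z ((1 - 2^-1) *: y + 2^-1 *: z).
  by exists 2^-1 => //; rewrite h2 invf_lt1 // ltr1n.
have := bary_interior (h _ mid) k; rewrite planeD !planeZ /bary interpolate_conv; last by lra.
have -> : (1 - 2^-1 : R) = 2^-1 by lra.
by rewrite -mulrDr pmulr_rgt0.
Qed.

Lemma side_coord i z a e : side T i z -> i != a -> i != e -> a != e ->
  exists2 t, 0 < t < 1 & z = (1 - t) *: T a + t *: T e.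
Proof.
move=> [t t01 ->]; rewrite ![i == _]eq_sym => /ord3_other[] -> /ord3_other[] ->;
  rewrite ?eqxx // => _; first by exists t.
by exists (1 - t); [lra|rewrite addrC; congr (_ *: _ + _ *: _); ring].
Qed.

Lemma bary_side i z : side T i z -> bary i (plane z) = 0.
Proof.
move=> [t t01 ->]; rewrite planeD !planeZ /bary interpolate_conv ?subrK // !interpolateT.
by case: (ord3P i) => -> /=; rewrite !mulr0 addr0.
Qed.

Lemma proper_shift i : proper (i, i + 1, i + 2%:R).
Proof. by case: (ord3P i) => ->. Qed.

Lemma cross_axis i z : cross (axis T i) (z - plane (T (i + 1))) =
  bary i z * cross (axis T i) (plane (T i) - plane (T (i + 1))).
Proof.
have -> : z - plane (T (i + 1)) = toC (bary i z) * (plane (T i) - plane (T (i + 1))) +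
    toC (bary (i + 2%:R) z) * axis T i.
  rewrite {1}[z]plane_bary; have := bary_sum z.
  rewrite !(sum_proper _ (proper_shift i)) /apex /= => s1.
  have -> : bary (i + 1) z = 1 - bary i z - bary (i + 2%:R) z by lra.
  by rewrite toC_1B /axis; ring.
by rewrite crossDr !crossZr crossvv mulr0 addr0.
Qed.

Lemma cos_scaled (X a : C) (s : R) : 0 < s ->
  dot X (toC s * a) / (normc X * normc (toC s * a)) = dot X a / (normc X * normc a).
Proof.
move=> s0; rewrite normcM normc_real gtr0_norm //.
have -> : dot X (toC s * a) = s * dot X a.
  by rewrite !dotE; case: X a => ? ? [? ?] /=; ring.
by rewrite mulrCA -mulf_div divff ?mul1r // gt_eqF.
Qed.

(** [X] and [Z] are the vectors from the point of reflection to the previous and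
    to the next point, and [a] is the direction of the side. Equal angles mean
    that the unit vectors of [X] and [Z] have opposite components along [a]; as
    they are on the same side of [a], their other components are equal. *)
Lemma law_of_reflection (a X Z : C) : 0 < cross a X * cross a Z ->
  - dot a X / (normc X * normc a) = dot a Z / (normc Z * normc a) ->
  exists l : R, a / conjc a * conjc Z = toC l * X.
Proof.
move=> c0 eqdot.
have pos w w' : 0 < `|cross w w'| -> 0 < normc w /\ 0 < normc w'.
  move=> h; have := cross_le w w'; move: (normc_ge0 w) (normc_ge0 w').
  by rewrite !le0r => /orP[/eqP->|->] /orP[/eqP->|->] //; rewrite ?mul0r ?mulr0 => h2;
    have := lt_le_trans h h2; rewrite ltxx.
have [na nX] : 0 < normc a /\ 0 < normc X.
  by apply: pos; rewrite normr_gt0; apply/eqP => e; move: c0; rewrite e mul0r ltxx.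
have [_ nZ] : 0 < normc a /\ 0 < normc Z.
  by apply: pos; rewrite normr_gt0; apply/eqP => e; move: c0; rewrite e mulr0 ltxx.
have dXZ : - dot a X * normc Z = dot a Z * normc X.
  have -> : - dot a X * normc Z =
      - dot a X / (normc X * normc a) * (normc X * normc Z * normc a).
    by field; rewrite !gt_eqF.
  by rewrite eqdot; field; rewrite !gt_eqF.
have cXZ : cross a X * normc Z = cross a Z * normc X.
  have sq : (cross a X * normc Z) ^+ 2 = (cross a Z * normc X) ^+ 2.
    have hX := dot_cross a X; have hZ := dot_cross a Z.
    have -> : (cross a X * normc Z) ^+ 2 =
       (dot a X ^+ 2 + cross a X ^+ 2) * normc Z ^+ 2 - (- dot a X * normc Z) ^+ 2 by ring.
    have -> : (cross a Z * normc X) ^+ 2 =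
       (dot a Z ^+ 2 + cross a Z ^+ 2) * normc X ^+ 2 - (dot a Z * normc X) ^+ 2 by ring.
    by rewrite hX hZ dXZ; ring.
  move/eqP: sq; rewrite eqf_sqr => /orP[/eqP //|/eqP opp].
  have : 0 < (cross a X * normc Z) * (cross a Z * normc X).
    have -> : cross a X * normc Z * (cross a Z * normc X) =
      cross a X * cross a Z * (normc X * normc Z) by ring.
    exact: mulr_gt0 c0 (mulr_gt0 nX nZ).
  by rewrite opp mulNr oppr_gt0 ltNge -expr2 sqr_ge0.
have a0 : a != 0 by apply/eqP => e; move: na; rewrite e normc0 ltxx.
have ca0 : conjc a != 0 by rewrite conjc_eq0.
exists (- normc Z / normc X); apply: (mulIf ca0).
rewrite mulrAC divfK //.
have nX0 : normc X != 0 by rewrite gt_eqF.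
move: dXZ cXZ nX0; clear c0 eqdot pos; move: (normc X) (normc Z) => x z; rewrite !dotE !crossE.
clear a0 ca0 na nX nZ; case: a X Z => a0 a1 [x0 x1] [z0 z1] /= dXZ cXZ n0.
apply/eqP; rewrite eq_complex /=; apply/andP; split; apply/eqP; rewrite ?mul0r ?subr0 ?addr0.
  transitivity ((a0 * z0 + a1 * z1) * x / x); first by field.
  by rewrite -dXZ; field.
transitivity (- ((a0 * z1 - a1 * z0) * x / x)); first by field.
by rewrite -cXZ; field.
Qed.


Lemma cross_side i y w : side T i y -> cross (axis T i) (w - plane y) =
  bary i w * cross (axis T i) (plane (T i) - plane (T (i + 1))).
Proof.
move=> sy; rewrite -[RHS]subr0 -[0 in RHS](mul0r (cross (axis T i) (plane (T i) - plane (T (i + 1))))).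
rewrite -(bary_side sy) -!cross_axis; move: (axis T i) (plane y) (plane _) => a y' t.
by rewrite !crossE; case: a w y' t => ? ? [? ?] [? ?] [? ?] /=; ring.
Qed.

Lemma axis_cross_neq0 i : cross (axis T i) (plane (T i) - plane (T (i + 1))) != 0.
Proof.
have := noncollinear_area T_noncollinear; rewrite -(area_cross T (proper_shift i)).
rewrite normr_gt0 /apex /side_end /= -/(axis T i); apply: contra => /eqP e.
rewrite -e; move: (plane (T i)) (plane (T _)) (axis T i) => a b d.
by rewrite !crossE; case: a b d => ? ? [? ?] [? ?] /=; apply/eqP; ring.
Qed.

Lemma cross_fixed F i y : side T i y ->
  interpolate (crossing 1 m i F) (plane y) = interpolate F (plane y).
Proof.
move=> [t _ ->]; rewrite planeD !planeZ !interpolate_conv ?subrK // !interpolateT.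
by have /and3P[h1 h2 _] := proper_shift i; rewrite !crossing_id // eq_sym.
Qed.

Lemma reflection_side i y : side T i y -> reflection T i (plane y) = plane y.
Proof.
move=> [t _ ->]; have ca := conj_axis_neq0 T_noncollinear i.
have -> : plane ((1 - t) *: T (i + 1) + t *: T (i + 2%:R)) =
    plane (T (i + 1)) + toC t * axis T i.
  by rewrite planeD !planeZ rmorphB rmorph1 /axis; ring.
have conjD (r q : C) : conjc (r + q) = conjc r + conjc q by exact: rmorphD.
have conjZ (r : R) w : conjc (toC r * w) = toC r * conjc w by rewrite rmorphM /= oppr0.
rewrite /reflection /tau conjD conjZ /omega; move: ca.
move: (axis T i) (conjc (axis T i)) (plane _) (conjc _) => a a' b b' a0.
by field.
Qed.

(** If a line is followed before a reflection, then its mirror image is followed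
    after it. *)
Lemma reflects_line F i x y z : side T i y ->
  angle x y (T (i + 1)) = angle z y (T (i + 2%:R)) ->
  0 < bary i (plane x) -> 0 < bary i (plane z) ->
  interpolate F (plane x) = 0 -> interpolate F (plane y) = 0 ->
  interpolate (crossing 1 m i F) (plane z) = 0.
Proof.
move=> sy an bx bz Fx Fy.
have k0 := axis_cross_neq0 i; have cX := cross_side (plane x) sy; have cZ := cross_side (plane z) sy.
have [l lP] : exists l : R, omega T i * conjc (plane z - plane y) = toC l * (plane x - plane y).
  apply: law_of_reflection.
    by rewrite cX cZ mulrACA -expr2 pmulr_rgt0 ?(mulr_gt0 bx bz) // exprn_even_gt0.
  have [t t01 yE] := sy; have t0 : 0 < t by lra. have t1 : 0 < 1 - t by lra.
  have e1 : plane (T (i + 1)) - plane y = toC t * - axis T i.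
    by rewrite yE planeD !planeZ rmorphB rmorph1 /axis; ring.
  have e2 : plane (T (i + 2%:R)) - plane y = toC (1 - t) * axis T i.
    by rewrite yE planeD !planeZ rmorphB rmorph1 /axis; ring.
  have := congr1 (@cos R) an; rewrite !cos_angle e1 e2 !cos_scaled // normcN.
  move: (axis T i) (plane x - plane y) (plane z - plane y) => a X Z.
  have -> : dot X (- a) = - dot a X.
    by rewrite !dotE; case: X a => ? ? [? ?] /=; ring.
  by have -> : dot Z a = dot a Z by rewrite !dotE; ring.
have -> : plane z = (plane z - plane y) + plane y by rewrite subrK.
rewrite interpolate_crossing.
have -> : reflection T i (plane z - plane y + plane y) =
    omega T i * conjc (plane z - plane y) + reflection T i (plane y).
  have conjD (r q : C) : conjc (r + q) = conjc r + conjc q by exact: rmorphD.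
  by rewrite /reflection conjD; ring.
rewrite lP (reflection_side sy).
have -> : toC l * (plane x - plane y) + plane y = toC l * plane x + toC (1 - l) * plane y.
  by rewrite rmorphB rmorph1; ring.
have l1 : l + (1 - l) = 1 by rewrite addrC subrK.
by rewrite (interpolate_conv _ _ _ l1) Fx Fy !mulr0 addr0.
Qed.

(** The point of the line through [T a] and [T e] where the affine function with
    values [F] vanishes. *)
Definition zero_between (F : 'I_3 -> R) (a e : 'I_3) : 'rV[R]_2 :=
  (1 - F a / (F a - F e)) *: T a + (F a / (F a - F e)) *: T e.

Fixpoint trace (st : state) (F : 'I_3 -> R) (w : seq bool) : seq 'rV[R]_2 :=
  if w is b :: w' then
    zero_between F (apex st) (side_end st (~~ b)) ::
      trace (turn b st) (crossing 1 m (side_end st b) F) w'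
  else [:: T (apex st)].

Definition orbit_of (st : state) (x : R) (w : seq bool) : seq 'rV[R]_2 :=
  [:: T (apex st), (1 - x) *: T (side_end st false) + x *: T (side_end st true) &
    trace st (crossing 1 m (apex st) (slope st x)) w].

Lemma size_trace st F w : size (trace st F w) = (size w).+1.
Proof. by elim: w st F => //= b w IH st F; rewrite IH. Qed.

Lemma bary_vertex i k : 0 < bary i (plane (T k)) -> k = i.
Proof. by rewrite /bary interpolateT; case: eqP => // _; rewrite ltxx. Qed.

(** The next point is between the apex and the end of the entry side that is not
    reflected; the affine function has opposite signs there. *)
Lemma turn_side st F z j : proper st -> straddles st F -> j != apex st ->
  side T j z -> interpolate F (plane z) = 0 ->
  exists2 b, j = side_end st b & 0 < sgb R b * F (apex st) /\
    z = zero_between F (apex st) (side_end st (~~ b)).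
Proof.
move=> pst /andP[Fl Fr] ji sz Fz.
have [b jb] : exists b, j = side_end st b.
  have [->|jl] := eqVneq j (side_end st false); first by exists false.
  by exists true; exact: proper_third pst ji jl.
exists b => //; have /and3P[h1 h2 h3] := pst.
have [t t01 zE] : exists2 t, 0 < t < 1 &
    z = (1 - t) *: T (apex st) + t *: T (side_end st (~~ b)).
  apply: (side_coord sz) => //; rewrite ?jb; case: (b) => //=; by rewrite eq_sym.
move: Fz; rewrite {1}zE planeD !planeZ interpolate_conv ?subrK // !interpolateT => Fz.
have F0 : 0 < sgb R b * F (apex st).
  have Fe : sgb R b * F (side_end st (~~ b)) < 0 by case: (b); rewrite /sgb /=; lra.
  have /andP[t0 t1] := t01; have t1' : 0 < 1 - t by lra.
  rewrite -(pmulr_rgt0 _ t1') mulrCA.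
  have -> : (1 - t) * F (apex st) = - (t * F (side_end st (~~ b))) by lra.
  by rewrite mulrN mulrCA oppr_gt0 pmulr_rlt0.
split => //; rewrite zE /zero_between.
have d0 : F (apex st) - F (side_end st (~~ b)) != 0.
  by apply/eqP; move: F0; case: (b); rewrite /sgb /=; lra.
have -> : F (apex st) / (F (apex st) - F (side_end st (~~ b))) = t.
  apply: (mulIf d0); rewrite divfK //; lra.
by [].
Qed.

(** The points of an orbit are successively computed from the line and the
    word. Unfolding the orbit amounts to keeping the triangle fixed and to
    reflecting the affine function that vanishes on the current segment. *)
Lemma orbit_word s st F y : proper st -> straddles st F ->
  side T (apex st) y -> interpolate F (plane y) = 0 ->
  s != [::] -> interpolate F (plane (head y s)) = 0 ->
  (forall k : nat, (k < size s)%N ->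
     open_segment (y :: s)`_k s`_k `<=` triangle_interior T) ->
  (forall k : nat, (k.+1 < size s)%N -> reflects T (y :: s)`_k s`_k s`_k.+1) ->
  range T (last y s) ->
  exists2 w, follows m st F w & s = trace st F w.
Proof.
elim: s st F y => // z s IH st F y pst sF sy Fy _ /= Fz seg law.
have by0 := bary_side sy.
have bz0 : 0 < bary (apex st) (plane z).
  by have := bary_segment (seg 0%N isT) (apex st); rewrite by0 add0r.
case: s IH seg law => [_ _ _|z2 s IH seg law] /=.
  move=> [k _ /= kz]; move: bz0; rewrite -kz => /bary_vertex ka.
  exists [::] => /=; last by rewrite ka.
  by move: Fz; rewrite -kz interpolateT ka => ->.
move=> lastT; have [i si ang] := law 0%N isT; rewrite /= in ang.
have ia : i != apex st.
  by apply: contraTneq bz0 => <-; rewrite bary_side // ltxx.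
have [b ib [Fb zE]] := turn_side pst sF ia si Fz.
have byi : 0 < bary i (plane y).
  by have := bary_segment (seg 0%N isT) i; rewrite /= (bary_side si) addr0.
have bz2 : 0 < bary i (plane z2).
  by have := bary_segment (seg 1%N isT) i; rewrite /= (bary_side si) add0r.
have G0 := reflects_line si ang byi bz2 Fy Fz.
have [w fw sE] : exists2 w, follows m (turn b st) (crossing 1 m i F) w &
    z2 :: s = trace (turn b st) (crossing 1 m i F) w.
  apply: (IH (turn b st) (crossing 1 m i F) z) => //.
  - exact: proper_turn.
  - by rewrite ib; exact: straddles_turn.
  - by rewrite apex_turn -ib.
  - by rewrite cross_fixed.
  - by move=> k ks; apply: (seg k.+1).
  - by move=> k ks; apply: (law k.+1).
by exists (b :: w); rewrite /= -ib; [rewrite Fb|rewrite -zE sE].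
Qed.

(** The first point of reflection is on the side opposite to the initial vertex,
    which is an end of both other sides; its position gives the coordinate
    [x]. *)
Lemma diagonal_word s : generalized_diagonal T s -> exists st x w,
  [/\ proper st, hits m st x w & s = orbit_of st x w].
Proof.
move=> [[size2 seg law] [i _ hi] lastT].
case: s size2 seg law hi lastT => // y0 [//|y1 s] _ seg law /= hi lastT.
have b1 k : k != i -> 0 < bary k (plane y1).
  move=> ki; have := bary_segment (seg 0%N isT) k.
  by rewrite /= -hi {1}/bary interpolateT eq_sym (negbTE ki) add0r.
case: s seg law lastT => [_ _ /= [k _ kE]|y2 s seg law lastT].
  have [pst /andP[h1 h2]] : proper (i, i + 1, i + 2%:R) /\ (i + 1 != i) && (i + 2%:R != i).
    split; first exact: proper_shift.
    by have /and3P[h1 h2 _] := proper_shift i; rewrite eq_sym h1 eq_sym.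
  have k1 := bary_vertex (_ : 0 < bary _ (plane (T k))).
  have e1 : k = i + 1 by apply: bary_vertex; rewrite kE; exact: b1.
  have e2 : k = i + 2%:R by apply: bary_vertex; rewrite kE; exact: b1.
  by have /and3P[_ _] := pst; rewrite /= -e1 -e2 eqxx.
have [j sj ang] := law 0%N isT; rewrite /= in ang.
have ji : j = i.
  by apply/eqP; apply: contraT => /b1; rewrite bary_side // ltxx.
rewrite {j}ji /= in sj ang; have [t t01 y1E] := sj.
pose st : state := (i, i + 1, i + 2%:R); have pst : proper st := proper_shift i.
have /andP[t0 t1] := t01; have /and3P[h1 h2 h3] := pst.
have sl : [/\ slope st t i = 0, slope st t (i + 1) = - t & slope st t (i + 2%:R) = 1 - t].
  by rewrite /slope /apex /side_end /= eqxx eq_sym (negbTE h1) eqxx ![i + 2%:R == _]eq_sym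
    (negbTE h2) (negbTE h3).
have [s0 s1 s2] := sl.
have F0 : interpolate (slope st t) (plane y0) = 0 by rewrite -hi interpolateT.
have F1 : interpolate (slope st t) (plane y1) = 0.
  rewrite [y1]y1E planeD !planeZ interpolate_conv ?subrK // !interpolateT s1 s2; ring.
have b2 : 0 < bary i (plane y2).
  by have := bary_segment (seg 1%N isT) i; rewrite /= (bary_side sj) add0r.
have bi : 0 < bary i (plane y0) by rewrite -hi /bary interpolateT eqxx.
have F2 := reflects_line sj ang bi b2 F0 F1.
have [w fw sE] : exists2 w, follows m st (crossing 1 m i (slope st t)) w &
    y2 :: s = trace st (crossing 1 m i (slope st t)) w.
  apply: (@orbit_word _ _ _ y1) => //.
  - rewrite /straddles /side_end /= !crossing_id 1?eq_sym // s1 s2; apply/andP; split; lra.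
  - by rewrite cross_fixed.
  - by move=> k ks; apply: (seg k.+1).
  - by move=> k ks; apply: (law k.+1).
exists st, t, w; split => //; first by rewrite /hits t0 t1.
by rewrite /orbit_of -sE -hi -y1E.
Qed.

End Coding.

(** * Counting generalized diagonals *)

Lemma counting_le_size (R : realType) (U : choiceType) (A : set U) (s : seq U) :
  A `<=` [set` s] -> (counting A <= (size s)%:R%:E :> \bar R)%E.
Proof.
move=> As; have finA : finite_set A := sub_finite_set As (finite_seq s).
rewrite /counting asboolT // lee_fin ler_nat.
apply: uniq_leq_size; first exact: finmap.fset_uniq.
by move=> x; rewrite in_fset_set // inE => /As.
Qed.

Section Bound.
Variable R : realType.
Variable T : 'I_3 -> 'rV[R]_2.
Hypothesis T_noncollinear : noncollinear T.
Variables u v : R.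
Hypothesis cot_u : dot (plane (T 1) - plane (T 0)) (plane (T 2%:R) - plane (T 0)) = u * area T.
Hypothesis cot_v : normc (plane (T 1) - plane (T 0)) ^+ 2 -
  dot (plane (T 1) - plane (T 0)) (plane (T 2%:R) - plane (T 0)) = v * area T.
Local Notation m := (mirror_coef u v).

Lemma num_generalized_diagonals_le n :
  (num_generalized_diagonals T n <= (num_diagonals m n)%:R%:E :> \bar R)%E.
Proof.
have uv0 := cot_sum_gt0 T_noncollinear cot_u cot_v.
pose ws := [seq (st, w) | st <- states, w <- diagonals m st n].
pose orbits := [seq orbit_of T u v p.1 (coord m p.1 p.2) p.2 | p <- ws].
have -> : num_diagonals m n = size orbits.
  by rewrite size_map size_allpairs_dep sumnE big_map.
apply: counting_le_size => s [gs sn] /=.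
have [st [x [w [pst hw sE]]]] := diagonal_word T_noncollinear cot_u cot_v gs.
have wn : w \in diagonals m st n.
  rewrite mem_diagonals; apply/andP; split; last by apply/asboolP; exists x.
  by move: sn; rewrite sE /reflections subn2 /= size_trace => /ltnW.
apply/mapP; exists (st, w); first by apply/allpairsPdep; exists st, w; rewrite mem_states.
by rewrite /= (coordE (mirror_diag uv0) (mirror_sum uv0) pst hw).
Qed.

End Bound.

Lemma cot_of_angles (R : realType) (T : 'I_3 -> 'rV[R]_2) (a b : R) :
  noncollinear T -> 0 < a < pi -> 0 < b < pi ->
  angle (T 1) (T 0) (T 2%:R) = a -> angle (T 0) (T 1) (T 2%:R) = b ->
  dot (plane (T 1) - plane (T 0)) (plane (T 2%:R) - plane (T 0)) = cot a * area T /\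
  normc (plane (T 1) - plane (T 0)) ^+ 2 -
    dot (plane (T 1) - plane (T 0)) (plane (T 2%:R) - plane (T 0)) = cot b * area T.
Proof.
move=> nc ha hb ea eb; have area0 := noncollinear_area nc.
have h0 : `|cross (plane (T 0) - plane (T 1)) (plane (T 2%:R) - plane (T 1))| = area T.
  rewrite /area -normrN; congr `|_|; rewrite !crossE.
  by case: (plane _) (plane _) (plane _) => ? ? [? ?] [? ?] /=; ring.
have h1 : cross (plane (T 1) - plane (T 0)) (plane (T 2%:R) - plane (T 0)) != 0.
  by rewrite -normr_gt0.
split; last rewrite -eb cot_angle ?eb //.
- by rewrite -ea cot_angle ?ea // -/(area T) divfK // gt_eqF.
- rewrite h0 divfK ?gt_eqF // normc_sqr !dotE.
  by case: (plane _) (plane _) (plane _) => ? ? [? ?] [? ?] /=; ring.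
- by rewrite -normr_gt0 h0.
Qed.

Theorem theorem4 (R : realType) :
  {ae (@lebesgue_measure R \x @lebesgue_measure R)%E, forall ab : R * R,
    0 < ab.1 -> 0 < ab.2 -> ab.1 + ab.2 < pi ->
    forall T : 'I_3 -> 'rV[R]_2,
      noncollinear T ->
      angle (T 1) (T 0) (T 2%:R) = ab.1 ->
      angle (T 0) (T 1) (T 2%:R) = ab.2 ->
      forall eps : R, 0 < eps ->
        exists2 C : R, 0 < C &
          forall n : nat,
            (num_generalized_diagonals T n < (C * expR (n%:R `^ eps))%:E)%E}.
Proof.
have [N [mN N0 sub]] := ae_not_small R size_comparisons degree_comparisons.
exists N; split => // ab /= nab; apply: sub => /= small; apply: nab.
move=> a0 b0 abpi T nc ea eb eps eps0.
have ha : 0 < ab.1 < pi by lra. have hb : 0 < ab.2 < pi by lra.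
have {}small := small ha hb.
have [cot_u cot_v] := cot_of_angles nc ha hb ea eb.
have uv0 := cot_sum_gt0 nc cot_u cot_v.
have md := mirror_diag uv0; have ms := mirror_sum uv0.
pose L : R := \sum_i \sum_j normc (plane (T i) - plane (T j)).
have sidesL i j : normc (plane (T i) - plane (T j)) <= L.
  rewrite /L (bigD1 i) //= (bigD1 j) //= -addrA lerDl.
  by rewrite addr_ge0 ?sumr_ge0 // => k _; rewrite ?sumr_ge0 // ?normc_ge0 // => l _; rewrite normc_ge0.
have area0 := noncollinear_area nc.
have areaP st : proper st -> area T <=
    `|cross (plane (T (side_end st false)) - plane (T (apex st)))
            (plane (T (side_end st true)) - plane (T (side_end st false)))|.
  by move=> pst; rewrite area_cross.
have reflP := crossing_reflection nc cot_u cot_v.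
have far := far_le ms (omega_unit nc) reflP sidesL areaP.
have [B B0 sep] := separation_of_comparisons uv0 area0 far small.
pose delta n : R := expR (- (B * n.+1%:R ^+ 2)).
have delta0 n : 0 < delta n by exact: expR_gt0.
have [C C0 hC] := num_diagonals_weakly_exponential md ms (omega_unit nc) reflP area0
  sidesL areaP delta0 sep B0 (fun=> erefl) eps0.
exists C => // n.
apply: le_lt_trans (num_generalized_diagonals_le nc cot_u cot_v n) _.
by rewrite lte_fin; apply: lt_le_trans (hC n); rewrite ltr_nat.
Qed.
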